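(* Let $(M,F,\mathfrak m)$ be a smooth reversible Finsler manifold equipped with a smooth positive reference measure $\mathfrak m$, and let $K\in\mathbb R$. Assume that $(M,\mathsf d_F,\mathfrak m)$ satisfies $\mathrm{BCD}(K,\infty)$, where $\mathsf d_F$ is the distance induced by $F$. Then for every $x\in M$ the norm $F_x:=F|_{T_xM}$ is induced by an inner product on $T_xM$. In particular, the Finsler structure is Riemannian.
   Context: A smooth reversible Finsler manifold is a smooth manifold $M$ with a Finsler structure $F:TM\to[0,\infty)$ in the standard sense (smooth off the zero section, positively 1-homogeneous and strongly convex on each tangent space) with $F(-v)=F(v)$ for all $v$, so that each $F_x$ is a norm on $T_xM$. The distance $\mathsf d_F(x,y)$ is the infimum of the lengths $\int F(\dot\gamma)\,dt$ over piecewise $C^1$ curves $\gamma$ from $x$ to $y$. A smooth positive measure is one with a smooth positive density in local coordinates. For a metric space $(X,\mathsf d)$, $\mathcal P_2(X)$ denotes the Borel probability measures with finite second moment, and $W_2$ is the 2-Wasserstein distance, $W_2^2(\mu,\nu)=\inf_{\pi\in\Pi(\mu,\nu)}\int \mathsf d(x,y)^2\,d\pi(x,y)$, where $\Pi(\mu,\nu)$ is the set of couplings of $\mu$ and $\nu$. For a reference measure $\mathfrak m$ on $X$, the Boltzmann entropy is $\mathrm{Ent}_{\mathfrak m}(\mu)=\int\rho\ln\rho\,d\mathfrak m$ if $\mu=\rho\,\mathfrak m\ll\mathfrak m$, and $\mathrm{Ent}_{\mathfrak m}(\mu)=+\infty$ otherwise. A geodesic metric measure space $(X,\mathsf d,\mathfrak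 m)$ satisfies $\mathrm{BCD}(K,\infty)$ if for every finite family $\mu_1,\dots,\mu_m\in\mathcal P_2(X)$ and all weights $\lambda_i>0$ with $\sum_i\lambda_i=1$, there exists $\bar\mu\in\operatorname{argmin}_{\eta\in\mathcal P_2(X)}\sum_i\lambda_iW_2^2(\eta,\mu_i)$ (such a minimizer is called a Wasserstein barycenter) such that $$\mathrm{Ent}_{\mathfrak m}(\bar\mu)\le\sum_i\lambda_i\mathrm{Ent}_{\mathfrak m}(\mu_i)-\frac K2\sum_i\lambda_iW_2^2(\bar\mu,\mu_i).$$ *)

(* Defs.v *)
From HB Require Import structures.
From mathcomp Require Import all_boot all_order all_algebra.
From mathcomp Require Import all_classical all_reals all_analysis.

Set Implicit Arguments.
Unset Strict Implicit.
Unset Printing Implicit Defensive.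

Import Order.TTheory GRing.Theory Num.Theory numFieldNormedType.Exports.

Local Open Scope classical_set_scope.
Local Open Scope ring_scope.

(** Meaningful for [U] open only. The directional derivatives [ 'D_v f ] of a
    function of class C^(k+1) are required to be of class C^k for every [v],
    which in finite dimension is the usual condition on partial derivatives. *)
Fixpoint class_C (R : realType) (V W : normedModType R) (k : nat)
    (U : set V) (f : V -> W) : Prop :=
  if k is k'.+1 then
    (forall x, U x -> differentiable f x) /\
    (forall v, class_C k' U ('D_v f))
  else forall x, U x -> {for x, continuous f}.

Definition smooth_on (R : realType) (V W : normedModType R)
    (U : set V) (f : V -> W) : Prop := forall k, class_C k U f.

(** [chart_map i] and [chart_inv i] are total functions; only the values of [chart_map i]
    on [chart_dom i] and of [chart_inv i] on [chart_map i @` chart_dom i] are meaningful. *)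
Record smooth_manifold (R : realType) (n : nat) (M : topologicalType) :=
  SmoothManifold {
    chart : Type;
    chart_dom : chart -> set M;
    chart_map : chart -> M -> 'rV[R]_n;
    chart_inv : chart -> 'rV[R]_n -> M;
    mfd_hausdorff : hausdorff_space M;
    mfd_second_countable : @second_countable M;
    chart_dom_cover : forall x, exists i, chart_dom i x;
    chart_dom_open : forall i, open (chart_dom i);
    chart_codom_open : forall i, open (chart_map i @` chart_dom i);
    chart_mapK : forall i x, chart_dom i x -> chart_inv i (chart_map i x) = x;
    chart_map_continuous : forall i x, chart_dom i x -> {for x, continuous (chart_map i)};
    chart_inv_continuous : forall i x, chart_dom i x ->
      {for chart_map i x, continuous (chart_inv i)};
    transition_smooth : forall i j,
      smooth_on (chart_map i @` (chart_dom i `&` chart_dom j)) (chart_map j \o chart_inv i)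
  }.

(** A tangent vector at [x] is a family of coordinate vectors, one for each
    chart around [x], related by the differentials of the transition maps; the
    components at the charts not containing [x] are set to 0. *)
Section TangentSpace.
Variables (R : realType) (n : nat) (M : topologicalType).
Variables (A : smooth_manifold R n M) (x : M).

Definition tangent_family : {pred chart A -> 'rV[R]_n} := fun v =>
  `[< (forall i j, chart_dom i x -> chart_dom j x ->
         v j = 'd (chart_map j \o chart_inv (s := A) i) (chart_map i x) (v i)) /\
      (forall i, ~ chart_dom i x -> v i = 0) >].

Fact tangent_family_submod_closed : submod_closed tangent_family.
Proof.
split.
  by apply/asboolP; split => [i j _ _|i _] //; rewrite !fctE raddf0.
move=> a u v /asboolP[u1 u2] /asboolP[v1 v2]; apply/asboolP; split.
  move=> i j xi xj; rewrite !fctE (u1 i j xi xj) (v1 i j xi xj).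
  by rewrite linearP.
by move=> i xi; rewrite !fctE u2// v2// scaler0 addr0.
Qed.

HB.instance Definition _ :=
  GRing.isSubmodClosed.Build R (chart A -> 'rV[R]_n) tangent_family
    tangent_family_submod_closed.

Record tangent := Tangent {
  tcoord :> chart A -> 'rV[R]_n;
  _ : tcoord \in tangent_family }.

HB.instance Definition _ := [isSub for tcoord].
HB.instance Definition _ := [Choice of tangent by <:].
HB.instance Definition _ := [SubChoice_isSubLmodule of tangent by <:].

End TangentSpace.

Section Finsler.
Variables (R : realType) (n : nat) (M : topologicalType).
Variable A : smooth_manifold R n M.

(** Strong convexity is positive definiteness of the fundamental tensor: the
    second derivative of [F_x ^ 2 / 2] at [v] in the direction [w]. *)
Record finsler_structure := FinslerStructure {
  finsler_norm :> forall x : M, tangent A x -> R;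
  finsler_ge0 : forall x v, 0 <= finsler_norm (x := x) v;
  finsler_homogeneous : forall x (v : tangent A x) (a : R), 0 < a ->
    finsler_norm (a *: v) = a * finsler_norm v;
  finsler_strongly_convex : forall x (v w : tangent A x), v != 0 -> w != 0 ->
    0 < derive1n 2 (fun s : R => finsler_norm (v + s *: w) ^+ 2 / 2) 0;
  finsler_smooth : forall i, exists f : 'rV[R]_n * 'rV[R]_n -> R,
    smooth_on ((chart_map (s := A) i @` chart_dom i) `*` [set v | v != 0]) f /\
    forall x (v : tangent A x), chart_dom i x -> v != 0 ->
      finsler_norm v = f (chart_map i x, v i)
  }.

Definition reversible (F : finsler_structure) : Prop :=
  forall x (v : tangent A x), F x (- v) = F x v.

Definition C1_curve_on (J : set R) (c : R -> M) : Prop :=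
  exists2 U, open U /\ J `<=` U & forall t, U t ->
    {for t, continuous c} /\
    forall i, chart_dom (s := A) i (c t) ->
      (\near t, derivable (chart_map i \o c) t 1) /\
      {for t, continuous (derive1 (chart_map i \o c))}.

(** Each piece is the restriction of a curve that is C^1 near the closed
    subinterval, i.e. it is C^1 up to the (one-sided) end points. *)
Definition piecewise_C1 (c : R -> M) : Prop :=
  exists2 s : seq R, itv_partition 0 1 s &
    forall k, (k < size s)%N ->
      let J := `[nth 0 (0 :: s) k, nth 0 s k]%classic in
      exists2 c', C1_curve_on J c' & forall t, J t -> c t = c' t.

Definition is_velocity (c : R -> M) (t : R) (v : tangent A (c t)) : Prop :=
  forall i, chart_dom i (c t) -> is_derive t 1 (chart_map i \o c) (v i).

(** [F (c' t)], with value 0 at the finitely many times where the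
    velocity of a piecewise C^1 curve may fail to exist. *)
Definition speed (F : finsler_structure) (c : R -> M) (t : R) : R :=
  xget 0 [set F (c t) v | v in @is_velocity c t].

Definition curve_length (F : finsler_structure) (c : R -> M) : \bar R :=
  (\int[lebesgue_measure]_(t in `[0%R, 1%R]) (speed F c t)%:E)%E.

Definition finsler_dist (F : finsler_structure) (x y : M) : \bar R :=
  ereal_inf [set curve_length F c | c in
    [set c | [/\ piecewise_C1 c, c 0 = x & c 1 = y]]].

Definition riemannian_metric (g : forall x : M, {dot tangent A x for idfun}) :
    Prop :=
  forall i, exists G : 'rV[R]_n -> 'M[R]_n,
    smooth_on (chart_map (s := A) i @` chart_dom i) G /\
    forall x (v w : tangent A x), chart_dom i x ->
      g x v w = (v i *m G (chart_map i x) *m (w i)^T) 0 0.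

Definition induced_by_inner_product (F : finsler_structure) (x : M) : Prop :=
  exists g : {dot tangent A x for idfun}, forall v, F x v = Num.sqrt (g v v).

Definition riemannian (F : finsler_structure) : Prop :=
  exists2 g : forall x : M, {dot tangent A x for idfun},
    riemannian_metric g & forall x v, F x v = Num.sqrt (g x v v).

End Finsler.

Notation borel X := (g_sigma_algebraType (@open X)).

(** The n-dimensional Lebesgue measure, as the Borel measure giving boxes their
    volume (which determines it). *)
Definition is_lebesgue (R : realType) (n : nat)
    (L : {measure set (borel 'rV[R]_n) -> \bar R}) : Prop :=
  forall a b : 'rV[R]_n, (forall j, a 0 j <= b 0 j) ->
    L [set v | forall j, a 0 j <= v 0 j <= b 0 j] =
    (\prod_j (b 0 j - a 0 j))%:E.

Definition smooth_positive_measure (R : realType) (n : nat)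
    (M : ptopologicalType) (A : smooth_manifold R n M)
    (m : {measure set (borel M) -> \bar R}) : Prop :=
  exists2 L : {measure set (borel 'rV[R]_n) -> \bar R}, is_lebesgue L &
    forall i : chart A, exists rho : 'rV[R]_n -> R,
      [/\ smooth_on (chart_map i @` chart_dom i) rho,
          forall y, (chart_map i @` chart_dom i) y -> 0 < rho y &
          forall B : set (borel M), measurable B -> B `<=` chart_dom i ->
            m B = (\int[L]_(y in chart_map i @` B) (rho y)%:E)%E].

(** [metric_nbhs] makes [borel X] the Borel sigma-algebra of the distance [d]. *)
Record is_metric (R : realType) (X : topologicalType) (d : X -> X -> \bar R) :
    Prop := IsMetric {
  metric_fin : forall x y, d x y \is a fin_num;
  metric_ge0 : forall x y, (0 <= d x y)%E;
  metric_eq0 : forall x y, d x y = 0%E <-> x = y;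
  metric_sym : forall x y, d x y = d y x;
  metric_triangle : forall x y z, (d x z <= d x y + d y z)%E;
  metric_nbhs : forall x (B : set X), nbhs x B <->
    exists2 e : R, 0 < e & [set y | (d x y < e%:E)%E] `<=` B
}.

Definition geodesic (R : realType) (X : topologicalType)
    (d : X -> X -> \bar R) : Prop :=
  forall x y, exists c : R -> X, [/\ c 0 = x, c 1 = y &
    forall s t, 0 <= s <= 1 -> 0 <= t <= 1 ->
      d (c s) (c t) = (`|s - t|%:E * d x y)%E].

Section Wasserstein.
Variables (R : realType) (X : ptopologicalType) (d : X -> X -> \bar R).

Local Notation P := (probability (borel X) R).

Local Open Scope ereal_scope.

Definition P2 (mu : P) : Prop :=
  exists x0 : X, \int[mu]_x (d x0 x ^+ 2) < +oo.

Definition couplings (mu nu : P) :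
    set (probability (borel X * borel X)%type R) :=
  [set p | forall B, measurable B ->
     p (B `*` setT) = mu B /\ p (setT `*` B) = nu B].

Definition W2sq (mu nu : P) : \bar R :=
  ereal_inf [set \int[p]_z (d z.1 z.2 ^+ 2) | p in couplings mu nu].

Definition barycenter_cost (k : nat) (lambda : 'I_k -> R) (mu : 'I_k -> P)
    (eta : P) : \bar R :=
  \sum_(i < k) (lambda i)%:E * W2sq eta (mu i).

Definition is_barycenter (k : nat) (lambda : 'I_k -> R) (mu : 'I_k -> P)
    (nu : P) : Prop :=
  P2 nu /\ forall eta, P2 eta ->
    barycenter_cost lambda mu nu <= barycenter_cost lambda mu eta.

Variable m : {measure set (borel X) -> \bar R}.

Definition is_density (mu : P) (rho : X -> R) : Prop :=
  [/\ measurable_fun setT (rho : borel X -> R), forall x, (0 <= rho x)%R &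
      forall B, measurable B -> mu B = \int[m]_(x in B) (rho x)%:E].

(** The difference of the integrals of the positive and negative parts is taken
    with the convention [+oo - +oo = +oo] (dual addition); [ln 0 = 0] makes
    [rho * ln rho] vanish where [rho] does. *)
Definition Ent (mu : P) : \bar R :=
  match pselect (exists rho, is_density mu rho) with
  | left e =>
      let f x := (projT1 (cid e) x * ln (projT1 (cid e) x))%:E in
      (\int[m]_x f^\+ x - \int[m]_x f^\- x)%dE
  | right _ => +oo
  end.

(** The sum of entropies uses dual addition, so that it is [+oo] as soon as one
    of the entropies is. *)
Definition BCD (K : R) : Prop :=
  [/\ is_metric d, geodesic d &
    forall (k : nat) (mu : 'I_k -> P) (lambda : 'I_k -> R),
      (forall i, P2 (mu i)) -> (forall i, 0 < lambda i)%R ->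
      (\sum_(i < k) lambda i = 1)%R ->
      exists2 nu, is_barycenter lambda mu nu &
        Ent nu <= (\sum_(i < k) ((lambda i)%:E * Ent (mu i)))%dE
                  - (K / 2)%:E * \sum_(i < k) (lambda i)%:E * W2sq nu (mu i)].

End Wasserstein.

(* Main.v *)
Require Import Defs.
From HB Require Import structures.
From mathcomp Require Import all_boot all_order all_algebra.
From mathcomp Require Import all_classical all_reals all_analysis.
From mathcomp Require Import measurable_realfun ring lra.

Set Implicit Arguments.
Unset Strict Implicit.
Unset Printing Implicit Defensive.

Import Order.TTheory GRing.Theory Num.Theory numFieldNormedType.Exports.

Local Open Scope classical_set_scope.
Local Open Scope ring_scope.

(** Fix a point, a chart around it and the norm [N] that [F] induces there, and put E = N^2 / 2,
    which is even, 2-homogeneous and strongly convex. The heart of the proof is that the Hessian of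
    E is the same at all nonzero vectors ([energy_hessian_constant]). Euler's relation
    [hessian_self] then gives N(v)^2 = H(v, v) for a single form H, and polarization of [F]^2 yields
    the inner products and the smooth metric.

    At a small scale eta around the point, the space is (R^n, N, Lebesgue) up to factors 1 - tau and
    1 + tau ([blowup], [finsler_blowups]), and the curvature term, of order eta^2, becomes
    negligible. The upper estimate of the distance uses straight segments, the lower one calibration
    by the support covectors of [N] ([mink_support], [curve_length_ge]).

    In the model take the sites v, -v, w, -w with equal weights. As dE is odd, 0 is a critical point
    of the averaged energy. Let H_i be the Hessian of E at minus the i-th site x_i, G the average of
    the H_i, and Q_i = H_i G^-1, acting on rows. To second order, the barycenter of the points x_i +
    d y_i is d times the average of the y_i Q_i; if every y_i Q_i lies in the unit ellipsoid of G,
    it lies in the G-ball of radius d. For uniform measures on the sets of such points, the entropy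
    inequality is a Brunn-Minkowski inequality ([barycenter_brunn_minkowski]), and in the limit it
    says that the weighted sum of the ln c_i is at most 0, where c_i is the factor 1 / |det Q_i|
    ([volume_factors_le]). But ln det is strictly concave: distinct Hessians H1 and H2 give c1 c2 >
    1 ([volume_gap]), a contradiction.

    The support of the barycenter is located by a variational argument ([barycenter_retract]). A
    retraction into the target set lowers the averaged squared distance to the source points by a
    definite amount off the target, so pushing the barycenter forward would lower its cost unless it
    is already concentrated on the target. The decrease comes from convexity of E along segments and
    its Taylor expansion at the -x_i ([energy_retract], [gain_average]). *)

Section row_norm.
Variables (R : realType) (n : nat).
Implicit Types (u v : 'rV[R]_n).

Lemma coord_le_norm u j : `|u 0 j| <= `|u|.
Proof.
rewrite [leRHS]/Num.Def.normr/= mx_normrE.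
exact: (le_bigmax _ (fun ij => `|u ij.1 ij.2|) (0, j)).
Qed.

Lemma norm_le_coord u (e : R) : 0 <= e -> (forall j, `|u 0 j| <= e) -> `|u| <= e.
Proof.
move=> e0 ue; rewrite [leLHS]/Num.Def.normr/= mx_normrE bigmax_le// => -[i j] _ /=.
by rewrite ord1.
Qed.

Lemma norm_lt_coord u (e : R) : 0 < e -> (forall j, `|u 0 j| < e) -> `|u| < e.
Proof.
move=> e0 ue; rewrite [ltLHS]/Num.Def.normr/= mx_normrE bigmax_lt// => -[i j] _ /=.
by rewrite ord1.
Qed.

End row_norm.

(** * Closure properties of C^k maps *)

Lemma near_eq_differentiable (R : numFieldType) (V W : normedModType R)
    (f g : V -> W) (x : V) :
  {near x, f =1 g} -> differentiable f x -> differentiable g x.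
Proof.
move=> fg df.
have key : g \o shift x = cst (g x) + 'd f x +o_ 0 id.
  apply/eqaddoP => e e0.
  have /eqaddoP /(_ e e0) := diff_locally df.
  have fg0 : \forall h \near (0 : V), f (h + x) = g (h + x).
    rewrite (near_shift x)/=; near=> y; rewrite /= sub0r addrNK.
    by near: y.
  apply: filterS2 fg0 => h /=.
  by rewrite !fctE /= => ->; rewrite (nbhs_singleton fg).
have dg := diff_unique (diff_continuous df) key.
by apply/diff_locallyP; rewrite dg; split => //; exact: diff_continuous.
Unshelve. all: by end_near. Qed.

Section class_C_theory.
Variable R : realType.
Implicit Types V W : normedModType R.

Lemma eq_class_C V W k (U : set V) (f g : V -> W) : open U ->
  (forall x, U x -> f x = g x) -> class_C k U f -> class_C k U g.
Proof.
move=> oU; elim: k f g => [|k IH] f g fg /=.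
  move=> cf x Ux; have := cf x Ux.
  rewrite /prop_for /continuous_at -(fg x Ux); apply: cvg_trans; apply: near_eq_cvg.
  by near=> y; apply/fg; near: y; apply: open_nbhs_nbhs.
have fgn x : U x -> {near x, f =1 g}.
  by move=> Ux; near=> y; apply/fg; near: y; apply: open_nbhs_nbhs.
move=> [df dfk]; split => [x Ux|v].
  exact: near_eq_differentiable (fgn x Ux) (df x Ux).
apply: IH (dfk v) => x Ux; exact: near_eq_derive (fgn x Ux).
Unshelve. all: by end_near. Qed.

Lemma class_C_differentiable V W k (U : set V) (f : V -> W) x :
  class_C k.+1 U f -> U x -> differentiable f x.
Proof. by move=> [df _]; exact: df. Qed.

Lemma class_C_continuous V W k (U : set V) (f : V -> W) x :
  class_C k U f -> U x -> {for x, continuous f}.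
Proof.
case: k => [|k] cf Ux; first exact: cf.
exact/differentiable_continuous/(class_C_differentiable cf).
Qed.

Lemma class_CS V W k (U : set V) (f : V -> W) : class_C k.+1 U f -> class_C k U f.
Proof.
elim: k f => [|k IH] f cf.
  by move=> x; exact: class_C_continuous cf.
by split => [x|v]; [exact: class_C_differentiable cf|exact/IH/(cf.2 v)].
Qed.

Lemma class_C_cst V W k (U : set V) (c : W) : class_C k U (cst c).
Proof.
elim: k c => [|k IH] c /=; first by move=> x _; exact: cst_continuous.
split => [x _|v]; first exact: differentiable_cst.
have -> : 'D_v (cst c : V -> W) = cst 0 by apply/funext => x; exact: derive_cst.
exact: IH.
Qed.

Lemma class_CD V W k (U : set V) (f g : V -> W) : open U ->
  class_C k U f -> class_C k U g -> class_C k U (f + g).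
Proof.
move=> oU; elim: k f g => [|k IH] f g /=.
  by move=> cf cg x Ux; apply: continuousD; [exact: cf|exact: cg].
move=> [df dfk] [dg dgk]; split => [x Ux|v].
  by apply: differentiableD; [exact: df|exact: dg].
apply: (@eq_class_C _ _ _ _ ('D_v f + 'D_v g)) => //; last exact: IH.
by move=> x Ux; rewrite deriveD//; apply: diff_derivable; [exact: df|exact: dg].
Qed.

Lemma class_CM V k (U : set V) (f g : V -> R) : open U ->
  class_C k U f -> class_C k U g -> class_C k U (f * g).
Proof.
move=> oU; elim: k f g => [|k IH] f g.
  by move=> cf cg x Ux; apply: continuousM; [exact: cf|exact: cg].
move=> cf cg; split => [x Ux|v].
  by apply: differentiableM; [exact: cf.1|exact: cg.1].
apply: (@eq_class_C _ _ _ _ (f * 'D_v g + g * 'D_v f)) => //.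
  by move=> x Ux; rewrite deriveM//; apply: diff_derivable; [exact: cf.1|exact: cg.1].
by apply: class_CD => //; apply: IH => //; try exact: class_CS; [exact: cg.2|exact: cf.2].
Qed.

Lemma class_CZl V W k (U : set V) (f : V -> R) (c : W) : open U ->
  class_C k U f -> class_C k U (fun x => f x *: c).
Proof.
move=> oU; elim: k f => [|k IH] f.
  by move=> cf x Ux; apply: continuousZr_tmp; exact: cf.
move=> cf; split => [x Ux|v].
  by apply: differentiableZl; exact: cf.1.
apply: (@eq_class_C _ _ _ _ (fun x => 'D_v f x *: c)) => //; last exact: IH (cf.2 v).
move=> x Ux.
have df := cf.1 x Ux.
by rewrite [RHS]deriveE; [rewrite diffZl// deriveE|exact: differentiableZl].
Qed.

Lemma class_C_sum V W k (U : set V) (I : Type) (r : seq I) (f : I -> V -> W) :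
  open U -> (forall i, class_C k U (f i)) ->
  class_C k U (fun x => \sum_(i <- r) f i x).
Proof.
move=> oU cf; elim: r => [|i r IH].
  apply: (@eq_class_C _ _ _ _ (cst 0)) => //; last exact: class_C_cst.
  by move=> x _; rewrite big_nil.
apply: (@eq_class_C _ _ _ _ (f i + (fun x => \sum_(i <- r) f i x))) => //.
  by move=> x _; rewrite big_cons.
exact: class_CD.
Qed.

Lemma class_C_comp_affine V V' W k (U : set V) (f : V -> W)
    (l : {linear V' -> V}) (b : V) :
  open U -> continuous l -> class_C k U f ->
  class_C k [set x | U (b + l x)] (fun x => f (b + l x)).
Proof.
move=> oU cl; have dl (x : V') : is_diff x (fun x => b + l x) l.
  have dl := linear_differentiable x cl; have dc := differentiable_cst b x.
  split; first exact: (differentiableD dc dl).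
  rewrite (_ : (fun x => _) = cst b + (l : V' -> V))//.
  by rewrite (diffD dc dl) diff_cst diff_lin//; apply/funext => y /=; rewrite add0r.
elim: k f => [|k IH] f.
  move=> cf x Ux; apply: (@continuous_comp _ _ _ (fun x => b + l x) f).
    by apply: continuousD; [exact: cst_continuous|exact: cl].
  exact: cf.
move=> cf; split => [x Ux|v].
  have [d _] := dl x; apply: (differentiable_comp d); exact: cf.1.
have cbl : continuous (fun x => b + l x).
  by move=> x; apply: continuousD; [exact: cst_continuous|exact: cl].
apply: (@eq_class_C _ _ _ _ (fun x => 'D_(l v) f (b + l x))).
- exact: (open_comp (fun x _ => cbl x) oU).
- move=> x Ux; have [d dE] := dl x; have dfx := cf.1 _ Ux.
  have dc : differentiable (f \o (fun x => b + l x)) x by exact: differentiable_comp.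
  rewrite [RHS](deriveE _ dc) diff_comp//= deriveE//.
  by rewrite dE.
- exact: IH (cf.2 _).
Qed.

End class_C_theory.

(** * Second-order Taylor expansion and Hessian forms *)

Section second_order.
Variable R : realType.
Implicit Types V W : normedModType R.

Lemma is_derive_line V W (f : V -> W) (x w : V) (s : R) (df : W) :
  is_derive (x + s *: w) w f df -> is_derive s 1 (fun t : R => f (x + t *: w)) df.
Proof.
have E : (fun h : R => h^-1 *: (f (x + (h *: 1 + s) *: w) - f (x + s *: w)))
    = (fun h => h^-1 *: (f (h *: w + (x + s *: w)) - f (x + s *: w))).
  apply/funext => h; rewrite [h *: _]mulr1 scalerDl.
  by rewrite addrCA.
move=> [dv <-]; split; first by rewrite /derivable /= E.
by rewrite /derive /= E.
Qed.

Lemma continuous_at_sum (T : topologicalType) V (I : Type) (r : seq I)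
    (F : I -> T -> V) (x : T) : (forall i, {for x, continuous (F i)}) ->
  {for x, continuous (fun y => \sum_(i <- r) F i y)}.
Proof.
move=> cF; elim: r => [|i r IH].
  rewrite (_ : (fun _ => _) = cst 0); first exact: cst_continuous.
  by apply/funext => y; rewrite big_nil.
rewrite (_ : (fun _ => _) = F i + (fun y => \sum_(i <- r) F i y)).
  by apply: continuousD; [exact: cF|exact: IH].
by apply/funext => y; rewrite big_cons.
Qed.

(** The mean value theorem is applied to [g] minus a quadratic model, then to the derivative of that
    difference; hence the factor [xi]. The free constant [c] is the Hessian at the base point in
    [class_C2_taylor] and 0 in [energy_tangent]. *)
Lemma taylor2_unit_interval (g g1 g2 : R -> R) (c : R) :
  (forall s : R, 0 <= s <= 1 -> is_derive s 1 g (g1 s)) ->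
  (forall s : R, 0 <= s <= 1 -> is_derive s 1 g1 (g2 s)) ->
  exists xi zeta : R, [/\ 0 <= xi <= 1, 0 <= zeta <= 1 &
    g 1 - g 0 - g1 0 - c / 2 = (g2 zeta - c) * xi].
Proof.
move=> dg dg1.
pose k := g - (fun s => s * g1 0 + c / 2 * s ^+ 2).
pose k1 := g1 - (fun s => g1 0 + c * s).
have dk (s : R) : 0 <= s <= 1 -> is_derive s 1 k (k1 s).
  move=> s01; have := dg _ s01 => dgs; rewrite /k /k1.
  rewrite (_ : (g1 - _) s = g1 s - (1 * g1 0 + c * s))//; last first.
    by rewrite /= !fctE mul1r.
  apply: is_deriveB; apply: is_derive_eq; rewrite /GRing.scale/=; lra.
have dk1 (s : R) : 0 <= s <= 1 -> is_derive s 1 k1 (g2 s - c).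
  move=> s01; have := dg1 _ s01 => dgs; rewrite /k1.
  apply: is_deriveB; apply: is_derive_eq; rewrite /GRing.scale/=; lra.
have cont (h h1 : R -> R) a : 0 <= a <= 1 ->
    (forall s : R, 0 <= s <= 1 -> is_derive s 1 h (h1 s)) ->
    {within `[0, a], continuous h}.
  move=> a01 dh; apply: derivable_within_continuous => s; rewrite in_itv/= => /andP[s0 sa].
  suff : is_derive s 1 h (h1 s) by case.
  by apply: dh; rewrite s0 (le_trans sa)//; case/andP: a01.
have [xi xi01 kE] : exists2 xi, xi \in `[0, 1] & k 1 - k 0 = k1 xi * (1 - 0).
  apply: MVT_segment => //; last by apply: (cont _ k1); rewrite ?lexx ?ler01.
  by move=> s; rewrite in_itv/= => /andP[/ltW s0 /ltW s1]; apply: dk; rewrite s0 s1.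
move: xi01; rewrite in_itv/= => xi01; have /andP[xi0 xi1] := xi01.
have [z z01 k1E] : exists2 z, z \in `[0, xi] & k1 xi - k1 0 = (g2 z - c) * (xi - 0).
  apply: (MVT_segment xi0); last exact: (cont _ (fun s => g2 s - c)).
  move=> s; rewrite in_itv/= => /andP[/ltW s0 /ltW s1]; apply: dk1.
  by rewrite s0 (le_trans s1).
move: z01; rewrite in_itv/= => /andP[z0 zx].
exists xi, z; split => //; first by rewrite z0 (le_trans zx).
rewrite -[in RHS](subr0 xi) -k1E; move: kE; rewrite /k /k1 !fctE; lra.
Qed.

Variable n : nat.
Local Notation E j := (delta_mx (0 : 'I_1) (j : 'I_n) : 'rV[R]_n).
Implicit Types (f : 'rV[R]_n -> R) (U : set 'rV[R]_n) (x v w : 'rV[R]_n).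

Lemma derive_row_sum f x w : differentiable f x ->
  'D_w f x = \sum_j w 0 j * 'D_(E j) f x.
Proof.
move=> df; rewrite deriveE// {1}(row_sum_delta w) linear_sum/=.
by apply: eq_bigr => j _; rewrite linearZ/= deriveE.
Qed.

(** Symmetrizing the matrix of iterated derivatives keeps its quadratic form and makes symmetry hold
    by construction; it is through this form that the matrix is tied to derivatives, in
    [derive2_hessian]. *)
Definition hessian f x : 'M[R]_n :=
  let A := \matrix_(i, j) 'D_(E i) ('D_(E j) f) x in 2^-1 *: (A + A^T).

Definition qform (H : 'M[R]_n) (u w : 'rV[R]_n) : R := (u *m H *m w^T) 0 0.

Lemma hessian_sym f x : (hessian f x)^T = hessian f x.
Proof. by rewrite /hessian linearZ/= linearD/= trmxK addrC. Qed.

Lemma qform_tr H u w : qform H^T u w = qform H w u.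
Proof. by rewrite /qform -[in RHS](trmxK (w *m H *m u^T)) [RHS]mxE !trmx_mul trmxK mulmxA. Qed.

Lemma qformDm H G u w : qform (H + G) u w = qform H u w + qform G u w.
Proof. by rewrite /qform mulmxDr mulmxDl mxE. Qed.

Lemma qformBm H G u w : qform (H - G) u w = qform H u w - qform G u w.
Proof. by rewrite /qform mulmxBr mulmxBl mxE [X in _ + X]mxE. Qed.

Lemma qformZm a H u w : qform (a *: H) u w = a * qform H u w.
Proof. by rewrite /qform -scalemxAr -scalemxAl mxE. Qed.

Lemma qformDl H u v w : qform H (u + v) w = qform H u w + qform H v w.
Proof. by rewrite /qform mulmxDl mulmxDl mxE. Qed.

Lemma qformZl a H u w : qform H (a *: u) w = a * qform H u w.
Proof. by rewrite /qform -scalemxAl -scalemxAl mxE. Qed.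

Lemma qformDr H u v w : qform H u (v + w) = qform H u v + qform H u w.
Proof. by rewrite /qform linearD mulmxDr mxE. Qed.

Lemma qformZr a H u w : qform H u (a *: w) = a * qform H u w.
Proof. by rewrite /qform linearZ/= -scalemxAr mxE. Qed.

Lemma derive2_hessian U f x w : open U -> U x -> class_C 2 U f ->
  'D_w ('D_w f) x = qform (hessian f x) w w.
Proof.
move=> oU Ux cf.
have nU : \forall y \near x, U y by exact: open_nbhs_nbhs.
have -> : 'D_w ('D_w f) x = 'D_w (\sum_j (w 0 j *: 'D_(E j) f)) x.
  apply: near_eq_derive; near=> y.
  rewrite derive_row_sum; last by apply: cf.1; near: y.
  by rewrite fct_sumE; apply: eq_bigr => j _.
have dD j : differentiable ('D_(E j) f) x by exact: (cf.2 (E j)).1.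
rewrite derive_sum; last by move=> j; apply: derivableZ; exact: diff_derivable.
set A := \matrix_(i, j) 'D_(E i) ('D_(E j) f) x.
have -> : qform (hessian f x) w w = qform A w w.
  by rewrite /hessian -/A qformZm qformDm qform_tr; lra.
rewrite /qform mxE; apply: eq_bigr => j _.
rewrite deriveZ/=; last exact: diff_derivable.
rewrite derive_row_sum// !mxE [LHS]mulrC; congr (_ * _).
by apply: eq_bigr => i _; rewrite mxE.
Unshelve. all: by end_near. Qed.

Lemma qform_le H u w :
  `|qform H u w| <= (\sum_i \sum_j `|H i j|) * (`|u| * `|w|).
Proof.
have -> : qform H u w = \sum_i \sum_j u 0 i * H i j * w 0 j.
  rewrite /qform mxE exchange_big/=; apply: eq_bigr => j _.
  by rewrite !mxE mulr_suml; apply: eq_bigr.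
rewrite (le_trans (ler_norm_sum _ _ _))// mulr_suml ler_sum// => i _.
rewrite (le_trans (ler_norm_sum _ _ _))// mulr_suml ler_sum// => j _.
rewrite !normrM mulrAC mulrC ler_wpM2l// ler_pM//.
  exact: (coord_le_norm u i).
exact: (coord_le_norm w j).
Qed.

Lemma derive_seg U f x w : open U -> class_C 2 U f ->
  (forall s, 0 <= s <= 1 -> U (x + s *: w)) ->
  forall c, exists xi zeta : R, [/\ 0 <= xi <= 1, 0 <= zeta <= 1 &
    f (x + w) - f x - 'D_w f x - c / 2 =
    (qform (hessian f (x + zeta *: w)) w w - c) * xi].
Proof.
move=> oU cf xwU c.
have [||xi [z [xi01 z01]]] := @taylor2_unit_interval (fun s => f (x + s *: w))
  (fun s => 'D_w f (x + s *: w)) (fun s => 'D_w ('D_w f) (x + s *: w)) c.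
- move=> s s01; apply: is_derive_line; apply: derivableP.
  exact/diff_derivable/(cf.1 _ (xwU _ s01)).
- move=> s s01; apply: (@is_derive_line _ _ ('D_w f)); apply: derivableP.
  exact/diff_derivable/((cf.2 w).1 _ (xwU _ s01)).
- rewrite !scale0r !addr0 scale1r (derive2_hessian w oU (xwU _ z01) cf) => E.
  by exists xi, z.
Qed.

Lemma hessian_near U f x (e : R) : open U -> U x -> class_C 2 U f -> 0 < e ->
  \forall y \near x, forall w, `|qform (hessian f y - hessian f x) w w| <= e * `|w| ^+ 2.
Proof.
move=> oU Ux cf e0.
pose g y := \sum_i \sum_j `|hessian f y i j - hessian f x i j|.
have cH i j : {for x, continuous (fun y => hessian f y i j)}.
  have -> : (fun y => hessian f y i j) =
      (fun y => 2^-1 * ('D_(E i) ('D_(E j) f) y + 'D_(E j) ('D_(E i) f) y)).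
    by apply/funext => y; rewrite !mxE.
  apply: continuousM; first exact: cst_continuous.
  have cD k l : {for x, continuous ('D_(E k) ('D_(E l) f))}.
    by have [_ /(_ (E l)) [_ /(_ (E k))]] := cf; exact.
  by apply: continuousD; exact: cD.
have cg : {for x, continuous g}.
  apply: continuous_at_sum => i; apply: continuous_at_sum => j.
  have cB : {for x, continuous (fun y => hessian f y i j - hessian f x i j)}.
    by apply: continuousB; [exact: cH|exact: cst_continuous].
  exact: (continuous_comp cB (@norm_continuous _ _ _)).
have g0 : g x = 0.
  by rewrite /g big1// => i _; rewrite big1// => j _; rewrite subrr normr0.
have : \forall y \near x, g y < e.
  by move/cvgrPdist_lt : cg => /(_ e e0); rewrite g0; apply: filterS => y /=;
    rewrite sub0r normrN; apply: le_lt_trans; exact: ler_norm.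
apply: filterS => y gy w; rewrite (le_trans (qform_le _ _ _))// -expr2.
rewrite ler_wpM2r ?sqr_ge0// ltW// (le_lt_trans _ gy)// ler_sum// => i _.
apply: ler_sum => j _; move: (hessian f y) (hessian f x) => H G.
by rewrite mxE [X in _ + X]mxE.
Qed.

Lemma class_C2_taylor U f x (e : R) : open U -> U x -> class_C 2 U f -> 0 < e ->
  \forall w \near (0 : 'rV[R]_n),
    `|f (x + w) - f x - 'D_w f x - qform (hessian f x) w w / 2| <= e * `|w| ^+ 2.
Proof.
move=> oU Ux cf e0.
have /nbhs_ballP[r /= r0 rU] : nbhs x (U `&`
    [set y | forall w, `|qform (hessian f y - hessian f x) w w| <= e * `|w| ^+ 2]).
  by apply: filterI; [exact: open_nbhs_nbhs|exact: (hessian_near oU Ux cf e0)].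
near=> w.
have wr : `|w| < r.
  have : ball 0 r w by near: w; exact: nbhsx_ballx.
  by rewrite -ball_normE /ball_/= sub0r normrN.
have seg s : 0 <= s <= 1 -> ball x r (x + s *: w).
  move=> /andP[s0 s1]; rewrite -ball_normE /ball_/= opprD addrA subrr sub0r normrN normrZ.
  by rewrite (ger0_norm s0) (le_lt_trans _ wr)// ler_piMl.
have xwU s : 0 <= s <= 1 -> U (x + s *: w) by move=> s01; exact: (rU _ (seg s s01)).1.
have [xi [z [xi01 z01 ->]]] := derive_seg oU cf xwU (qform (hessian f x) w w).
have := (rU _ (seg z z01)).2 w.
have /andP[xi0 xi1] := xi01.
rewrite qformBm normrM (ger0_norm xi0).
by apply: le_trans; rewrite ler_piMr.
Unshelve. all: by end_near. Qed.

End second_order.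

(** * Borel measurability and pushforwards *)

Section borel_functions.
Variables (R : realType).

Lemma borel_open (X : ptopologicalType) (U : set X) :
  open U -> measurable (U : set (borel X)).
Proof. exact: sub_sigma_algebra. Qed.

Lemma borel_closed (X : ptopologicalType) (U : set X) :
  closed U -> measurable (U : set (borel X)).
Proof.
by move=> cU; rewrite -[U]setCK; apply: measurableC; apply: borel_open; exact: closed_openC.
Qed.

Lemma open_preimageI (X Y : topologicalType) (D : set X) (f : X -> Y) (O : set Y) :
  open D -> (forall x, D x -> {for x, continuous f}) -> open O ->
  open (D `&` f @^-1` O).
Proof.
rewrite !openE => oD cf oO x [Dx Ofx].
by apply: filterI; [exact: oD|apply: cf => //; exact: oO].
Qed.

Lemma borel_measurable_fun (X Y : ptopologicalType) (D : set X) (f : X -> Y) :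
  open D -> (forall x, D x -> {for x, continuous f}) ->
  measurable_fun (D : set (borel X)) (f : borel X -> borel Y).
Proof.
move=> oD cf; apply: (@measurability _ _ (borel X) (borel Y) D f (@open Y)) => //.
by move=> _ [B oB <-]; apply: borel_open; exact: open_preimageI.
Qed.

Lemma borel_measurable_real (X : ptopologicalType) (D : set X) (f : X -> R) :
  open D -> (forall x, D x -> {for x, continuous f}) ->
  measurable_fun (D : set (borel X)) (f : borel X -> R).
Proof.
move=> oD cf; apply: (measurability _ (measurable_realfun.RGenOpens.measurableE R)).
move=> _ [_ [a [b ->]] <-]; apply: borel_open; apply: open_preimageI => //.
Qed.

End borel_functions.

Section pushforwards.
Context d d' (T : measurableType d) (T' : measurableType d') (R : realType).
Variables (f : T -> T') (mf : measurable_fun setT f).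

Lemma pushforward_measureP (m : {measure set T -> \bar R}) :
  exists m' : {measure set T' -> \bar R}, m' = pushforward m f :> (set T' -> \bar R).
Proof.
pose F : {mfun T >-> T'} := HB.pack f (isMeasurableFun.Build _ _ _ _ f mf).
by exists (pushforward m F).
Unshelve. exact: mf. Qed.

Lemma pushforward_probabilityP (m : probability T R) :
  exists m' : probability T' R, m' = pushforward m f :> (set T' -> \bar R).
Proof.
pose F : {mfun T >-> T'} := HB.pack f (isMeasurableFun.Build _ _ _ _ f mf).
by exists (distribution m F).
Qed.

End pushforwards.

(** * Half-open boxes as generators of the Borel sets of R^n *)

Section boxes.
Variables (R : realType) (n : nat).
Local Notation V := 'rV[R]_n.
Implicit Types (a b v : V).

Definition box a b : set V := [set v | forall j, a 0 j <= v 0 j < b 0 j].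

Lemma boxI a b a' b' : box a b `&` box a' b' =
  box (\row_j Num.max (a 0 j) (a' 0 j)) (\row_j Num.min (b 0 j) (b' 0 j)).
Proof.
apply/seteqP; split => [v [v1 v2] j|v vb]; rewrite /box/=.
  rewrite !mxE ge_max lt_min; have /andP[a1 b1] := v1 j; have /andP[a2 b2] := v2 j.
  by apply/andP; split; apply/andP.
by split => j; have := vb j; rewrite !mxE ge_max lt_min => /andP[/andP[? ?] /andP[? ?]]; apply/andP.
Qed.

Lemma measurable_box a b : measurable (box a b : set (borel V)).
Proof.
have -> : box a b = \bigcap_(j in [set: 'I_n]) ((fun v : V => v 0 j) @^-1` `[a 0 j, b 0 j[).
  apply/seteqP; split => [v vb j _|v vb j]; first by rewrite /= in_itv/= vb.
  by have := vb j I; rewrite /= in_itv/=.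
apply: fin_bigcap_measurable => // j _.
rewrite -[X in measurable X]setTI.
apply: (@borel_measurable_real R V setT (fun v => v 0 j)) => //.
  exact: openT.
by move=> v _; exact: coord_continuous.
Qed.

(** Every open set is the union of the boxes with rational corners that it contains, and there are
    countably many of these. *)
Lemma borel_boxE : measurable = <<s [set box ab.1 ab.2 | ab in [set: V * V]] >> :> set (set (borel V)).
Proof.
set G := [set _ | _ in _].
apply/seteqP; split; apply: smallest_sub; try exact: smallest_sigma_algebra; last first.
  by move=> _ [[a b] _ <-]; exact: measurable_box.
move=> U oU.
pose q2r (q : 'rV[rat]_n) : V := map_mx ratr q.
pose F (ab : 'rV[rat]_n * 'rV[rat]_n) :=
  if `[< box (q2r ab.1) (q2r ab.2) `<=` U >] then box (q2r ab.1) (q2r ab.2) else set0.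
have -> : U = \bigcup_ab F ab.
  apply/seteqP; split => [x Ux|x [ab _]]; last by rewrite /F; case: asboolP => // s /s.
  have /nbhs_ballP[r /= r0 rU] : nbhs x U by exact: open_nbhs_nbhs.
  have qa j : exists q : rat, x 0 j - r < ratr q < x 0 j.
    by have /rat_in_itvoo[q] : x 0 j - r < x 0 j by [lra]; rewrite in_itv; exists q.
  have qb j : exists q : rat, x 0 j < ratr q < x 0 j + r.
    by have /rat_in_itvoo[q] : x 0 j < x 0 j + r by [lra]; rewrite in_itv; exists q.
  pose a := \row_j projT1 (cid (qa j)); pose b := \row_j projT1 (cid (qb j)).
  exists (a, b) => //; rewrite /F/=.
  have ax j : x 0 j - r < q2r a 0 j < x 0 j by rewrite !mxE; exact: (projT2 (cid (qa j))).
  have bx j : x 0 j < q2r b 0 j < x 0 j + r by rewrite !mxE; exact: (projT2 (cid (qb j))).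
  case: asboolP => [_ j|[]].
    by have /andP[_ /ltW ->] := ax j; have /andP[-> _] := bx j.
  move=> y yab; apply: rU; rewrite -ball_normE /ball_/= norm_lt_coord// => j.
  rewrite !mxE ltr_norml.
  have := ax j; have := bx j; have := yab j; lra.
apply: (@countable_bigcupT_measurable _ (g_sigma_algebraType G)) => //.
move=> ab; rewrite /F; case: asboolP => _; last exact: measurable0.
by apply: sub_sigma_algebra; eexists (_, _).
Qed.

Lemma box_cover : \bigcup_k box (const_mx (- k%:R)) (const_mx k%:R) = [set: V].
Proof.
apply/seteqP; split => // v _; have [k vk] : exists k : nat, `|v| < k%:R.
  by exists (Num.truncn `|v|).+1; exact: truncnS_gt.
exists k => // j; rewrite !mxE.
have : `|v 0 j| < k%:R.
  by apply: le_lt_trans vk; exact: coord_le_norm.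
by rewrite ltr_norml => /andP[/ltW -> ->].
Qed.

(** Boxes are stable under intersection and generate the Borel sets, and centered cubes exhaust the
    space, so the pi-lambda uniqueness theorem applies. *)
Lemma eq_measure_box (m1 m2 : {measure set (borel V) -> \bar R}) :
  (forall a b, m1 (box a b) = m2 (box a b)) -> (forall a b, (m1 (box a b) < +oo)%E) ->
  forall A, measurable A -> m1 A = m2 A.
Proof.
move=> m12 m1oo A mA.
have := @measure_unique _ R (borel V) [set box ab.1 ab.2 | ab in [set: V * V]]
  (fun k => box (const_mx (- k%:R)) (const_mx k%:R)) borel_boxE _ _ _ m1 m2; apply => //.
- by move=> _ _ [[a b] _ <-] [[a' b'] _ <-]; rewrite boxI; eexists (_, _).
- by move=> k; eexists (_, _).
- exact: box_cover.
- by move=> _ [[a b] _ <-].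
Qed.

End boxes.

(** Nonnegativity and additivity make [h] monotone; comparing [t * N] with its integer part then
    bounds N times the defect by [h 1] for every N. Here [h] will be the measure of a box as a
    function of one side. *)
Lemma monotone_cauchy (R : realType) (h : R -> R) :
  (forall s, 0 <= s -> 0 <= h s) ->
  (forall s t, 0 <= s -> 0 <= t -> h (s + t) = h s + h t) ->
  forall t, 0 <= t -> h t = t * h 1.
Proof.
move=> h0 hD; have hmono s t : 0 <= s -> s <= t -> h s <= h t.
  move=> s0 st; rewrite -(subrKC s t) hD ?subr_ge0// lerDl; apply: h0.
  by rewrite subr_ge0.
have h00 : h 0 = 0 by have := hD 0 0 (lexx _) (lexx _); rewrite addr0; lra.
have hn (k : nat) s : 0 <= s -> h (k%:R * s) = k%:R * h s.
  move=> s0; elim: k => [|k IH]; first by rewrite !mul0r.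
  by rewrite -natr1 !mulrDl !mul1r hD ?IH// mulr_ge0.
move=> t t0.
have key (N : nat) : `|h t - t * h 1| * N%:R <= h 1.
  have [->|N0] := posnP N; first by rewrite mulr0; exact: h0.
  pose k := Num.truncn (t * N%:R).
  have kt : k%:R <= t * N%:R by rewrite truncn_le// mulr_ge0.
  have tk : t * N%:R < k.+1%:R by exact: truncnS_gt.
  have N0' : (0 : R) < N%:R by rewrite ltr0n.
  have hN : h (t * N%:R) = N%:R * h t by rewrite mulrC hn.
  have h1 : h k%:R = k%:R * h 1 by rewrite -(hn k 1)// mulr1.
  have h2 : h k.+1%:R = k.+1%:R * h 1 by rewrite -(hn k.+1 1)// mulr1.
  have := hmono _ _ (ler0n _ k) kt; rewrite hN h1 => e1.
  have := hmono _ _ (mulr_ge0 t0 (ltW N0')) (ltW tk); rewrite hN h2 => e2.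
  have h10 : 0 <= h 1 by exact: h0.
  rewrite -[N%:R](ger0_norm (ltW N0')) -normrM ler_norml.
  rewrite -natr1 in e2 tk; nra.
apply/eqP; rewrite -subr_eq0 -normr_eq0; apply/negPn/negP => hne.
have p0 : 0 < `|h t - t * h 1| by rewrite lt_neqAle eq_sym hne normr_ge0.
have := key (Num.truncn (h 1 / `|h t - t * h 1|)).+1.
by rewrite leNgt -ltr_pdivrMl// mulrC truncnS_gt.
Qed.

(** * Translation-invariant measures are proportional *)

Section translation_invariant_measures.
Variables (R : realType) (n : nat).
Local Notation V := 'rV[R]_n.
Implicit Types (a b l v : V) (m : {measure set (borel V) -> \bar R}).

Definition translation_invariant m := forall v (A : set (borel V)),
  measurable A -> m ((fun u : V => u + v) @^-1` A) = m A.

Definition box_finite m := forall a b : V, (m (box a b) < +oo)%E.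

Lemma box0 a b j : b 0 j <= a 0 j -> box a b = set0.
Proof.
move=> ba; apply/seteqP; split => // v /(_ j) /andP[av vb].
by have := le_lt_trans av vb; rewrite ltNge ba.
Qed.

Definition unit_box : set V := box 0 (const_mx 1).

Let upd l j t : V := \row_k (if k == j then t else l 0 k).

Let updE l j t k : upd l j t 0 k = if k == j then t else l 0 k.
Proof. by rewrite mxE. Qed.

(** Cutting a box by a hyperplane and translating one part back shows that its measure is additive
    in each side length, hence linear by [monotone_cauchy]. The sides are then replaced by 1 one
    after the other. *)
Lemma translation_invariant_box m : translation_invariant m -> box_finite m ->
  forall l, (forall j, 0 <= l 0 j) ->
  m (box 0 l) = ((\prod_j l 0 j)%:E * m unit_box)%E.
Proof.
move=> minv mfin.
have mfn a b : m (box a b) \is a fin_num by rewrite ge0_fin_numE ?mfin.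
pose g l := fine (m (box 0 l)).
have gE l : m (box 0 l) = (g l)%:E by rewrite /g fineK.
have step l j : (forall k, 0 <= l 0 k) -> g l = l 0 j * g (upd l j 1).
  move=> l0; have -> : g l = g (upd l j (l 0 j)).
    by congr g; apply/rowP => k; rewrite mxE; case: eqP => [->|].
  apply: (@monotone_cauchy R (fun t => g (upd l j t))) => //.
    by move=> s _; apply: fine_ge0.
  move=> s t s0 t0; rewrite /g -fineD//; congr fine.
  pose sh : V := \row_k (if k == j then - s else 0).
  have -> : m (box 0 (upd l j t)) = m ((fun u : V => u + sh) @^-1` box 0 (upd l j t)).
    by rewrite minv//; exact: measurable_box.
  rewrite -measureU//.
  - congr (m _); apply/seteqP; split => [v vb|v [vb|vb] k].
    + have [vs|vs] := ltP (v 0 j) s.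
        left => k; have := vb k; rewrite !mxE; case: eqP => [->|//].
        by move=> /andP[-> _].
      right => k; have := vb k; rewrite !mxE; case: eqP => [->|]; last by rewrite addr0.
      lra.
    + by have := vb k; rewrite !mxE; case: eqP => [->|//]; lra.
    + by have := vb k; rewrite !mxE; case: eqP => [->|_]; rewrite ?addr0//; lra.
  - exact: measurable_box.
  - rewrite -[X in measurable X]setTI.
    apply: (@borel_measurable_fun V V setT) => //; first exact: openT.
      by move=> x _; apply: continuousD => //; exact: cst_continuous.
    exact: measurable_box.
  - apply/seteqP; split => // v [/(_ j) + /(_ j)].
    by rewrite /= !mxE eqxx; lra.
suff H (r : seq 'I_n) l : uniq r -> (forall k, 0 <= l 0 k) ->
    g l = (\prod_(j <- r) l 0 j) * g (\row_k if k \in r then 1 else l 0 k).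
  move=> l l0; rewrite !gE (H (enum 'I_n))// ?enum_uniq// EFinM big_enum/=.
  congr (_ * (g _)%:E)%E; apply/rowP => k; by rewrite !mxE mem_enum.
elim: r l => [|j r IH] l /=.
  move=> _ _; rewrite big_nil mul1r; congr g; by apply/rowP => k; rewrite mxE.
move=> /andP[jr ur] l0; rewrite (step l j)// IH//; last first.
  by move=> k; rewrite updE; case: ifP => // _; exact: ler01.
rewrite big_cons -mulrA; congr (_ * _).
rewrite (eq_big_seq (fun k => l 0 k)); last first.
  by move=> k kr; rewrite updE; case: eqP => // kj; rewrite -kj kr in jr.
congr (_ * g _); apply/rowP => k; rewrite !mxE inE.
by case: (k \in r); rewrite ?orbT ?orbF//; case: eqP.
Qed.

Lemma translation_invariant_unique m1 m2 :
  translation_invariant m1 -> translation_invariant m2 ->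
  box_finite m1 -> box_finite m2 -> forall c : R, 0 <= c ->
  m1 unit_box = (c%:E * m2 unit_box)%E ->
  forall A, measurable A -> m1 A = (c%:E * m2 A)%E.
Proof.
move=> i1 i2 f1 f2 c c0 m12.
have boxE m a b : translation_invariant m -> box_finite m -> (forall j, a 0 j <= b 0 j) ->
    m (box a b) = ((\prod_j (b - a) 0 j)%:E * m unit_box)%E.
  move=> im fm ab; rewrite -translation_invariant_box//; last first.
    by move=> j; rewrite !mxE subr_ge0.
  rewrite -(im (- a) (box 0 (b - a))); last exact: measurable_box.
  congr (m _); apply/seteqP; split => v vb j; have := vb j; rewrite !mxE; lra.
pose m3 := mscale (NngNum c0) m2.
apply: (@eq_measure_box _ _ m1 m3) => // a b.
have [ab|] := pselect (forall j, a 0 j <= b 0 j).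
  rewrite (boxE m1)// m12 [RHS]/(c%:E * m2 (box a b))%E (boxE m2)//.
  exact: muleCA.
by move=> /existsNP[j /negP]; rewrite -ltNge => /ltW ba; rewrite (box0 ba) !measure0.
Qed.

End translation_invariant_measures.

(** * Lebesgue measure under translations, linear maps and dilations *)

Section lebesgue_rows.
Variables (R : realType) (n : nat).
Local Notation V := 'rV[R]_n.
Variables (L : {measure set (borel V) -> \bar R}).
Hypothesis lebL : is_lebesgue L.
Implicit Types (a b u v : V).

Let bernoulli_le (e : R) k : 0 <= e <= 1 -> 1 - k%:R * e <= (1 - e) ^+ k.
Proof.
move=> /andP[e0 e1]; elim: k => [|k IH]; first by rewrite mul0r subr0.
rewrite exprS -natr1.
have : (1 - e) * (1 - k%:R * e) <= (1 - e) * (1 - e) ^+ k by rewrite ler_wpM2l// subr_ge0.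
apply: le_trans; have : 0 <= k%:R * e ^+ 2 by rewrite mulr_ge0// sqr_ge0.
nra.
Qed.

Let measurable_cbox a b : measurable ([set v | forall j, a 0 j <= v 0 j <= b 0 j] : set (borel V)).
Proof.
have cl : closed [set v : V | forall j, a 0 j <= v 0 j <= b 0 j]; last exact: borel_closed cl.
have -> : [set v : V | forall j, a 0 j <= v 0 j <= b 0 j] =
    \bigcap_(j in [set: 'I_n]) ((fun v : V => v 0 j) @^-1` `[a 0 j, b 0 j]).
  apply/seteqP; split => [v vb j _|v vb j]; first by rewrite /= in_itv/= vb.
  by have := vb j I; rewrite /= in_itv/=.
apply: closed_bigI => j _; apply: closed_comp; last exact: interval_closed.
by move=> v _; exact: coord_continuous.
Qed.

(** The definition of [L] concerns closed boxes. A half-open box lies inside its closure and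
    contains the closed boxes with sides shrunk by [1 - e], whose volume Bernoulli's inequality
    controls. *)
Lemma lebesgue_box a b : (forall j, a 0 j <= b 0 j) ->
  L (box a b) = (\prod_j (b - a) 0 j)%:E.
Proof.
move=> ab; have [aj|] := pselect (forall j, a 0 j < b 0 j); last first.
  move=> /existsNP[j /negP]; rewrite -leNgt => ba.
  rewrite (box0 ba) measure0 (bigD1 j)//= !mxE.
  have -> : b 0 j - a 0 j = 0 by have := ab j; lra.
  by rewrite mul0r.
set P := \prod_j _.
have P0 : 0 <= P by apply: prodr_ge0 => j _; rewrite !mxE subr_ge0.
have le1 : (L (box a b) <= P%:E)%E.
  have -> : P = \prod_j (b 0 j - a 0 j) by apply: eq_bigr => j _; rewrite !mxE.
  rewrite -lebL//; apply: le_measure; rewrite ?inE.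
  - exact: measurable_box.
  - exact: measurable_cbox.
  - by move=> v vb j; have /andP[-> /ltW ->] := vb j.
have Lfin : L (box a b) \is a fin_num.
  by rewrite ge0_fin_numE// (le_lt_trans le1)// ltry.
rewrite -(fineK Lfin) in le1 *; move: le1; rewrite lee_fin => le1.
congr (_%:E); apply/eqP; rewrite eq_le le1/= leNgt; apply/negP => lt1.
have key (e : R) : 0 < e <= 1 -> (1 - n%:R * e) * P <= fine (L (box a b)).
  move=> /andP[e0 e1]; apply: (@le_trans _ _ ((1 - e) ^+ n * P)).
    by rewrite ler_wpM2r// bernoulli_le// (ltW e0).
  pose b' : V := \row_j (a 0 j + (1 - e) * (b 0 j - a 0 j)).
  have ab' j : a 0 j <= b' 0 j.
    by rewrite mxE lerDl mulr_ge0// subr_ge0// ltW.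
  rewrite -lee_fin fineK//.
  have -> : (1 - e) ^+ n * P = \prod_j (b' 0 j - a 0 j).
    rewrite -[in (1 - e) ^+ n](card_ord n) -prodr_const -big_split/=.
    by apply: eq_bigr => j _; rewrite !mxE [RHS]addrC addKr.
  rewrite -lebL//; apply: le_measure; rewrite ?inE.
  - exact: measurable_cbox.
  - exact: measurable_box.
  - move=> v vb j; have := vb j; have := aj j; rewrite mxE; nra.
pose d := P - fine (L (box a b)).
have d0 : 0 < d by rewrite subr_gt0.
have P1 : 0 < P by apply: le_lt_trans lt1; exact: fine_ge0.
have Q0 : 0 < n.+1%:R * P by rewrite mulr_gt0// ltr0n.
(* With this [e] the shrinking loses at most n / (n + 1) times the supposed deficit [d], which is
   absurd. *)
have := key (d / (n.+1%:R * P)).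
have -> : 0 < d / (n.+1%:R * P) <= 1.
  rewrite divr_gt0//= ler_pdivrMr// mul1r -natr1.
  have : 0 <= n%:R * P by rewrite mulr_ge0.
  have : 0 <= fine (L (box a b)) by exact: fine_ge0.
  rewrite /d; lra.
move=> /(_ isT); rewrite mulrBl mul1r.
have -> : n%:R * (d / (n.+1%:R * P)) * P = d * (n%:R / n.+1%:R).
  by field; rewrite gt_eqF//= gt_eqF// ltr0n.
have : n%:R / n.+1%:R < 1 :> R by rewrite ltr_pdivrMr ?ltr0n// mul1r ltr_nat.
move=> h1; have : d * (n%:R / n.+1%:R) < d by rewrite gtr_pMr.
by move: (d * _) => X; rewrite /d; lra.
Qed.

Lemma lebesgue_unit_box : L (@unit_box R n) = 1%E.
Proof.
rewrite /unit_box lebesgue_box; last by move=> j; rewrite !mxE.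
by rewrite big1// => j _; rewrite !mxE subr0.
Qed.

Lemma lebesgue_box_finite : box_finite L.
Proof.
move=> a b; have [ab|] := pselect (forall j, a 0 j <= b 0 j).
  by rewrite lebesgue_box// ltry.
by move=> /existsNP[j /negP]; rewrite -ltNge => /ltW ba; rewrite (box0 ba) measure0.
Qed.

Lemma shift_measurable v : measurable_fun setT ((fun u : V => u + v) : borel V -> borel V).
Proof.
apply: borel_measurable_fun; first exact: openT.
by move=> x _; apply: continuousD => //; exact: cst_continuous.
Qed.

Lemma mulmxr_continuous (T : 'M[R]_n) : continuous (fun u : V => u *m T).
Proof.
have -> : (fun u : V => u *m T) = (fun u => \sum_i u 0 i *: row i T).
  by apply/funext => u; exact: mulmx_sum_row.
move=> u; apply: continuous_at_sum => i; apply: continuousZr_tmp; exact: coord_continuous.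
Qed.

Lemma mulmxr_measurable (T : 'M[R]_n) :
  measurable_fun setT ((fun u : V => u *m T) : borel V -> borel V).
Proof.
apply: borel_measurable_fun; first exact: openT.
by move=> x _; exact: mulmxr_continuous.
Qed.

Lemma lebesgue_translation_invariant : translation_invariant L.
Proof.
move=> v A mA; have [L' L'E] := pushforward_measureP (shift_measurable v) L.
have E a b : L (box a b) = L' (box a b).
  rewrite L'E /pushforward (_ : _ @^-1` _ = box (a - v) (b - v)).
    have [ab|] := pselect (forall j, a 0 j <= b 0 j).
      rewrite !lebesgue_box//; last by move=> j; rewrite !mxE lerD2r.
      by rewrite opprB addrA subrK.
    move=> /existsNP[j /negP]; rewrite -ltNge => /ltW ba.
    by rewrite (box0 ba) (@box0 _ _ _ _ j) ?measure0// !mxE lerD2r.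
  by apply/seteqP; split => u ub j; have := ub j; rewrite /= !mxE; lra.
by rewrite [RHS](eq_measure_box E)// => [|a b]; [rewrite L'E|exact: lebesgue_box_finite].
Qed.

Lemma bounded_box (A : set V) (r : R) : (forall u, A u -> `|u| < r) ->
  A `<=` box (const_mx (- r)) (const_mx r).
Proof.
move=> Ar u /Ar ur j; rewrite !mxE.
by have := le_lt_trans (coord_le_norm u j) ur; rewrite ltr_norml => /andP[/ltW -> ->].
Qed.

(** The volume factor [|det T|], characterized without determinants. *)
Lemma lebesgue_linear (T : 'M[R]_n) : T \in unitmx ->
  exists2 c : R, 0 <= c &
    forall A : set (borel V), measurable A ->
      L ((fun u : V => u *m T) @^-1` A) = (c%:E * L A)%E.
Proof.
move=> uT; have [L' L'E] := pushforward_measureP (mulmxr_measurable T) L.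
have L'fin : box_finite L'.
  move=> a b; rewrite L'E /pushforward.
  pose r := (`|a| + `|b|) * (\sum_i \sum_j `|invmx T i j|) + 1.
  have sub : (fun u : V => u *m T) @^-1` box a b `<=` box (const_mx (- r)) (const_mx r).
    apply: bounded_box => u ub.
    have uE : u = (u *m T) *m invmx T by rewrite mulmxK.
    rewrite uE; set w := u *m T in ub *.
    have wle : `|w| <= `|a| + `|b|.
      apply: norm_le_coord; first by rewrite addr_ge0.
      move=> j; have := ub j; have := coord_le_norm a j; have := coord_le_norm b j.
      by rewrite !ler_norml; lra.
    apply: norm_lt_coord.
      rewrite ltr_wpDl// mulr_ge0 ?addr_ge0// sumr_ge0// => i _; exact: sumr_ge0.
    move=> j; rewrite /r ltr_pwDr// mxE (le_trans (ler_norm_sum _ _ _))//.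
    rewrite mulr_sumr ler_sum// => i _; rewrite normrM ler_pM//.
      exact: le_trans (coord_le_norm w i) wle.
    by rewrite (bigD1 j)//= lerDl sumr_ge0.
  apply: le_lt_trans (lebesgue_box_finite (const_mx (- r)) (const_mx r)).
  apply: le_measure; rewrite ?inE; [|exact: measurable_box|exact: sub].
  rewrite -[X in measurable X]setTI; apply: mulmxr_measurable => //.
  exact: measurable_box.
have L'inv : translation_invariant L'.
  move=> v A mA; rewrite L'E /pushforward.
  rewrite -[RHS](lebesgue_translation_invariant (v *m invmx T)); last first.
    by rewrite -[X in measurable X]setTI; exact: mulmxr_measurable.
  by congr (L _); apply/seteqP; split => u; rewrite /= mulmxDl mulmxKV.
have c0 : 0 <= fine (L' (@unit_box R n)) by exact: fine_ge0.
exists (fine (L' (@unit_box R n))) => //.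
move=> A mA; have -> : L ((fun u : V => u *m T) @^-1` A) = L' A by rewrite L'E.
apply: (translation_invariant_unique L'inv lebesgue_translation_invariant L'fin
  lebesgue_box_finite c0) => //.
by rewrite lebesgue_unit_box mule1 fineK// ge0_fin_numE//; exact: L'fin.
Qed.

(** The factor of the scalar matrix is read off the unit box, whose preimage is a cube of side
    [s]. *)
Lemma lebesgue_scale (s : R) (A : set (borel V)) : 0 < s -> measurable A ->
  L ((fun u : V => s^-1 *: u) @^-1` A) = ((s ^+ n)%:E * L A)%E.
Proof.
move=> s0 mA; have uT : (s^-1)%:M \in @unitmx R n.
  by rewrite unitmxE det_scalar unitfE expf_neq0// invr_neq0// gt_eqF.
have [c c0 cE] := lebesgue_linear uT.
have preE (B : set V) : (fun u : V => u *m (s^-1)%:M) @^-1` B = (fun u : V => s^-1 *: u) @^-1` B.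
  by apply/seteqP; split => u; rewrite /= mul_mx_scalar.
rewrite -preE cE//; congr (_%:E * _)%E.
have := cE (@unit_box R n) (measurable_box _ _).
rewrite lebesgue_unit_box mule1 preE.
have -> : (fun u : V => s^-1 *: u) @^-1` (@unit_box R n) = box 0 (const_mx s).
  apply/seteqP; split => u ub j; have := ub j; rewrite /= !mxE.
    by rewrite mulrC pmulr_lge0 ?invr_gt0// ltr_pdivrMr// mul1r.
  by rewrite mulrC pmulr_lge0 ?invr_gt0// ltr_pdivrMr// mul1r.
rewrite lebesgue_box; last by move=> j; rewrite !mxE ltW.
move=> [<-]; rewrite (eq_bigr (fun=> s)); last by move=> j _; rewrite !mxE subr0.
by rewrite prodr_const card_ord.
Qed.

Lemma lebesgue_open_gt0 (U : set V) : open U -> U !=set0 -> (0 < L U)%E.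
Proof.
move=> oU [x Ux]; have /nbhs_ballP[r /= r0 rU] : nbhs x U by exact: open_nbhs_nbhs.
have h0 : 0 < r / 2 by rewrite divr_gt0.
apply: (@lt_le_trans _ _ (L (box x (x + const_mx (r / 2))))).
  rewrite lebesgue_box; last by move=> j; rewrite !mxE lerDl ltW.
  by rewrite lte_fin prodr_gt0// => j _; rewrite !mxE addrC addKr.
apply: le_measure; rewrite ?inE.
- exact: measurable_box.
- exact: borel_open.
- move=> v vb; apply: rU; rewrite -ball_normE /ball_/= norm_lt_coord// => j.
  by have := vb j; rewrite !mxE ltr_norml; lra.
Qed.

End lebesgue_rows.

Lemma countable_bigcup_measurable d (T : measurableType d) (I : choiceType)
    (D : set I) (F : I -> set T) :
  countable D -> (forall i, measurable (F i)) -> measurable (\bigcup_(i in D) F i).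
Proof.
move=> /countable_injP[f finj] mF.
have -> : \bigcup_(i in D) F i = \bigcup_k (\bigcup_(i in D `&` f @^-1` [set k]) F i).
  apply/seteqP; split => [x [i Di Fx]|x [k _ [i [Di _] Fx]]]; last by exists i.
  by exists (f i) => //; exists i.
apply: bigcup_measurable => k _.
have [[i [Di fi]]|no] := pselect (exists i, D i /\ f i = k).
  rewrite (_ : _ `&` _ = [set i]) ?bigcup_set1//.
  apply/seteqP; split => [j [Dj fj]|_ ->]; last by split.
  by apply: finj; rewrite ?inE// fi.
rewrite (_ : _ `&` _ = set0) ?bigcup_set0//.
by apply/seteqP; split => // j [Dj fj]; apply: no; exists j.
Qed.

(** * Joint measurability of the distance *)

Section metric_measurability.
Variables (R : realType) (X : ptopologicalType) (d : X -> X -> \bar R).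
Hypothesis md : is_metric d.
Local Open Scope ereal_scope.

Lemma metric_ball_nbhs (x : X) (e : R) : (0 < e)%R -> nbhs x [set y | d x y < e%:E].
Proof. by move=> e0; apply/(metric_nbhs md); exists e. Qed.

(** By the triangle inequality a strict sublevel set of [d] is a union of rectangles of basic open
    sets, and second countability makes the union countable. This gives measurability for the
    product of the two Borel sigma-algebras, where couplings live. *)
Lemma metric_measurable : @second_countable X ->
  measurable_fun setT ((fun z => d z.1 z.2) : (borel X * borel X)%type -> \bar R).
Proof.
move=> [B cB [Bo Bx]].
apply: (measurability _ (ErealGenInftyO.measurableE R)).
move=> _ [_ [r ->] <-]; rewrite setTI.
pose F (b : set X * set X) := if `[< [/\ B b.1, B b.2 &
  forall x y, b.1 x -> b.2 y -> d x y < r%:E] >] then (b.1 `*` b.2 : set (borel X * borel X)%type) else set0.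
have -> : ((fun z => d z.1 z.2) : (borel X * borel X)%type -> \bar R) @^-1` `]-oo, r%:E[ =
    \bigcup_(b in B `*` B) F b.
  apply/seteqP; split => [[x y]|[x y] [b _]]; last first.
    by rewrite /F; case: asboolP => // -[B1 B2 bd] [b1 b2]; rewrite /= in_itv/=; exact: bd.
  rewrite /= in_itv/= => dxy.
  have /fineK dE := metric_fin md x y.
  pose e := ((r - fine (d x y)) / 2)%R.
  have e0 : (0 < e)%R by rewrite divr_gt0// subr_gt0 -lte_fin dE.
  have [U [BU Ux] UE] := Bx x _ (metric_ball_nbhs x e0).
  have [U' [BU' Uy] UE'] := Bx y _ (metric_ball_nbhs y e0).
  exists (U, U') => //; rewrite /F; case: asboolP => // -[]; split => // x' y' Ux' Uy'.
  have h1 : d x x' < e%:E := UE _ Ux'; have h2 : d y y' < e%:E := UE' _ Uy'.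
  have h3 := Defs.metric_triangle md x' x y'; have h4 := Defs.metric_triangle md x y y'.
  rewrite (Defs.metric_sym md x' x) in h3.
  move: h1 h2 h3 h4; rewrite -dE.
  rewrite -(fineK (metric_fin md x x')) -(fineK (metric_fin md y y')).
  rewrite -(fineK (metric_fin md x' y')) -(fineK (metric_fin md x y')).
  rewrite -!EFinD !lee_fin !lte_fin /e; lra.
have mF b : measurable (F b).
  rewrite /F; case: asboolP => // -[B1 B2 _]; apply: measurableX.
    exact: (borel_open (Bo _ B1)).
  exact: (borel_open (Bo _ B2)).
apply: countable_bigcup_measurable => //; exact: countableX.
Qed.

End metric_measurability.

(** * Localizing a Wasserstein barycenter by a retraction *)

Section wasserstein.
Variables (R : realType) (X : ptopologicalType) (d : X -> X -> \bar R).
Hypothesis (dmet : is_metric d) (scX : @second_countable X).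
Local Notation P := (probability (borel X) R).
Local Open Scope ereal_scope.

Let md := metric_measurable dmet scX.

Let md2 d' (T : measurableType d') (f g : T -> borel X) :
  measurable_fun setT f -> measurable_fun setT g ->
  measurable_fun setT (fun t => d (f t) (g t) ^+ 2).
Proof.
move=> mf mg; have mdfg : measurable_fun setT (fun t => d (f t) (g t)).
  exact: (measurableT_comp md (measurable_fun_pair mf mg)).
by under eq_fun do rewrite expe2; apply: emeasurable_funM.
Qed.

Let d2_ge0 x y : 0 <= d x y ^+ 2.
Proof. by rewrite expe_ge0// (metric_ge0 dmet). Qed.

Let coupling_fst (mu nu : P) p : couplings mu nu p -> forall A, measurable A ->
  p (fst @^-1` A) = mu A.
Proof.
move=> pc A mA; have [<- _] := pc A mA; congr (p _).
by apply/seteqP; split => -[x y] //= [].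
Qed.

Let coupling_snd (mu nu : P) p : couplings mu nu p -> forall A, measurable A ->
  p (snd @^-1` A) = nu A.
Proof.
move=> pc A mA; have [_ <-] := pc A mA; congr (p _).
by apply/seteqP; split => -[x y] //= [].
Qed.

Lemma W2sq_ge0 (mu nu : P) : 0 <= W2sq d mu nu.
Proof.
by apply: le_ereal_inf_tmp => _ [p _ <-]; apply: integral_ge0 => z _; exact: d2_ge0.
Qed.

(** Applying [r] to the first coordinate of a coupling of [nu] and [mu] gives a coupling of [nu']
    and [mu], whose cost is lower by at least the integral of [h]. Adding [C] on both sides keeps
    all integrands nonnegative, so that infinite values cause no ambiguity. *)
Lemma W2sq_retract (mu nu nu' : P) (r : X -> X) (A : set X) (h : X -> R) (C : R) :
  measurable_fun setT (r : borel X -> borel X) ->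
  nu' = pushforward nu (r : borel X -> borel X) :> (set _ -> \bar R) ->
  measurable (A : set (borel X)) -> mu (~` A) = 0 ->
  measurable_fun setT (h : borel X -> R) -> (forall z, (0 <= h z + C)%R) ->
  (forall z x, A x -> d (r z) x ^+ 2 + (h z)%:E <= d z x ^+ 2) -> (0 <= C)%R ->
  W2sq d nu' mu + \int[nu]_z (h z + C)%:E <= W2sq d nu mu + C%:E.
Proof.
move=> mr nu'E mA muA mh hC dh C0.
rewrite -leeBlDr//; apply: le_ereal_inf_tmp => _ [p pc <-]; rewrite leeBlDr//.
have mr2 : measurable_fun setT ((fun z => (r z.1, z.2)) :
    (borel X * borel X)%type -> (borel X * borel X)%type).
  by apply: measurable_fun_pair => //; exact: (measurableT_comp mr).
have [p' p'E] := pushforward_probabilityP mr2 p.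
have p'c : couplings nu' mu p'.
  move=> B mB; rewrite p'E nu'E /pushforward; split.
    have mrB : measurable ((r : borel X -> borel X) @^-1` B).
      by rewrite -[X in measurable X]setTI; exact: mr.
    rewrite -(coupling_fst pc mrB); congr (p _).
    by apply/seteqP; split => -[x y] //= [].
  rewrite -(coupling_snd pc mB); congr (p _).
  by apply/seteqP; split => -[x y] //= [].
have mhC : measurable_fun setT (fun z : borel X => (h z + C)%:E).
  by apply/measurable_EFinP; apply: measurable_funD.
apply: (@le_trans _ _ (\int[p']_z (d z.1 z.2 ^+ 2) + \int[nu]_z (h z + C)%:E)).
  by rewrite leeD2r//; apply: ereal_inf_lbound; exists p'.
have -> : \int[p']_z (d z.1 z.2 ^+ 2) = \int[p]_z (d (r z.1) z.2 ^+ 2).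
  by rewrite p'E ge0_integral_pushforward//; exact: md2.
have -> : \int[nu]_z (h z + C)%:E = \int[p]_z (h z.1 + C)%:E.
  have -> : \int[p]_z (h z.1 + C)%:E = \int[pushforward p fst]_z (h z + C)%:E.
    by rewrite ge0_integral_pushforward// => z _; rewrite lee_fin.
  by apply: eq_measure_integral => B mB _; exact: (esym (coupling_fst pc mB)).
have -> : C%:E = \int[p]_z (cst C%:E z).
  by rewrite integral_cst//= probability_setT mule1.
have mrf : measurable_fun setT ((fun z => d (r z.1) z.2 ^+ 2) : (borel X * borel X)%type -> \bar R).
  by apply: md2 => //; exact: (measurableT_comp mr).
have mdf : measurable_fun setT ((fun z => d z.1 z.2 ^+ 2) : (borel X * borel X)%type -> \bar R).
  exact: md2.
have mhf : measurable_fun setT ((fun z => (h z.1 + C)%:E) : (borel X * borel X)%type -> \bar R).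
  exact: (measurableT_comp mhC).
rewrite -!ge0_integralD//; last by move=> z _; rewrite lee_fin.
apply: ae_ge0_le_integral => //.
- by move=> z _; rewrite adde_ge0// lee_fin.
- exact: emeasurable_funD.
- by move=> z _; rewrite adde_ge0// lee_fin.
- exact: emeasurable_funD.
(* The pointwise estimate holds for targets in [A]; the other pairs are negligible since the second
   marginal is [mu]. *)
exists (snd @^-1` ~` A); split.
- rewrite -[X in measurable X]setTI; apply: measurable_snd => //; exact: measurableC.
- by rewrite -muA; exact: (coupling_snd pc (measurableC mA)).
- move=> [z x] /= nzx Ax; apply: nzx => _ /=.
  by rewrite EFinD addeA leeD2r// dh.
Qed.

Lemma le_sum_mule (k : nat) (lambda : 'I_k -> R) (a b : 'I_k -> \bar R) :
  (forall i, (0 <= lambda i)%R) -> (forall i, a i <= b i) ->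
  \sum_(i < k) (lambda i)%:E * a i <= \sum_(i < k) (lambda i)%:E * b i.
Proof. by move=> l0 ab; apply: lee_sum => i _; rewrite lee_wpmul2l ?lee_fin. Qed.

(** The pushforward of [nu] by [r] is a competitor, in [P2] because [r] has bounded range. Averaging
    [W2sq_retract], minimality of [nu] (whose finite cost can be cancelled) bounds the integral of
    the averaged [h] by 0, whereas this average is nonnegative on [W] and at least [c] off [W]. *)
Lemma barycenter_retract (k : nat) (lambda : 'I_k -> R) (mu : 'I_k -> P) (nu : P)
    (r : X -> X) (A : 'I_k -> set X) (h : 'I_k -> X -> R) (W : set X) (c C D : R) (x0 : X) :
  is_barycenter d lambda mu nu -> (forall i, (0 < lambda i)%R) ->
  (\sum_(i < k) lambda i = 1)%R -> barycenter_cost d lambda mu nu < +oo ->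
  measurable_fun setT (r : borel X -> borel X) ->
  (forall z, d x0 (r z) <= D%:E) ->
  (forall i, measurable (A i : set (borel X))) -> (forall i, mu i (~` A i) = 0) ->
  (forall i, measurable_fun setT (h i : borel X -> R)) ->
  (0 <= C)%R -> (forall i z, (0 <= h i z + C)%R) ->
  (forall i z x, A i x -> d (r z) x ^+ 2 + (h i z)%:E <= d z x ^+ 2) ->
  measurable (W : set (borel X)) -> (0 < c)%R ->
  (forall z, W z -> (0 <= \sum_i lambda i * h i z)%R) ->
  (forall z, ~ W z -> (c <= \sum_i lambda i * h i z)%R) ->
  nu (~` W) = 0.
Proof.
move=> [_ numin] lam0 lam1 cfin mr rD mA muA mh C0 hC dh mW c0 hge0 hgec.
have [nu' nu'E] := pushforward_probabilityP mr nu.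
have lam0' i : (0 <= lambda i)%R by exact: ltW.
have d0D : (0 <= D)%R by rewrite -lee_fin (le_trans _ (rD x0))// (metric_ge0 dmet).
have nu'P2 : P2 d nu'.
  exists x0; rewrite nu'E ge0_integral_pushforward//; last exact: md2.
  rewrite preimage_setT.
  apply: (@le_lt_trans _ _ (\int[nu]_x (cst (D ^+ 2)%:E x))).
    apply: ge0_le_integral => //.
    - by move=> x _; exact: d2_ge0.
    - have mx0 : measurable_fun setT ((fun y => d x0 y ^+ 2) : borel X -> \bar R) by exact: md2.
      exact: (measurableT_comp mx0 mr).
    - by move=> x _ /=; rewrite EFin_expe lee_sqr ?rD// (metric_ge0 dmet).
  by rewrite integral_cst//= probability_setT mule1 ltry.
pose I i := \int[nu]_z (h i z + C)%:E.
have mhC i : measurable_fun setT (fun z : borel X => (h i z + C)%:E).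
  by apply/measurable_EFinP; apply: measurable_funD.
have mlh i : measurable_fun setT (fun z : borel X => (lambda i * (h i z + C))%R).
  by apply: measurable_funM => //; apply: measurable_funD.
have I0 i : 0 <= I i by apply: integral_ge0 => z _; rewrite lee_fin.
have H i : W2sq d nu' (mu i) + I i <= W2sq d nu (mu i) + C%:E.
  exact: (W2sq_retract mr nu'E (mA i) (muA i) (mh i) (hC i) (dh i) C0).
have := le_sum_mule lam0' H.
under eq_bigr do rewrite ge0_muleDr ?W2sq_ge0//.
under [X in _ <= X]eq_bigr do rewrite ge0_muleDr ?W2sq_ge0 ?lee_fin//.
rewrite !big_split/=.
have -> : \sum_(i < k) (lambda i)%:E * C%:E = C%:E.
  by under eq_bigr do rewrite -EFinM; rewrite sumEFin -mulr_suml lam1 mul1r.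
set S := \sum_(i < k) _ * I i => HS.
have SC : S <= C%:E.
  have cge0 : 0 <= barycenter_cost d lambda mu nu.
    by apply: sume_ge0 => i _; rewrite mule_ge0 ?lee_fin ?W2sq_ge0.
  have cfn : barycenter_cost d lambda mu nu \is a fin_num by rewrite ge0_fin_numE.
  rewrite -(leeD2lE _ _ cfn); apply: le_trans HS.
  by rewrite leeD2r//; exact: numin.
have SE : S = \int[nu]_z (\sum_(i < k) (lambda i * (h i z + C))%:E).
  rewrite ge0_integral_sum//; last 2 first.
  - by move=> i; apply/measurable_EFinP; exact: mlh.
  - by move=> i z _; rewrite lee_fin mulr_ge0.
  apply: eq_bigr => i _; under [RHS]eq_integral do rewrite EFinM.
  by rewrite ge0_integralZl_EFin// => z _; rewrite lee_fin.
have E2 : C%:E + c%:E * nu (~` W) <= S.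
  rewrite SE.
  have -> : C%:E + c%:E * nu (~` W) = \int[nu]_z (C + c * \1_(~` W) z)%:E.
    under eq_integral do rewrite EFinD.
    rewrite ge0_integralD//; last 2 first.
    - by move=> z _; rewrite lee_fin mulr_ge0// ltW.
    - apply/measurable_EFinP/measurable_funM => //.
      by apply: measurable_indic; exact: measurableC.
    - under [X in _ = _ + X]eq_integral do rewrite EFinM.
      rewrite ge0_integralZl_EFin//; last 2 first.
      + by apply/measurable_EFinP/measurable_indic; exact: measurableC.
      + exact: ltW.
      rewrite integral_indic//; last exact: measurableC.
      by rewrite setIT integral_cst//= probability_setT mule1.
  apply: ge0_le_integral => //.
  - by move=> z _; rewrite lee_fin addr_ge0// mulr_ge0// ltW.
  - apply/measurable_EFinP/measurable_funD => //; apply: measurable_funM => //.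
    by apply: measurable_indic; exact: measurableC.
  - apply: emeasurable_sum => i.
    by apply/measurable_EFinP; exact: mlh.
  - move=> z _; rewrite sumEFin lee_fin.
    under eq_bigr do rewrite mulrDr; rewrite big_split/= -mulr_suml lam1 mul1r [leLHS]addrC lerD2r.
    rewrite indicE; have [/set_mem/hgec|/negP nz] := boolP (z \in ~` W).
      by rewrite mulr1.
    rewrite mulr0; apply: hge0; apply: contrapT => Wz; apply: nz; exact: mem_set.
have := le_trans E2 SC.
rewrite -[leRHS]adde0 leeD2lE// => cW.
apply/eqP; rewrite eq_le measure_ge0 andbT.
by rewrite -(@lee_pmul2l _ c%:E)// mule0.
Qed.

(** The competitor is the Dirac mass at [x0], coupled to each [mu i] by the product coupling. *)
Lemma barycenter_cost_le (k : nat) (lambda : 'I_k -> R) (mu : 'I_k -> P) (nu : P)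
    (A : 'I_k -> set X) (D : R) (x0 : X) :
  is_barycenter d lambda mu nu -> (forall i, (0 <= lambda i)%R) ->
  (\sum_(i < k) lambda i = 1)%R ->
  (forall i, measurable (A i : set (borel X))) -> (forall i, mu i (~` A i) = 0) ->
  (0 <= D)%R -> (forall i x, A i x -> d x0 x <= D%:E) ->
  barycenter_cost d lambda mu nu <= (D ^+ 2)%:E.
Proof.
move=> [_ numin] lam0 lam1 mA muA D0 AD.
pose eta : P := dirac (x0 : borel X).
have etaP2 : P2 d eta.
  exists x0; rewrite integral_dirac//; last exact: md2.
  by rewrite diracT mul1e (_ : d x0 x0 = 0) ?expe2 ?mule0// ; apply/(metric_eq0 dmet).
apply: (le_trans (numin _ etaP2)).
have -> : (D ^+ 2)%:E = \sum_(i < k) (lambda i)%:E * (D ^+ 2)%:E.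
  by under eq_bigr do rewrite -EFinM; rewrite sumEFin -mulr_suml lam1 mul1r.
apply: le_sum_mule => // i.
have mp : measurable_fun setT ((fun x => (x0, x)) : borel X -> (borel X * borel X)%type).
  by apply: measurable_fun_pair.
have [p pE] := pushforward_probabilityP mp (mu i).
apply: (@le_trans _ _ (\int[p]_z (d z.1 z.2 ^+ 2))).
  apply: ereal_inf_lbound; exists p => // B mB; rewrite pE /pushforward; split.
    rewrite /eta/= diracE; have [Bx|Bx] := boolP (x0 \in B).
      rewrite (_ : _ @^-1` _ = setT) ?probability_setT//.
      by apply/seteqP; split => // x _ /=; split => //; exact: set_mem.
    rewrite (_ : _ @^-1` _ = set0) ?measure0//.
    by apply/seteqP; split => // x [/= /mem_set]; rewrite (negbTE Bx).
  congr (mu i _); by apply/seteqP; split => x //= [].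
rewrite pE ge0_integral_pushforward//; last exact: md2.
rewrite preimage_setT -[leRHS]mule1 -(probability_setT (mu i)) -integral_cst//.
apply: ae_ge0_le_integral => //.
- by move=> x _; exact: d2_ge0.
- have mx0 : measurable_fun setT ((fun y => d x0 y ^+ 2) : borel X -> \bar R) by exact: md2.
  exact: mx0.
- by move=> x _; rewrite lee_fin sqr_ge0.
exists (~` A i); split; [exact: measurableC|exact: muA|].
move=> x /= nx Ax; apply: nx => _.
rewrite EFin_expe lee_sqr; [exact: AD Ax|exact: (metric_ge0 dmet)|by rewrite lee_fin].
Qed.

End wasserstein.

(** * Entropy of uniform measures and entropy versus support *)

Section entropy.
Import DualAddTheory.
Variables (R : realType) (X : ptopologicalType).
Variable m : {measure set (borel X) -> \bar R}.
Local Notation P := (probability (borel X) R).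
Local Open Scope ereal_scope.

(** The left-hand side is the tangent line of t ln t at t = 1 / w. Integrating it with w = m(A)
    gives Jensen's inequality in [Ent_ge_support]. *)
Lemma xlnx_ge (t w : R) : (0 <= t)%R -> (0 < w)%R ->
  (t * - ln w + t - w^-1 <= t * ln t)%R.
Proof.
move=> t0 w0; have [->|tn0] := eqVneq t 0%R.
  by rewrite !mul0r !add0r oppr_le0 invr_ge0 ltW.
have t1 : (0 < t)%R by rewrite lt_neqAle eq_sym tn0.
have : (ln (t * w)^-1 <= (t * w)^-1 - 1)%R.
  have tw0 : (0 < (t * w)^-1)%R by rewrite invr_gt0 mulr_gt0.
  rewrite -[leRHS]expRK ler_ln ?posrE ?expR_gt0//.
  by have := expR_ge1Dx ((t * w)^-1 - 1); lra.
rewrite lnV ?posrE ?mulr_gt0// lnM ?posrE// => h.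
have : (t * (- (ln t + ln w)) <= t * ((t * w)^-1 - 1))%R by rewrite ler_pM2l.
have -> : (t * ((t * w)^-1 - 1) = w^-1 - t)%R by field; rewrite !gt_eqF.
lra.
Qed.

Lemma uniform_probability (A : set (borel X)) : measurable A ->
  0 < m A -> m A < +oo ->
  exists mu : P, forall B, measurable B -> mu B = m (B `&` A) * ((fine (m A))^-1)%:E.
Proof.
move=> mA A0 Aoo; pose mr := mrestr m mA.
exists (mnormalize mr (dirac (point : borel X))) => B mB.
have mrT : mr setT = m A by rewrite /mr /mrestr setTI.
rewrite -[LHS]/(mnormalize mr (dirac (point : borel X)) B) /mnormalize.
case: ifPn => [/orP H|_]; last by rewrite -mrT.
case: H => /eqP E.
  by have := A0; rewrite -mrT (E : mr setT = 0) ltxx.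
by have := Aoo; rewrite -mrT (E : mr setT = +oo) ltxx.
Qed.

Section density.
Variables (A : set (borel X)) (mu : P).
Hypotheses (mA : measurable A) (A0 : 0 < m A) (Aoo : m A < +oo).
Let a := fine (m A).
Let aE : m A = a%:E. Proof. by rewrite /a fineK// ge0_fin_numE. Qed.
Let a0 : (0 < a)%R. Proof. by rewrite -lte_fin -aE. Qed.

Let intA : m.-integrable setT (fun x => (\1_A x)%:E).
Proof.
apply/integrableP; split; first exact/measurable_EFinP/measurable_indic.
under eq_integral => x _ do rewrite gee0_abs ?lee_fin//.
by rewrite integral_indic// setIT.
Qed.

(** [Ent] evaluates a density picked by choice; it agrees almost everywhere with the normalized
    indicator [rho0], so the integrals can be computed with the latter. *)
Lemma Ent_uniform_le :
  (forall B, measurable B -> mu B = m (B `&` A) * (a^-1)%:E) ->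
  Ent m mu <= (- ln a)%:E.
Proof.
move=> muE; pose rho0 x : R := (a^-1 * \1_A x)%R.
have mrho0 : measurable_fun setT (rho0 : borel X -> R).
  by apply: measurable_funM => //; exact: measurable_indic.
have rho0E B : measurable B -> mu B = \int[m]_(x in B) (rho0 x)%:E.
  move=> mB; under eq_integral do rewrite EFinM.
  rewrite ge0_integralZl_EFin//; last 2 first.
  - by apply/measurable_EFinP; apply: measurable_funTS; exact: measurable_indic.
  - by rewrite invr_ge0 ltW.
  by rewrite integral_indic// muE// muleC setIC.
rewrite /Ent; case: pselect => [e|[]]; last first.
  by exists rho0; split => // x; rewrite mulr_ge0// invr_ge0 ltW.
case: (cid e) => rho /= [mrho rho_ge0 rhoE].
have int0 : m.-integrable setT (EFin \o rho0).
  apply/integrableP; split; first exact/measurable_EFinP.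
  under eq_integral => x _ do rewrite gee0_abs ?lee_fin ?mulr_ge0 ?invr_ge0 ?(ltW a0)//.
  by rewrite -rho0E// (le_lt_trans (probability_le1 _ _))// ltry.
have ae : ae_eq m setT (EFin \o rho0) (EFin \o rho).
  apply: integral_ae_eq => //; first exact/measurable_EFinP.
  by move=> B _ mB; rewrite -rho0E// rhoE.
pose f : X -> \bar R := fun x => (rho x * ln (rho x))%:E.
rewrite -/f.
pose f0 x : R := ((a^-1 * ln a^-1) * \1_A x)%R.
have mf : measurable_fun setT (f : borel X -> \bar R).
  apply/measurable_EFinP; apply: measurable_funM => //.
  exact: (measurableT_comp (@measurable_ln R)).
have mf0 : measurable_fun setT (f0 : borel X -> R).
  by apply: measurable_funM => //; exact: measurable_indic.
have aef : ae_eq m setT (EFin \o f0) f.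
  apply: filterS ae => x /= /(_ I) [E] _; rewrite /f -E /f0 /rho0 indicE.
  by case: (x \in A); rewrite ?mulr1// !mulr0 mul0r.
have intf0 : m.-integrable setT (EFin \o f0).
  rewrite (_ : EFin \o f0 = (fun x => (a^-1 * ln a^-1)%:E * (\1_A x)%:E)).
    by apply: integrableZl.
  by apply/funext => x; rewrite /= EFinM.
have intf : m.-integrable setT f.
  apply/integrableP; split => //; have /integrableP[_] := intf0.
  rewrite (@ge0_ae_eq_integral _ _ _ m setT (abse \o (EFin \o f0)) (abse \o f))//.
  - by apply: measurableT_comp => //; exact/measurable_EFinP.
  - exact: measurableT_comp.
  - by move=> x _; exact: abse_ge0.
  - by move=> x _; exact: abse_ge0.
  - by apply: filterS aef => x /= E /E [E1]; rewrite /f E1.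
rewrite dual_addeE_def; last first.
  apply: fin_num_adde_defr; apply: integrable_pos_fin_num => //; exact: integrable_funepos.
have fE : \int[m]_x f x = \int[m]_x (EFin \o f0) x.
  by apply/esym/ae_eq_integral => //; exact/measurable_EFinP.
rewrite -integralE fE.
under eq_integral do rewrite /= EFinM.
rewrite integralZl//.
rewrite integral_indic// setIT aE -EFinM lee_fin lnV ?posrE// mulrAC mulVf ?gt_eqF//.
by rewrite mul1r.
Qed.

(** The function [g] is the tangent-line minorant of [xlnx_ge], with the constant term restricted to
    [A] since the density vanishes off [A] almost everywhere; its integral is [- ln a]. Positive and
    negative parts are compared separately because the entropy is a difference of two possibly
    infinite integrals. *)
Lemma Ent_ge_support : mu (~` A) = 0 -> (- ln a)%:E <= Ent m mu.
Proof.
move=> muA; rewrite /Ent; case: pselect => [e|_]; last exact: leey.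
case: (cid e) => rho /= [mrho rho_ge0 rhoE].
pose f : X -> \bar R := fun x => (rho x * ln (rho x))%:E.
rewrite -/f.
have mf : measurable_fun setT (f : borel X -> \bar R).
  apply/measurable_EFinP; apply: measurable_funM => //.
  exact: (measurableT_comp (@measurable_ln R)).
pose g x : R := (rho x * (1 - ln a) - a^-1 * \1_A x)%R.
have intrho : m.-integrable setT (EFin \o rho).
  apply/integrableP; split; first exact/measurable_EFinP.
  under eq_integral => x _ do rewrite gee0_abs ?lee_fin//.
  by rewrite -rhoE// (le_lt_trans (probability_le1 _ _))// ltry.
have gE : EFin \o g = (fun x => (1 - ln a)%:E * (rho x)%:E - (a^-1)%:E * (\1_A x)%:E).
  by apply/funext => x; rewrite /g /= EFinB !EFinM (muleC (rho x)%:E).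
have intg : m.-integrable setT (EFin \o g).
  by rewrite gE; apply: integrableB => //; exact: integrableZl.
have Ig : \int[m]_x (EFin \o g) x = (- ln a)%:E.
  rewrite gE integralB//; try exact: integrableZl.
  rewrite !integralZl// integral_indic// setIT aE -rhoE// probability_setT mule1.
  by rewrite -EFinM mulVf ?gt_eqF// -EFinB; congr (_%:E); lra.
have ae0 : ae_eq m (~` A) (EFin \o rho) (cst 0).
  apply/ae_eq_integral_abs; first exact: measurableC.
    by apply: measurable_funTS; exact/measurable_EFinP.
  rewrite -muA rhoE; last exact: measurableC.
  by apply: eq_integral => x _; rewrite gee0_abs ?lee_fin.
have aeS (Q Q' : borel X -> Prop) : (forall x, Q x -> Q' x) ->
    {ae m, forall x, Q x} -> {ae m, forall x, Q' x}.
  by move=> QQ [N [mN N0 sN]]; exists N; split => // x nx; apply: sN => /QQ.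
have aefg : {ae m, forall x, (EFin \o g) x <= f x}.
  apply: filterS ae0 => x /= H; rewrite lee_fin /g indicE.
  have [xA|xA] := boolP (x \in A).
    by have := xlnx_ge (rho_ge0 x) a0; rewrite mulr1n; lra.
  have [->] := H (fun Ax => negP xA (mem_set Ax)).
  by rewrite !mulr0 !mul0r subr0.
rewrite -Ig integralE -dual_addeE_def; last first.
  apply: fin_num_adde_defr; apply: integrable_pos_fin_num => //.
apply: lee_dB.
- apply: ae_ge0_le_integral => //.
  + by apply: measurable_funepos; exact: (measurable_int _ intg).
  + by apply: measurable_funepos; exact: mf.
  + by move: aefg; apply: aeS => x gf _; rewrite !funeposE; exact: (le_max2 gf (lexx 0)).
- apply: ae_ge0_le_integral => //.
  + by apply: measurable_funeneg; exact: mf.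
  + by apply: measurable_funeneg; exact: (measurable_int _ intg).
  + by move: aefg; apply: aeS => x gf _; rewrite !funenegE; apply: le_max2 => //; rewrite leeN2; exact: gf.
Qed.

End density.
End entropy.

(** * A Brunn-Minkowski inequality from the barycenter curvature condition *)

Section entropy_of_barycenter.
Import DualAddTheory.
Variables (R : realType) (X : ptopologicalType) (d : X -> X -> \bar R).
Variables (m : {measure set (borel X) -> \bar R}) (K : R).
Hypotheses (bcd : BCD d m K) (scX : @second_countable X).
Local Notation P := (probability (borel X) R).
Local Open Scope ereal_scope.

Let dmet : is_metric d. Proof. by case: bcd. Qed.

Let md2 (x0 : X) : measurable_fun setT ((fun y => d x0 y ^+ 2) : borel X -> \bar R).
Proof.
have h : measurable_fun setT ((fun y => d x0 y) : borel X -> \bar R).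
  have mp : measurable_fun setT ((fun x => (x0, x)) : borel X -> (borel X * borel X)%type).
    by apply: measurable_fun_pair.
  exact: (measurableT_comp (metric_measurable dmet scX) mp).
by rewrite (_ : (fun y => _) = (fun y => d x0 y * d x0 y)) //; exact: emeasurable_funM.
Qed.

Lemma bounded_support_P2 (mu : P) (A : set X) (D : R) (x0 : X) :
  measurable (A : set (borel X)) -> mu (~` A) = 0 -> (0 <= D)%R ->
  (forall x, A x -> d x0 x <= D%:E) -> P2 d mu.
Proof.
move=> mA muA D0 AD; exists x0; apply: (@le_lt_trans _ _ (D ^+ 2)%:E); last exact: ltry.
rewrite -[leRHS]mule1 -(probability_setT mu) -integral_cst//.
apply: ae_ge0_le_integral => //.
- by move=> x _; rewrite expe2 mule_ge0// (metric_ge0 dmet).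
- by move=> x _; rewrite lee_fin sqr_ge0.
exists (~` A); split; [exact: measurableC|exact: muA|].
move=> x /= nx Ax; apply: nx => _.
rewrite EFin_expe lee_sqr; [exact: AD Ax|exact: (metric_ge0 dmet)|by rewrite lee_fin].
Qed.

(** The curvature condition is applied to the uniform probabilities on the [A i]. Their barycenter
    is concentrated on [W] by [barycenter_retract], so its entropy is at least -ln m(W), while the
    given measures have entropies at most -ln m(A_i). The curvature term is bounded through the
    cost, which is at most [D ^+ 2]. *)
Lemma barycenter_brunn_minkowski (k : nat) (lambda : 'I_k -> R)
    (r : X -> X) (A : 'I_k -> set X) (h : 'I_k -> X -> R) (W : set X) (c C D : R) (x0 : X) :
  (forall i, (0 < lambda i)%R) -> (\sum_(i < k) lambda i = 1)%R ->
  measurable_fun setT (r : borel X -> borel X) ->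
  (0 <= D)%R -> (forall z, d x0 (r z) <= D%:E) ->
  (forall i, measurable (A i : set (borel X))) ->
  (forall i, 0 < m (A i)) -> (forall i, m (A i) < +oo) ->
  (forall i x, A i x -> d x0 x <= D%:E) ->
  (forall i, measurable_fun setT (h i : borel X -> R)) ->
  (0 <= C)%R -> (forall i z, (0 <= h i z + C)%R) ->
  (forall i z x, A i x -> d (r z) x ^+ 2 + (h i z)%:E <= d z x ^+ 2) ->
  measurable (W : set (borel X)) -> 0 < m W -> m W < +oo -> (0 < c)%R ->
  (forall z, W z -> (0 <= \sum_i lambda i * h i z)%R) ->
  (forall z, ~ W z -> (c <= \sum_i lambda i * h i z)%R) ->
  (\sum_(i < k) lambda i * ln (fine (m (A i))) - `|K| / 2 * D ^+ 2 <= ln (fine (m W)))%R.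
Proof.
move=> lam0 lam1 mr D0 rD mA A0 Aoo AD mh C0 hC hd mW W0 Woo c0 hW hWn.
have ex i : exists mu : P, forall B, measurable B -> mu B = m (B `&` A i) * ((fine (m (A i)))^-1)%:E.
  exact: uniform_probability.
pose mu i := projT1 (cid (ex i)).
have muE i : forall B, measurable B -> mu i B = m (B `&` A i) * ((fine (m (A i)))^-1)%:E.
  exact: (projT2 (cid (ex i))).
have muA i : mu i (~` A i) = 0.
  by rewrite muE ?setICl ?measure0 ?mul0e//; exact: measurableC.
have [_ _ /(_ k mu lambda)] := bcd.
case=> //; first by move=> i; exact: (bounded_support_P2 (mA i) (muA i) D0 (AD i)).
move=> nu nub ent.
have costD : barycenter_cost d lambda mu nu <= (D ^+ 2)%:E.
  by apply: (barycenter_cost_le dmet scX nub _ lam1 mA muA D0 AD) => i; exact: ltW.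
have cost0 : 0 <= barycenter_cost d lambda mu nu.
  by apply: sume_ge0 => i _; rewrite mule_ge0 ?lee_fin ?W2sq_ge0// ltW.
have nuW : nu (~` W) = 0.
  apply: (barycenter_retract dmet scX nub lam0 lam1 (le_lt_trans costD (ltry _)) mr rD mA muA mh
    C0 hC hd mW c0 hW hWn).
have := le_trans (Ent_ge_support mW W0 Woo nuW) ent.
rewrite -/(barycenter_cost d lambda mu nu).
set S := barycenter_cost _ _ _ _ in costD cost0 *.
have Sf : S \is a fin_num by rewrite ge0_fin_numE// (le_lt_trans costD)// ltry.
have entA : (\sum_(i < k) ((lambda i)%:E * Ent m (mu i)))%dE <=
    (\sum_(i < k) lambda i * - ln (fine (m (A i))))%:E.
  rewrite -dsumEFin; apply: lee_dsum => i _; rewrite EFinM lee_pmul2l ?lte_fin//.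
  by apply: (Ent_uniform_le (mA i) (A0 i) (Aoo i)); exact: muE.
have KS : - ((K / 2)%:E * S) <= (`|K| / 2 * D ^+ 2)%:E.
  rewrite -(fineK Sf) -EFinM -EFinN lee_fin.
  have s0 : (0 <= fine S)%R by exact: fine_ge0.
  have sD : (fine S <= D ^+ 2)%R by rewrite -lee_fin fineK.
  have : (- K <= `|K|)%R by rewrite -normrN ler_norm.
  have := mulr_ge0 (normr_ge0 K) (_ : 0 <= D ^+ 2 - fine S)%R.
  rewrite subr_ge0 => /(_ sD) h1 h2; have := ler_wpM2r s0 h2; lra.
move=> /le_trans - /(_ _ (leeD entA KS)); rewrite -EFinD.
rewrite lee_fin; under eq_bigr do rewrite mulrN; rewrite sumrN; lra.
Qed.

End entropy_of_barycenter.

(** The integral of a nonnegative function is a supremum over the simple functions below it, hence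
    monotone for arbitrary functions. It serves to compare integrals of [speed], which is defined
    pointwise by choice. *)
Lemma ge0_le_integral_nonmeasurable d (T : measurableType d) (R : realType)
    (mu : {measure set T -> \bar R}) (D : set T) (f g : T -> \bar R) :
  (forall x, D x -> (0 <= f x)%E) -> (forall x, D x -> (f x <= g x)%E) ->
  (\int[mu]_(x in D) f x <= \int[mu]_(x in D) g x)%E.
Proof.
move=> f0 fg; have g0 x : D x -> (0 <= g x)%E by move=> Dx; rewrite (le_trans (f0 x Dx)) ?fg.
rewrite !ge0_integralE//; apply: ereal_sup_le => _ [h hf <-]; exists h => // x.
apply: le_trans (hf x) _; rewrite /patch; case: ifPn => // /set_mem Dx; exact: fg.
Qed.

(** * Extrema on the unit sphere *)

Section sphere.
Variables (R : realType) (n : nat).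
Local Notation V := 'rV[R]_n.
Implicit Types (g : V -> R) (w : V).

Definition sphere : set V := [set w | `|w| = 1].

Lemma sphere_compact : compact sphere.
Proof.
apply: bounded_closed_compact.
  by exists 1; split => // M M1 w; rewrite /sphere/= => ->; exact: ltW.
have -> : sphere = (fun w : V => `|w|) @^-1` [set 1] by [].
apply: closed_comp; last exact: closed_eq.
by move=> w _; exact: norm_continuous.
Qed.

Lemma sphere_neq0 w : sphere w -> w != 0.
Proof. by move=> w1; rewrite -normr_eq0 w1 oner_neq0. Qed.

Lemma sphere_normalize w : w != 0 -> sphere (`|w|^-1 *: w).
Proof. by move=> w0; rewrite /sphere/= normrZ normfV normr_id mulVf ?normr_eq0. Qed.

Lemma sphere_min g : (forall w, w != 0 -> {for w, continuous g}) ->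
  (forall w, w != 0 -> 0 < g w) ->
  exists2 c : R, 0 < c & forall w, sphere w -> c <= g w.
Proof.
move=> cg g0; have [S0|S0] := pselect (sphere !=set0); last first.
  by exists 1 => // w w1; case: S0; exists w.
have cgS : {within sphere, continuous g}.
  by apply/continuous_in_subspaceT => w /set_mem/sphere_neq0; exact: cg.
have [w wS wmin] := EVT_min_rV S0 sphere_compact cgS.
exists (g w); first by apply/g0/sphere_neq0/set_mem.
by move=> w' w'S; apply: wmin; exact: mem_set.
Qed.

Lemma sphere_max g : (forall w, w != 0 -> {for w, continuous g}) ->
  exists2 c : R, 0 < c & forall w, sphere w -> g w <= c.
Proof.
move=> cg; have [S0|S0] := pselect (sphere !=set0); last first.
  by exists 1 => // w w1; case: S0; exists w.
have cgS : {within sphere, continuous g}.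
  by apply/continuous_in_subspaceT => w /set_mem/sphere_neq0; exact: cg.
have [w wS wmax] := EVT_max_rV S0 sphere_compact cgS.
exists (Num.max 1 (g w)); first by rewrite lt_max ltr01.
by move=> w' w'S; rewrite le_max wmax ?orbT//; exact: mem_set.
Qed.

End sphere.

Lemma diff_chain (R : realType) (U V W : normedModType R) (f : U -> V) (g : V -> W)
    (x : U) (y : V) (w : U) : differentiable f x -> f x = y -> differentiable g y ->
  differentiable (g \o f) x /\ 'd (g \o f) x w = 'd g y ('d f x w).
Proof.
by move=> df <- dg; split; [exact: differentiable_comp|rewrite diff_comp].
Qed.

(** * Tangent vectors in coordinates *)

Section tangent_coordinates.
Variables (R : realType) (n : nat) (M : ptopologicalType).
Variable A : smooth_manifold R n M.
Local Notation V := 'rV[R]_n.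
Local Notation dom i := (@chart_dom R n M A i).
Local Notation phi i := (@chart_map R n M A i).
Local Notation psi i := (@chart_inv R n M A i).

Definition chart_image i : set V := phi i @` dom i.

Lemma chart_image_open i : open (chart_image i).
Proof. exact: chart_codom_open. Qed.

Lemma chart_invP i y : chart_image i y -> dom i (psi i y) /\ phi i (psi i y) = y.
Proof. by move=> [x xi <-]; rewrite (chart_mapK xi). Qed.

Lemma chart_inv_cont i y : chart_image i y -> {for y, continuous (psi i)}.
Proof. by move=> [x xi <-]; exact: chart_inv_continuous. Qed.

Lemma overlapE i j : phi i @` (dom i `&` dom j) = chart_image i `&` psi i @^-1` dom j.
Proof.
apply/seteqP; split => [_ [x [xi xj] <-]|y [[x xi <-]]].
  by split; [exists x|rewrite /= chart_mapK].
by rewrite /= chart_mapK// => xj; exists x.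
Qed.

Lemma overlap_open i j : open (phi i @` (dom i `&` dom j)).
Proof.
rewrite overlapE; apply: open_preimageI; first exact: chart_image_open.
  by move=> y; exact: chart_inv_cont.
exact: chart_dom_open.
Qed.

Lemma transition_differentiable i j x : dom i x -> dom j x ->
  differentiable (phi j \o psi i) (phi i x).
Proof. by move=> xi xj; apply: (transition_smooth i j 1%N).1; exists x. Qed.

Lemma transition_comp i j k x : dom i x -> dom j x -> dom k x ->
  \forall y \near phi i x, ((phi k \o psi j) \o (phi j \o psi i)) y = (phi k \o psi i) y.
Proof.
move=> xi xj xk.
have : nbhs (phi i x) (phi i @` (dom i `&` dom j)).
  by apply: open_nbhs_nbhs; split; [exact: overlap_open|exists x].
apply: filterS => _ [z [zi zj] <-] /=.
by rewrite (chart_mapK zi) (chart_mapK zj).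
Qed.

(** Transporting [w] from chart [i] to all other charts is consistent by the chain rule for
    transition maps. *)
Lemma tangent_family_of i x (w : V) : dom i x ->
  (fun j => if `[< dom j x >] then 'd (phi j \o psi i) (phi i x) w else 0)
    \in @tangent_family R n M A x.
Proof.
move=> xi; apply/asboolP; split => [j k xj xk|j xj]; last by case: asboolP.
case: asboolP => // _; case: asboolP => // _.
have dji := transition_differentiable xi xj; have dkj := transition_differentiable xj xk.
have Tx : (phi j \o psi i) (phi i x) = phi j x by rewrite /= chart_mapK.
have [dc dE] := @diff_chain R V V V (phi j \o psi i) (phi k \o psi j) _ _ w dji Tx dkj.
have dki := transition_differentiable xi xk.
apply: etrans dE.
apply: (etrans (esym (deriveE w dki))); apply: (etrans _ (deriveE w dc)).
by apply/esym; apply: near_eq_derive; exact: transition_comp.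
Qed.

Definition tangent_of i x (xi : dom i x) (w : V) : tangent A x :=
  Tangent (tangent_family_of w xi).

Lemma tangent_ofK i x (xi : dom i x) w : tangent_of xi w i = w.
Proof.
rewrite /=; case: asboolP => // _.
have dii := transition_differentiable xi xi.
rewrite -deriveE//.
have -> : 'D_w (phi i \o psi i) (phi i x) = 'D_w id (phi i x).
  apply: near_eq_derive.
  have : nbhs (phi i x) (chart_image i).
    by apply: open_nbhs_nbhs; split; [exact: chart_image_open|exists x].
  by apply: filterS => _ [z zi <-] /=; rewrite chart_mapK.
exact: derive_id.
Qed.

Lemma tangent_transition i j x (v : tangent A x) : dom i x -> dom j x ->
  v j = 'd (phi j \o psi i) (phi i x) (v i).
Proof. by case: v => v /= /asboolP[+ _]; apply. Qed.

Lemma tangent_inj i x (v v' : tangent A x) : dom i x -> v i = v' i -> v = v'.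
Proof.
move=> xi vv'; apply: val_inj; apply/funext => j /=.
have [xj|xj] := pselect (dom j x).
  by rewrite (tangent_transition v xi xj) (tangent_transition v' xi xj) vv'.
by case: v v' {vv'} => v /= /asboolP[_ v0] [v' /= /asboolP[_ v'0]]; rewrite v0// v'0.
Qed.

Lemma tcoordD i x (u v : tangent A x) : (u + v) i = u i + v i.
Proof. by []. Qed.

Lemma tcoordZ i x a (v : tangent A x) : (a *: v) i = a *: v i.
Proof. by []. Qed.

Lemma tcoordN i x (v : tangent A x) : (- v) i = - v i.
Proof. by []. Qed.

Lemma tcoord0 i x : (0 : tangent A x) i = 0.
Proof. by []. Qed.

Lemma tcoord_eq0 i x (v : tangent A x) : dom i x -> (v i == 0) = (v == 0).
Proof.
move=> xi; apply/eqP/eqP => [v0|->]; last exact: tcoord0.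
by apply: (tangent_inj xi); rewrite v0 tcoord0.
Qed.

End tangent_coordinates.

Section linear_functional.
Variables (R : realType) (n : nat).
Local Notation V := 'rV[R]_n.
Implicit Types (q w : V).

Definition dotr q w : R := \sum_j w 0 j * q 0 j.

Lemma dotrD q u w : dotr q (u + w) = dotr q u + dotr q w.
Proof. by rewrite /dotr -big_split/=; apply: eq_bigr => j _; rewrite mxE mulrDl. Qed.

Lemma dotrZ q a w : dotr q (a *: w) = a * dotr q w.
Proof. by rewrite /dotr mulr_sumr; apply: eq_bigr => j _; rewrite mxE mulrA. Qed.

Lemma dotrB q u w : dotr q (u - w) = dotr q u - dotr q w.
Proof. by rewrite -scaleN1r dotrD dotrZ mulN1r. Qed.

Lemma dotr_continuous q : continuous (dotr q).
Proof.
move=> u; apply: continuous_at_sum => j.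
apply: continuousM; [exact: coord_continuous|exact: cst_continuous].
Qed.

Lemma is_derive_dotr q (g : R -> V) (t : R) : derivable g t 1 ->
  is_derive t 1 (fun s => dotr q (g s)) (dotr q ('D_1 g t)).
Proof.
move=> dg; have dgj j : is_derive t (1 : R) (fun s => g s 0 j * q 0 j) ('D_1 g t 0 j * q 0 j).
  have dj : derivable (fun s => g s 0 j) t 1 by exact: (derivable_mxP g t 1).1.
  have -> : 'D_1 g t 0 j = 'D_1 (fun s => g s 0 j) t by rewrite derive_mx// mxE.
  have dj' := derivableP dj.
  by apply: is_derive_eq; rewrite scaler0 add0r [LHS]mulrC.
have := @is_derive_sum R R R n (fun j s => g s 0 j * q 0 j) t 1
  (fun j => 'D_1 g t 0 j * q 0 j) dgj.
rewrite (_ : \sum_(i < n) _ = (fun s => dotr q (g s)))//.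
by apply/funext => s; rewrite fct_sumE.
Qed.

End linear_functional.

Section coordinate_norm.
Variables (R : realType) (n : nat).
Local Notation V := 'rV[R]_n.

(** The Finsler norm read in a chart. The function [f] represents [F] off the zero section only, so
    the value at [w = 0] is put in by hand. *)
Definition cnorm (f : V * V -> R) (y w : V) : R := if w == 0 then 0 else f (y, w).

End coordinate_norm.

(** * Lower bounds for lengths of curves by calibration *)

Section curves.
Variables (R : realType) (n : nat) (M : ptopologicalType).
Variable A : smooth_manifold R n M.
Local Notation V := 'rV[R]_n.
Local Notation dom i := (@chart_dom R n M A i).
Local Notation phi i := (@chart_map R n M A i).
Local Notation psi i := (@chart_inv R n M A i).
Variable F : finsler_structure A.

Lemma finsler_norm0 x : F x 0 = 0.
Proof.
have := finsler_homogeneous F (0 : tangent A x) (ltr0n R 2).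
by rewrite scaler0; lra.
Qed.

Lemma speed_ge0 (c : R -> M) t : 0 <= speed F c t.
Proof. by rewrite /speed; case: xgetP => // _ _ [v _ <-]; exact: finsler_ge0. Qed.

Variables (i : chart A) (f : V * V -> R).
Hypothesis fE : forall x (v : tangent A x), dom i x -> v != 0 -> F x v = f (phi i x, v i).

Lemma finsler_cnorm x (v : tangent A x) : dom i x -> F x v = cnorm f (phi i x) (v i).
Proof.
move=> xi; rewrite /cnorm tcoord_eq0//; have [->|v0] := eqVneq v 0.
  exact: finsler_norm0.
exact: fE.
Qed.

(** The chain rule turns the derivative in one chart into a velocity valid in every chart, and a
    tangent vector is determined by one coordinate representation; so the choice inside [speed] is
    forced. *)
Lemma speedE (c : R -> M) (t : R) : dom i (c t) -> {for t, continuous c} ->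
  derivable (phi i \o c) t 1 ->
  speed F c t = cnorm f (phi i (c t)) ('D_1 (phi i \o c) t).
Proof.
move=> cti cc dc; set w := 'D_1 _ t.
pose v := tangent_of cti w.
have vi : v i = w by exact: tangent_ofK.
have cdom : \forall s \near t, dom i (c s).
  by apply: cc; apply: open_nbhs_nbhs; split => //; exact: chart_dom_open.
have dfc : differentiable (phi i \o c) t by apply/derivable1_diffP.
have vel : is_velocity v.
  move=> j ctj.
  have dT := transition_differentiable cti ctj.
  have [dTc dTcE] := @diff_chain R R V V (phi i \o c) (phi j \o psi i) t (phi i (c t)) 1
    dfc erefl dT.
  have nE : \forall s \near t, ((phi j \o psi i) \o (phi i \o c)) s = (phi j \o c) s.
    by apply: filterS cdom => s si /=; rewrite chart_mapK.
  apply: (near_eq_is_derive nE); apply: DeriveDef; first exact: diff_derivable.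
  apply: (etrans (deriveE _ dTc)); apply: (etrans dTcE).
  rewrite (tangent_transition v cti ctj) vi /w.
  by congr ('d _ _ _); rewrite deriveE.
rewrite -vi -finsler_cnorm// /speed.
apply: xget_unique; first by exists v.
move=> _ [v' vel' <-]; congr (F _ _); apply: (tangent_inj cti).
by have [_ <-] := vel' i cti; rewrite vi.
Qed.

Section lower_bound.
Variables (c : R -> M) (t1 : R) (q : V).
Hypothesis t101 : 0 <= t1 <= 1.
Hypothesis cdom : forall t, 0 <= t <= t1 -> dom i (c t).
Hypothesis cq : forall t w, 0 <= t <= t1 -> dotr q w <= cnorm f (phi i (c t)) w.

Let g t := dotr q (phi i (c t)).

(** The covector [q] is dominated by the norm, so the speed dominates the derivative of [g], and the
    fundamental theorem of calculus recovers the increment of [g]. The bound is given through a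
    measurable minorant [sigma] supported in the open piece, so that pieces can be added; [t1] is
    the time up to which the curve stays in the chart. *)
Lemma length_piece (a b : R) (c' : R -> M) : 0 <= a -> a < b -> b <= 1 ->
  C1_curve_on A `[a, b]%classic c' -> (forall t, a <= t <= b -> c t = c' t) ->
  exists sigma : R -> R, [/\ measurable_fun setT sigma, forall t, 0 <= sigma t,
    forall t, ~ (a < t < b) -> sigma t = 0,
    forall t, a < t < b -> sigma t <= speed F c t &
    ((g (Num.min b t1) - g (Num.min a t1))%:E <=
      \int[lebesgue_measure]_(t in `[0%R, 1%R]) (sigma t)%:E)%E].
Proof.
move=> a0 ab b1 [U [oU JU] c'U] cc'.
have [t1a|at1] := leP t1 a.
  exists (cst 0); split => //; first by move=> t _; exact: speed_ge0.
  rewrite (min_idPr (le_trans t1a (ltW ab))) subrr.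
  by apply: integral_ge0.
set b' := Num.min b t1.
have ab' : a < b' by rewrite lt_min ab at1.
have b'b : b' <= b by rewrite ge_min lexx.
have b't : b' <= t1 by rewrite ge_min lexx orbT.
have cdom' t : a <= t <= b' -> dom i (c' t).
  move=> /andP[at_ tb]; rewrite -cc'; last by rewrite at_ (le_trans tb).
  by apply: cdom; rewrite (le_trans a0 at_) (le_trans tb).
have tU t : a <= t <= b' -> U t.
  by move=> /andP[at_ tb]; apply: JU; rewrite /= in_itv/= at_ (le_trans tb).
pose h t := dotr q (derive1 (phi i \o c') t).
pose G t := dotr q ((phi i \o c') t).
have dc' t : a <= t <= b' -> derivable (phi i \o c') t 1.
  by move=> tab; have [_ /(_ i (cdom' t tab))[/nbhs_singleton]] := c'U t (tU t tab).
have Gd t : a <= t <= b' -> is_derive t 1 G (h t).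
  by move=> tab; rewrite /G /h derive1E; exact: is_derive_dotr (dc' t tab).
have hc t : a <= t <= b' -> {for t, continuous h}.
  move=> tab; have [_ /(_ i (cdom' t tab))[_ cd]] := c'U t (tU t tab).
  exact: (continuous_comp cd (@dotr_continuous _ _ q _)).
have hw : {within `[a, b'], continuous h}.
  by apply: continuous_in_subspaceT => t /set_mem; rewrite /= in_itv/=; exact: hc.
have FTC : (\int[lebesgue_measure]_(t in `[a, b']) (h t)%:E = (G b')%:E - (G a)%:E)%E.
  apply: continuous_FTC2 => //.
    have Gc t : a <= t <= b' -> {for t, continuous G}.
      move=> tab; apply: differentiable_continuous; apply/derivable1_diffP.
      by have [] := Gd t tab.
    split.
    - move=> t; rewrite in_itv/= => /andP[ta tb].
      by have [] : is_derive t 1 G (h t) by apply: Gd; rewrite !ltW.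
    - by apply: cvg_at_right_filter; apply: Gc; rewrite lexx ltW.
    - by apply: cvg_at_left_filter; apply: Gc; rewrite lexx ltW.
  move=> t; rewrite in_itv/= => /andP[ta tb]; rewrite derive1E.
  by have [_ ->] : is_derive t 1 G (h t) by apply: Gd; rewrite !ltW.
have mh : measurable_fun `[a, b'] h.
  by apply: subspace_continuous_measurable_fun => //.
pose D : set R := `]a, b'[%classic.
have mhD : measurable_fun D (fun t => Num.max (h t) 0).
  apply: measurable_funS (_ : measurable_fun `[a, b'] _) => //.
    by apply: subset_itvW.
  exact: measurable_maxr.
exists ((fun t => Num.max (h t) 0) \_ D); split.
- have mD : measurable D by exact: measurable_itv.
  exact: (measurable_restrictT _ mD).1 mhD.
- move=> t; rewrite /patch; case: ifP => _; [by rewrite le_max lexx orbT|exact: lexx].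
- move=> t nt; rewrite /patch; case: ifPn => // /set_mem; rewrite /D/= in_itv/= => /andP[ta tb].
  by case: nt; rewrite ta (lt_le_trans tb).
- move=> t _; rewrite /patch; case: ifPn => [/set_mem|_]; last exact: speed_ge0.
  rewrite /D/= in_itv/= => /andP[ta tb]; rewrite ge_max speed_ge0 andbT.
  have tab : a <= t <= b' by rewrite !ltW.
  have ncc : \forall s \near t, c' s = c s.
    have : \forall s \near t, s \in `]a, b[.
      by apply: near_in_itvoo; rewrite in_itv/= ta (lt_le_trans tb).
    by apply: filterS => s; rewrite in_itv/= => /andP[/ltW ? /ltW ?]; rewrite cc'//; apply/andP.
  have ctE : c t = c' t by rewrite (nbhs_singleton ncc).
  have cti : dom i (c t) by rewrite ctE; exact: cdom'.
  have cct : {for t, continuous c}.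
    have [c'c _] := c'U t (tU t tab).
    rewrite /prop_for /continuous_at ctE; apply: cvg_trans c'c; apply: near_eq_cvg.
    exact: ncc.
  have nphi : \forall s \near t, (phi i \o c') s = (phi i \o c) s.
    by apply: filterS ncc => s /= ->.
  have dct : derivable (phi i \o c) t 1 by apply: near_eq_derivable nphi (dc' t tab).
  rewrite (speedE cti cct dct) /h derive1E (near_eq_derive _ nphi).
  by apply: cq; move/andP: tab => [at_ tb']; rewrite (le_trans a0 at_) (le_trans tb').
- have DS : D `<=` `[0%R, 1%R]%classic.
    move=> t; rewrite /D/= !in_itv/= => /andP[/ltW ta /ltW tb].
    by rewrite (le_trans a0 ta) (le_trans tb)// (le_trans b'b).
  have -> : (fun t : R => (((fun t => Num.max (h t) 0) \_ D) t)%:E) =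
      (fun t => (Num.max (h t) 0)%:E) \_ D.
    by apply/funext => t; rewrite /patch; case: ifP.
  rewrite -integral_mkcondr (setIidr DS) -(@integral_itv_bndoo _ a b' _ true false); last first.
    exact/measurable_EFinP.
  have -> : ((g b' - g a)%:E = (G b')%:E - (G a)%:E)%E.
    by rewrite -EFinB /g /G/= !cc' ?lexx ?(ltW ab)//; rewrite (ltW ab').
  rewrite -FTC integralE.
  have -> : (\int[lebesgue_measure]_(t in `[a, b']) (Num.max (h t) 0)%:E =
      \int[lebesgue_measure]_(t in `[a, b']) (fun t => (h t)%:E)^\+ t)%E.
    by apply: eq_integral => t _; rewrite funeposE EFin_max.
  by apply: geeDl; rewrite oppe_le0 integral_ge0.
Qed.

Lemma curve_length_ge : piecewise_C1 A c -> ((g t1 - g 0)%:E <= curve_length F c)%E.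
Proof.
move=> [s [s_sorted /eqP s_last] pieces].
pose p k := nth 0 (0 :: s) k.
have pS k : nth 0 s k = p k.+1 by [].
have sz : last 0 s = p (size s) by exact: (esym (nth_last 0 (0 :: s))).
have pmono k l : (k <= l)%N -> (l <= size s)%N -> p k <= p l.
  move=> kl ls; have ss : sorted <=%O (0 :: s).
    by apply: sub_path s_sorted => x y /ltW.
  by apply: (sorted_leq_nth le_trans (@lexx _ R) 0 ss); rewrite ?inE//= ltnS (leq_trans kl).
have pstrict k : (k < size s)%N -> p k < p k.+1.
  move=> ks; have := @sorted_ltn_nth _ <%O lt_trans 0 (0 :: s) s_sorted.
  by move=> /(_ k k.+1); apply; rewrite ?inE//= ltnS// ltnW.
have p0 : p 0%N = 0 by [].
have p1 : p (size s) = 1 by rewrite -sz.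
have piece (k : 'I_(size s)) : exists sigma : R -> R, [/\ measurable_fun setT sigma,
    forall t, 0 <= sigma t,
    forall t, ~ (p k < t < p k.+1) -> sigma t = 0,
    forall t, p k < t < p k.+1 -> sigma t <= speed F c t &
    ((g (Num.min (p k.+1) t1) - g (Num.min (p k) t1))%:E <=
      \int[lebesgue_measure]_(t in `[0%R, 1%R]) (sigma t)%:E)%E].
  have [c' c'C cc'] := pieces k (ltn_ord k).
  apply: (@length_piece _ _ c').
  - by rewrite -p0 pmono// ltnW.
  - exact: pstrict.
  - by rewrite -p1 pmono.
  - exact: c'C.
  - by move=> t tk; apply: cc'; rewrite /= in_itv/=.
have [sigma sP] := choice piece.
(* The open pieces are disjoint, so at each time at most one [sigma k] is nonzero and their sum is
   still below the speed; the increments of [g] then telescope. *)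
apply: (@le_trans _ _ (\int[lebesgue_measure]_(t in `[0%R, 1%R])
    (\sum_(k < size s) (sigma k t)%:E))%E); last first.
  apply: ge0_le_integral_nonmeasurable => t _.
    by apply: sume_ge0 => k _; rewrite lee_fin; have [] := sP k.
  rewrite sumEFin lee_fin.
  have [[k tk]|no] := pselect (exists k : 'I_(size s), p k < t < p k.+1); last first.
    rewrite big1 ?speed_ge0// => k _; have [_ _ s0 _ _] := sP k; apply: s0.
    by move=> tk; apply: no; exists k.
  rewrite (bigD1 k)//= big1 ?addr0; first by have [_ _ _ + _] := sP k; apply.
  move=> l lk; have [_ _ s0 _ _] := sP l; apply: s0 => tl.
  move/andP: tk => [tk1 tk2]; move/andP: tl => [tl1 tl2].
  have [lek|] := ltnP l k.
    by have := lt_le_trans tl2 (pmono l.+1 k lek (ltnW (ltn_ord k))); rewrite ltNge (ltW tk1).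
  rewrite leq_eqVlt => /orP[/eqP/val_inj kl|kl]; first by rewrite kl eqxx in lk.
  by have := lt_le_trans tk2 (pmono k.+1 l kl (ltnW (ltn_ord l))); rewrite ltNge (ltW tl1).
rewrite ge0_integral_sum//; last 2 first.
- by move=> k; apply/measurable_EFinP; apply: measurable_funTS; have [] := sP k.
- by move=> k t _; rewrite lee_fin; have [] := sP k.
apply: (@le_trans _ _ (\sum_(k < size s) (g (Num.min (p k.+1) t1) - g (Num.min (p k) t1))%:E)%E).
  rewrite sumEFin lee_fin -(big_mkord xpredT (fun k => g (Num.min (p k.+1) t1) - g (Num.min (p k) t1))).
  rewrite telescope_sumr// p0 p1; have /andP[t10 t11] := t101.
  by rewrite (min_idPr t11) (min_idPl t10).
by apply: lee_sum => k _; have [] := sP k.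
Qed.

End lower_bound.
End curves.

(** * Comparison of the Finsler distance with a fixed norm in a chart *)

Section distance.
Variables (R : realType) (n : nat) (M : ptopologicalType).
Variable A : smooth_manifold R n M.
Local Notation V := 'rV[R]_n.
Local Notation dom i := (@chart_dom R n M A i).
Local Notation phi i := (@chart_map R n M A i).
Local Notation psi i := (@chart_inv R n M A i).
Variable F : finsler_structure A.

Lemma piecewise_C1_continuous (c : R -> M) : piecewise_C1 A c ->
  {within `[0, 1], continuous c}.
Proof.
move=> [s [s_sorted /eqP s_last] pieces].
pose p k := nth 0 (0 :: s) k.
have p1 : p (size s) = 1 by rewrite -s_last; exact: (nth_last 0 (0 :: s)).
have pmono k l : (k <= l)%N -> (l <= size s)%N -> p k <= p l.
  move=> kl ls; have ss : sorted <=%O (0 :: s).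
    by apply: sub_path s_sorted => x y /ltW.
  by apply: (sorted_leq_nth le_trans (@lexx _ R) 0 ss); rewrite ?inE//= ltnS (leq_trans kl).
have piece k : (k < size s)%N -> {within `[p k, p k.+1], continuous c}.
  move=> ks; have [c' [U [oU JU] c'U] cc'] := pieces k ks.
  apply/subspace_continuousP => t tk.
  have [c't _] := c'U t (JU _ tk).
  suff : c @ within `[p k, p k.+1] (nbhs t) --> c' t by rewrite -(cc' t tk).
  have c'tw : c' @ within `[p k, p k.+1] (nbhs t) --> c' t by exact: cvg_within_filter.
  apply: cvg_trans c'tw; apply: near_eq_cvg.
  have near_eq : \forall x \near nbhs t, `[p k, p k.+1]%classic x -> c' x = c x.
    by apply: filterE => x xk; exact: esym (cc' x xk).
  exact: near_eq.
suff H k : (k <= size s)%N -> {within `[0, p k], continuous c}.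
  by rewrite -p1; exact: H.
elim: k => [_|k IH ks].
  rewrite (_ : `[0, p 0%N]%classic = [set 0]); last by rewrite set_itv1.
  exact: continuous_subspace1.
have -> : `[0, p k.+1]%classic = `[0, p k] `|` `[p k, p k.+1].
  apply/seteqP; split => t; rewrite /= !in_itv/=.
    by move=> /andP[t0 tk]; have [tp|/ltW tp] := leP t (p k); [left|right]; apply/andP.
  have h0 : 0 <= p k by apply: (pmono 0%N) => //; exact: ltnW.
  have h1 : p k <= p k.+1 by exact: pmono.
  by move=> [/andP[-> tp]|/andP[tp ->]]; [rewrite (le_trans tp h1)|rewrite (le_trans h0 tp)].
by apply: withinU_continuous; [exact: interval_closed|exact: interval_closed
  |apply: IH; exact: ltnW|exact: piece].
Qed.

Variables (i : chart A) (f : V * V -> R).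
Hypothesis fE : forall x (v : tangent A x), dom i x -> v != 0 -> F x v = f (phi i x, v i).
Local Notation chart_image := (@chart_image R n M A).

Lemma segment_length_le (O : set V) (a b : V) (K : R) :
  open O -> O `<=` chart_image i -> (forall t, 0 <= t <= 1 -> O (a + t *: (b - a))) ->
  (forall y, O y -> cnorm f y (b - a) <= K) ->
  (finsler_dist F (psi i a) (psi i b) <= K%:E)%E.
Proof.
move=> oO Oi seg Kle; set w := b - a in seg Kle.
pose line t : V := a + t *: w.
pose c t := psi i (line t).
have line_cont : continuous line.
  move=> t; have ct : {for t, continuous (fun t : R => t *: w)}.
    by apply: continuousZr_tmp; exact: cvg_id.
  exact: (continuousD (@cst_continuous _ _ a t) ct).
pose U := line @^-1` O.
have oU : open U by apply: open_comp => // t _; exact: line_cont.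
have cU t : U t -> {for t, continuous c}.
  move=> Ut; apply: (continuous_comp (line_cont t)).
  by apply: chart_inv_cont; exact: Oi.
have overlap_deriv j t : U t -> dom j (c t) ->
    \forall s \near t, is_derive (s : R) 1 (phi j \o c) ('D_w (phi j \o psi i) (line s)).
  move=> Ut cj.
  have : \forall s \near t, (phi i @` (dom i `&` dom j)) (line s).
    apply: line_cont; apply: open_nbhs_nbhs; split; first exact: overlap_open.
    by rewrite overlapE; split; [exact: Oi|].
  apply: filterS => s sO.
  have dT : differentiable (phi j \o psi i) (line s) by exact: (transition_smooth i j 1%N).1.
  exact: (@is_derive_line R V V (phi j \o psi i) a w s _ (derivableP (diff_derivable dT))).
have cC1 : C1_curve_on A `[0, 1]%classic c.
  exists U; first by split => // t; rewrite /= in_itv/=; exact: seg.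
  move=> t Ut; split; first exact: cU.
  move=> j cj; have nd := overlap_deriv j t Ut cj; split.
    by apply: filterS nd => s [].
  have cD : {for line t, continuous ('D_w (phi j \o psi i))}.
    have tO : (phi i @` (dom i `&` dom j)) (line t).
      by rewrite overlapE; split; [exact: Oi|].
    exact: ((transition_smooth i j 1%N).2 w) tO.
  have cDl : {for t, continuous ('D_w (phi j \o psi i) \o line)}.
    exact: continuous_comp (line_cont t) cD.
  have E : \forall s \near t, ('D_w (phi j \o psi i) \o line) s = derive1 (phi j \o c) s.
    by apply: filterS nd => s [_ dE]; rewrite derive1E dE.
  rewrite /prop_for /continuous_at -(nbhs_singleton E).
  by apply: cvg_trans cDl; apply: near_eq_cvg.
have speed_le t : U t -> speed F c t <= K.
  move=> Ut; have [cti ctE] := chart_invP (Oi _ Ut).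
  have nd := nbhs_singleton (overlap_deriv i t Ut cti).
  rewrite (speedE fE cti (cU t Ut)); last by have [] := nd.
  rewrite [phi i (c t)]ctE.
  have -> : 'D_1 (phi i \o c) t = w; last exact: Kle.
  have [_ ->] := nd.
  transitivity ('D_w (@id V) (line t)); last exact: derive_id.
  apply: near_eq_derive; have : nbhs (line t) O by exact: open_nbhs_nbhs.
  by apply: filterS => y /Oi /chart_invP[].
apply: ge_ereal_inf; exists (curve_length F c); last first.
  apply: (@le_trans _ _ (\int[lebesgue_measure]_(t in `[0%R, 1%R]) (cst K%:E t))%E).
    apply: ge0_le_integral_nonmeasurable => t.
      by move=> _; rewrite lee_fin speed_ge0.
    by rewrite /= in_itv/= => t01; rewrite lee_fin; apply: speed_le; exact: seg.
  by rewrite integral_cst//= lebesgue_measure_itv/= lte_fin ltr01 oppr0 adde0 mule1.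
exists c => //; split.
- exists [:: 1] => [|[|//] _ /=]; first by split => //=; rewrite ltr01.
  by exists c.
- by rewrite /c /line scale0r addr0.
- by rewrite /c /line scale1r /w addrC subrK.
Qed.

Variables (p : V) (rho tau : R) (N : V -> R) (c0 : R).
Hypothesis rho_codom : forall y, `|y - p| < rho -> chart_image i y.
Hypothesis tau01 : 0 <= tau < 1.
Hypothesis Nle : forall y w, `|y - p| < rho -> (1 - tau) * N w <= cnorm f y w.
Hypothesis Nge : forall y w, `|y - p| < rho -> cnorm f y w <= (1 + tau) * N w.
Hypothesis Nsupp : forall w, exists2 q, dotr q w = N w & forall u, dotr q u <= N u.
Hypothesis Nc0 : forall w, c0 * `|w| <= N w.
Hypothesis c00 : 0 <= c0.

Lemma finsler_dist_le a b : `|a - p| < rho -> `|b - p| < rho ->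
  (finsler_dist F (psi i a) (psi i b) <= ((1 + tau) * N (b - a))%:E)%E.
Proof.
move=> ap bp; apply: (@segment_length_le [set y | `|y - p| < rho]).
- have -> : [set y | `|y - p| < rho] = ball p rho.
    by apply/seteqP; split => y; rewrite -ball_normE /ball_/= distrC.
  exact: ball_open.
- exact: rho_codom.
- move=> t /andP[t0 t1] /=.
  have -> : a + t *: (b - a) - p = (1 - t) *: (a - p) + t *: (b - p).
    by rewrite !scalerBr !scalerBl !scale1r; apply/rowP => j; rewrite !mxE; ring.
  rewrite (le_lt_trans (ler_normD _ _))// !normrZ (ger0_norm t0) ger0_norm ?subr_ge0//.
  have [->|tn] := eqVneq t 0; first by rewrite subr0 mul1r mul0r addr0.
  have tp : 0 < t by rewrite lt_neqAle eq_sym tn.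
  have : t * `|b - p| < t * rho by rewrite ltr_pM2l.
  have : (1 - t) * `|a - p| <= (1 - t) * rho by rewrite ler_wpM2l ?subr_ge0// ltW.
  lra.
- by move=> y yp; exact: Nge.
Qed.

(** As long as the curve stays in the chart ball, the support covector of [N] at its displacement,
    scaled by [1 - tau], calibrates it. Either the curve never leaves the ball of radius [r1], or it
    is followed up to its first exit, where the displacement has norm at least [r1 - r0]. *)
Lemma curve_length_ge_ball (c : R -> M) (a : V) (r0 r1 : R) :
  piecewise_C1 A c -> c 0 = psi i a -> `|a - p| < r0 -> 0 < r0 < r1 -> r1 < rho ->
  (((1 - tau) * (c0 * (r1 - r0)))%:E <= curve_length F c)%E \/
  exists b, [/\ `|b - p| < r1, c 1 = psi i b &
    (((1 - tau) * N (b - a))%:E <= curve_length F c)%E].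
Proof.
move=> cC1 ca ar0 /andP[r0_gt0 r01] r1rho.
have t1_gt0 : 0 < 1 - tau by have := tau01; lra.
have ai : chart_image i a by apply: rho_codom; lra.
have length_ge t : 0 <= t <= 1 -> (forall s, 0 <= s <= t -> exists2 y, `|y - p| < rho & c s = psi i y) ->
    forall b, `|b - p| < rho -> c t = psi i b -> (((1 - tau) * N (b - a))%:E <= curve_length F c)%E.
  move=> t01 cst b bp cb; have [q qE qN] := Nsupp (b - a).
  have := @curve_length_ge _ _ _ _ F i f fE c t ((1 - tau) *: q) t01.
  have dq w : dotr ((1 - tau) *: q) w = (1 - tau) * dotr q w.
    by rewrite /dotr mulr_sumr; apply: eq_bigr => j _; rewrite mxE mulrCA.
  have -> : dotr ((1 - tau) *: q) (phi i (c t)) - dotr ((1 - tau) *: q) (phi i (c 0)) =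
      (1 - tau) * N (b - a).
    rewrite cb ca (chart_invP (rho_codom bp)).2 (chart_invP ai).2.
    by rewrite !dq -mulrBr -dotrB qE.
  apply => //.
  - by move=> s /cst[y yp ->]; have [] := chart_invP (rho_codom yp).
  - move=> s w /cst[y yp ->]; rewrite (chart_invP (rho_codom yp)).2.
    by rewrite dq; apply: le_trans (Nle _ yp); rewrite ler_pM2l.
pose U := psi i @` [set y | `|y - p| < r1].
pose K := psi i @` [set y | `|y - p| <= r1].
have cc := piecewise_C1_continuous cC1.
(* A compact image in a Hausdorff space: this keeps the exit point inside the chart. *)
have cK : closed K.
  apply: (compact_closed (mfd_hausdorff A)); apply: continuous_compact.
    apply: continuous_in_subspaceT => y /set_mem /= yp; apply: chart_inv_cont.
    by apply: rho_codom; rewrite (le_lt_trans yp).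
  have -> : [set y | `|y - p| <= r1] = closed_ball p r1.
    rewrite closed_ballE; last by lra.
    by apply/seteqP; split => y; rewrite /closed_ball_/= distrC.
  apply: bounded_closed_compact; last exact: closed_ball_closed.
  exists (`|p| + r1); split; first exact: num_real.
  move=> m pm y; rewrite closed_ballE; last by lra.
  rewrite /closed_ball_/= => yp; rewrite -(subrK p y) addrC.
  by rewrite (le_trans (ler_normD _ _))// distrC; lra.
have oU : open U.
  have -> : U = dom i `&` phi i @^-1` [set y | `|y - p| < r1].
    apply/seteqP; split => [_ [y yp <-]|x [xi xp]].
      have yi : chart_image i y by apply: rho_codom; rewrite (lt_trans yp).
      by have [? yE] := chart_invP yi; split => //=; rewrite yE.
    by exists (phi i x) => //; rewrite chart_mapK.
  apply: open_preimageI; first exact: chart_dom_open.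
    by move=> x; exact: chart_map_continuous.
  have -> : [set y | `|y - p| < r1] = ball p r1.
    by apply/seteqP; split => y; rewrite -ball_normE /ball_/= distrC.
  exact: ball_open.
have closed_pre (C : set M) : closed C -> closed (c @^-1` C `&` `[0, 1]).
  move=> clC; rewrite closed_setIS; last exact: interval_closed.
  by move/continuous_closedP : cc; apply.
have [stay|] := pselect (forall t, 0 <= t <= 1 -> U (c t)).
  have h1 : 0 <= (1 : R) <= 1 by rewrite ler01 lexx.
  right; have [b bp cb] := stay 1 h1.
  exists b; split => //; apply: (length_ge 1) => //; last by rewrite (lt_trans bp).
  by move=> s /stay[y yp <-]; exists y => //; rewrite (lt_trans yp).
move=> /existsNP[t0 /not_implyP[t001 nUt0]]; left.
(* The first exit time is the minimum of this compact set of times. *)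
pose E := c @^-1` (~` U) `&` `[0, 1]%classic.
have cE : closed E by apply: closed_pre; exact: open_closedC.
have E0 : E !=set0 by exists t0; split => //=; rewrite in_itv.
have kE : compact E.
  by apply: (subclosed_compact cE (@segment_compact _ 0 1)) => t [].
have idE : {within E, continuous (@id R)} by apply: continuous_subspaceT => t; exact: cvg_id.
have [ts /set_mem[nUts ts01] tsmin] := compact_EVT_min E0 kE idE.
have {}ts01 : 0 <= ts <= 1 by move: ts01; rewrite /= in_itv.
have before s : 0 <= s < ts -> U (c s).
  move=> /andP[s0 sts]; apply: contrapT => nUs.
  have : s \in E.
    by apply/mem_set; split => //=; rewrite in_itv/= s0 (le_trans (ltW sts))//; case/andP: ts01.
  by move=> /tsmin; rewrite leNgt sts.
have ts_gt0 : 0 < ts.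
  have /andP[ts0 _] := ts01; rewrite lt_neqAle ts0 andbT; apply/eqP => ts0'.
  by apply: nUts; rewrite -ts0' ca; exists a => //=; lra.
(* Before [ts] the curve lies in [U], hence in the closed set [K], so the limit point does too; not
   being in [U], it lies on the sphere of radius [r1]. *)
have Kts : K (c ts).
  apply: contrapT => nK.
  have oK : open (~` (c @^-1` K `&` `[0, 1]%classic)) by apply: closed_openC; exact: closed_pre.
  have : nbhs ts (~` (c @^-1` K `&` `[0, 1]%classic)).
    by apply: open_nbhs_nbhs; split => // -[].
  move=> /nbhs_ballP[r /= r_gt0 rK].
  pose s := Num.max 0 (ts - r / 2).
  have s0 : 0 <= s by rewrite le_max lexx.
  have sts : s < ts by rewrite gt_max ts_gt0/=; lra.
  have : ball ts r s.
    rewrite -ball_normE /ball_/= gtr0_norm ?subr_gt0// ltrBlDr -ltrBlDl.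
    by rewrite lt_max; apply/orP; right; lra.
  move=> /rK; apply; split => /=.
    have [y yp <-] : U (c s) by apply: before; rewrite s0.
    by exists y => //=; exact: ltW.
  by rewrite in_itv/= s0 (le_trans (ltW sts))//; case/andP: ts01.
have [b bp cb] := Kts.
have b1 : `|b - p| = r1.
  apply/eqP; rewrite eq_le bp/= leNgt; apply/negP => b1; apply: nUts.
  by rewrite /= -cb; exists b.
apply: (@le_trans _ _ ((1 - tau) * N (b - a))%:E); last first.
  apply: (length_ge ts) => //; last by rewrite b1.
  move=> s /andP[s0]; rewrite le_eqVlt => /orP[/eqP->|sts].
    by exists b => //; rewrite b1.
  have [y yp <-] : U (c s) by apply: before; rewrite s0.
  by exists y => //; rewrite (lt_trans yp).
rewrite lee_fin ler_pM2l//; apply: le_trans (Nc0 _); rewrite ler_wpM2l//.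
have -> : b - a = (b - p) - (a - p) by rewrite opprB addrA subrK.
have := lerB_dist (b - p) (a - p); rewrite b1; lra.
Qed.

(** A curve that leaves the ball of radius [r1] is long enough by the last hypothesis; otherwise the
    end point found in that ball is [b], by injectivity of the chart. *)
Lemma finsler_dist_ge a b r0 r1 : `|a - p| < r0 -> `|b - p| < rho -> 0 < r0 < r1 -> r1 < rho ->
  N (b - a) <= c0 * (r1 - r0) ->
  (((1 - tau) * N (b - a))%:E <= finsler_dist F (psi i a) (psi i b))%E.
Proof.
move=> ap bp r01 r1rho Nba; apply: le_ereal_inf_tmp => _ [c [cC1 c0a c1b] <-].
have t1 : 0 <= 1 - tau by have := tau01; lra.
have [h|[b' [b'p c1b' h]]] := curve_length_ge_ball cC1 c0a ap r01 r1rho.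
  by apply: le_trans h; rewrite lee_fin ler_wpM2l.
suff -> : b = b' by [].
have <- := (chart_invP (rho_codom bp)).2.
have <- := (chart_invP (rho_codom (lt_trans b'p r1rho))).2.
by rewrite -c1b -c1b'.
Qed.

Lemma finsler_dist_far a z r0 r1 : `|a - p| < r0 -> 0 < r0 < r1 -> r1 < rho ->
  ~ (psi i @` [set y | `|y - p| < r1]) z ->
  (((1 - tau) * (c0 * (r1 - r0)))%:E <= finsler_dist F (psi i a) z)%E.
Proof.
move=> ap r01 r1rho zr; apply: le_ereal_inf_tmp => _ [c [cC1 c0a c1z] <-].
have [h|[b [bp c1b _]]] := curve_length_ge_ball cC1 c0a ap r01 r1rho; first exact: h.
by case: zr; exists b => //; rewrite -c1b.
Qed.

End distance.

(** * Minkowski norms and their energy *)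

Section minkowski_norm.
Variables (R : realType) (n : nat).
Local Notation V := 'rV[R]_n.
Implicit Types (u v w : V).

Record minkowski_norm (N : V -> R) : Prop := MinkowskiNorm {
  mink0 : N 0 = 0;
  mink_gt0 : forall w, w != 0 -> 0 < N w;
  minkZ : forall a w, 0 < a -> N (a *: w) = a * N w;
  minkN : forall w, N (- w) = N w;
  mink_C2 : class_C 2 [set w : V | w != 0] (fun w => N w ^+ 2 / 2);
  mink_convex : forall v w, v != 0 -> w != 0 ->
    0 < qform (hessian (fun w => N w ^+ 2 / 2) v) w w }.

Lemma neq0_open : open [set w : V | w != 0].
Proof.
have -> : [set w : V | w != 0] = ~` [set 0].
  by apply/seteqP; split => w /= /eqP.
by apply: closed_openC; exact: (accessible_closed_set1 (hausdorff_accessible (@norm_hausdorff R V))).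
Qed.

Lemma is_derive_line0 (g : V -> R) v w : derivable g v w ->
  is_derive (0 : R) (1 : R) (fun s : R => g (v + s *: w)) ('D_w g v).
Proof.
move=> dg; have := @is_derive_line R V R g v w 0 ('D_w g v).
by rewrite scale0r addr0; apply; exact: derivableP.
Qed.

Variable N : V -> R.
Hypothesis NM : minkowski_norm N.

Definition energy w : R := N w ^+ 2 / 2.
Local Notation E := energy.

Lemma mink_ge0 w : 0 <= N w.
Proof. by have [->|/(mink_gt0 NM)/ltW//] := eqVneq w 0; rewrite (mink0 NM). Qed.

Lemma minkZ_norm a w : N (a *: w) = `|a| * N w.
Proof.
have [a0|a0|->] := ltgtP a 0; last by rewrite scale0r (mink0 NM) normr0 mul0r.
  by rewrite -[a *: w]opprK (minkN NM) -scaleNr (minkZ NM) ?oppr_gt0// ltr0_norm.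
by rewrite (minkZ NM)// gtr0_norm.
Qed.

Lemma energyZ a w : E (a *: w) = a ^+ 2 * E w.
Proof. by rewrite /energy minkZ_norm exprMn real_normK ?num_real// mulrA. Qed.

Lemma energy_derivable v w : v != 0 -> derivable E v w.
Proof. by move=> v0; apply: diff_derivable; exact: (mink_C2 NM).1. Qed.

Lemma energy_derivable2 v w u : v != 0 -> derivable ('D_w E) v u.
Proof. by move=> v0; apply: diff_derivable; exact: ((mink_C2 NM).2 w).1. Qed.

Lemma energy_derive2 v w : v != 0 -> qform (hessian E v) w w = 'D_w ('D_w E) v.
Proof. by move=> v0; exact: (esym (derive2_hessian w neq0_open v0 (mink_C2 NM))). Qed.

Lemma derive_energy_self v : v != 0 -> 'D_v E v = 2 * E v.
Proof.
move=> v0.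
have d1 : is_derive (0 : R) (1 : R) (fun s : R => E (v + s *: v)) ('D_v E v).
  exact: (is_derive_line0 (energy_derivable v0)).
have -> : 'D_v E v = 'D_1 (fun s : R => E (v + s *: v)) 0 by case: d1.
have -> : (fun s : R => E (v + s *: v)) = (fun s : R => (1 + s) ^+ 2 * E v).
  by apply/funext => s; rewrite -energyZ scalerDl scale1r.
have d2 : is_derive (0 : R) (1 : R) (fun s : R => (1 + s) ^+ 2 * E v) (2 * E v).
  by apply: is_derive_eq; rewrite /GRing.scale/=; lra.
by case: d2.
Qed.

Lemma deriveE_lin v : v != 0 -> forall a u w,
  'D_(a *: u + w) E v = a * 'D_u E v + 'D_w E v.
Proof.
move=> v0 a u w; have dE : differentiable E v by exact: (mink_C2 NM).1.
by rewrite !deriveE// linearP.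
Qed.

Lemma derive_energyN v w : v != 0 -> 'D_w E (- v) = - 'D_w E v.
Proof.
move=> v0; have d1 : is_derive (0 : R) (1 : R) (fun s : R => E (- v + s *: w)) ('D_w E (- v)).
  by apply: is_derive_line0; apply: energy_derivable; rewrite oppr_eq0.
have d2 : is_derive (0 : R) (1 : R) (fun s : R => E (v + s *: (- w))) ('D_(- w) E v).
  exact: (is_derive_line0 (energy_derivable v0)).
have E12 : (fun s : R => E (- v + s *: w)) = (fun s : R => E (v + s *: (- w))).
  by apply/funext => s; rewrite /energy -(minkN NM) opprD opprK scalerN.
have -> : 'D_w E (- v) = 'D_(- w) E v by case: d1 => _ <-; case: d2 => _ <-; rewrite E12.
by rewrite -[- w]addr0 -scaleN1r deriveE_lin// derive0 addr0 mulN1r.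
Qed.

Lemma hessianN v w : v != 0 -> qform (hessian E (- v)) w w = qform (hessian E v) w w.
Proof.
move=> v0; have nv0 : - v != 0 by rewrite oppr_eq0.
apply: (etrans (energy_derive2 w nv0)); apply: (etrans _ (esym (energy_derive2 w v0))).
have d1 : is_derive (0 : R) (1 : R) (fun s : R => 'D_w E (- v + s *: w)) ('D_w ('D_w E) (- v)).
  exact: (is_derive_line0 (energy_derivable2 nv0)).
have d2 : is_derive (0 : R) (1 : R) (fun s : R => 'D_w E (v + s *: (- w))) ('D_(- w) ('D_w E) v).
  exact: (is_derive_line0 (energy_derivable2 v0)).
have nb : \forall s \near (0 : R), v + s *: (- w) != 0.
  have cl : {for 0, continuous (fun s : R => v + s *: (- w))}.
    have ct : {for 0, continuous (fun t : R => t *: (- w))}.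
      by apply: continuousZr_tmp; exact: cvg_id.
    exact: (continuousD (@cst_continuous _ _ v 0) ct).
  have nU : nbhs (v + 0 *: (- w)) [set u : V | u != 0].
    by apply: open_nbhs_nbhs; split; [exact: neq0_open|rewrite /= scale0r addr0].
  exact: cl nU.
have E12 : \forall s \near (0 : R), - ('D_w E (v + s *: (- w))) = 'D_w E (- v + s *: w).
  apply: filterS nb => s s0; rewrite -derive_energyN//.
  by rewrite opprD scalerN opprK.
have d3 : is_derive (0 : R) (1 : R) (fun s : R => 'D_w E (- v + s *: w)) (- 'D_(- w) ('D_w E) v).
  by apply: near_eq_is_derive E12 _; exact: is_deriveN.
have -> : 'D_w ('D_w E) (- v) = - 'D_(- w) ('D_w E) v.
  by case: d1 => _ <-; case: d3 => _ <-.
have dE : differentiable ('D_w E) v by exact: ((mink_C2 NM).2 w).1.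
by rewrite !deriveE// linearN opprK.
Qed.

(** Euler's relation, obtained by differentiating along the ray of [v]. It is what turns a constant
    Hessian into a quadratic norm. *)
Lemma hessian_self v : v != 0 -> qform (hessian E v) v v = N v ^+ 2.
Proof.
move=> v0; rewrite (energy_derive2 v v0).
have d1 : is_derive (0 : R) (1 : R) (fun s : R => 'D_v E (v + s *: v)) ('D_v ('D_v E) v).
  exact: (is_derive_line0 (energy_derivable2 v0)).
have E12 : \forall s \near (0 : R), (1 + s) * (2 * E v) = 'D_v E (v + s *: v).
  near=> s; have s1 : 0 < 1 + s.
    have : ball (0 : R) 1 s by near: s; exact: nbhsx_ballx.
    by rewrite -ball_normE /ball_/= sub0r normrN ltr_norml => /andP[]; lra.
  have -> : v + s *: v = (1 + s) *: v by rewrite scalerDl scale1r.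
  have sv0 : (1 + s) *: v != 0 by rewrite scaler_eq0 negb_or v0 gt_eqF.
  have := deriveE_lin sv0 (1 + s) v 0; rewrite addr0 derive0 addr0.
  rewrite (derive_energy_self sv0) energyZ => h.
  by apply: (mulfI (lt0r_neq0 s1)); rewrite -h; ring.
have d2 : is_derive (0 : R) (1 : R) (fun s : R => (1 + s) * (2 * E v)) (2 * E v).
  by apply: is_derive_eq; rewrite /GRing.scale/=; lra.
have d3 := near_eq_is_derive E12 d2.
have -> : 'D_v ('D_v E) v = 2 * E v by case: d1 => _ <-; case: d3 => _ <-.
by rewrite /energy; field.
Unshelve. all: by end_near. Qed.

(** The second derivative is positive along the segment from [v] to [w]. As the energy is C^2 off
    the origin only, a segment through the origin is treated by homogeneity. *)
Lemma energy_tangent v w : v != 0 -> E v + 'D_(w - v) E v <= E w.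
Proof.
move=> v0; have [|no0] := pselect (exists2 s : R, 0 <= s <= 1 & v + s *: (w - v) = 0).
  (* Here [w] is a multiple of [v], and the claim reduces to the nonnegativity of (1 / s)^2 times
     the energy of [v]. *)
  move=> [s /andP[s0 s1] vs].
  have sn0 : s != 0 by apply: contra_eq_neq vs => ->; rewrite scale0r addr0.
  have wE : w = (1 - s^-1) *: v.
    apply: (@scalerI _ _ s sn0); rewrite scalerA mulrBr mulr1 mulfV//.
    apply/eqP; rewrite -subr_eq0 scalerBl scale1r opprB.
    by rewrite addrC -addrA -[X in _ + X]addrC -scalerBr vs.
  have -> : w - v = (- s^-1) *: v + 0.
    by rewrite addr0 {1}wE scalerBl scale1r addrAC subrr sub0r scaleNr.
  rewrite deriveE_lin// derive0 addr0 derive_energy_self// wE energyZ.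
  have E0 : 0 <= E v by rewrite /energy divr_ge0// sqr_ge0.
  have : 0 <= (s^-1 ^+ 2) * E v by rewrite mulr_ge0// sqr_ge0.
  by nra.
have seg s : 0 <= s <= 1 -> v + s *: (w - v) != 0.
  by move=> s01; apply/eqP => h; apply: no0; exists s.
have [xi [z [xi01 z01]]] := derive_seg neq0_open (mink_C2 NM) seg 0.
have -> : v + (w - v) = w by rewrite addrC subrK.
rewrite mul0r !subr0 => h; rewrite -subr_ge0 opprD addrA h mulr_ge0//; last by case/andP: xi01.
have [->|wv] := eqVneq (w - v) 0.
  by rewrite /qform mul0mx mul0mx mxE.
apply: ltW; apply: (mink_convex NM) => //; apply/eqP => h0; apply: no0; by exists z.
Qed.

(** Convexity in the form of monotone slopes, from the tangent inequalities at the intermediate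
    point. It bounds the energy change over a long displacement by that over a short one, where
    Taylor's formula is accurate. *)
Lemma energy_slope a b (t : R) : 0 < t <= 1 ->
  (E (a + t *: b) - E a) / t <= E (a + b) - E a.
Proof.
move=> /andP[t0 t1]; rewrite ler_pdivrMr//.
have E0 w : 0 <= E w by rewrite /energy divr_ge0// sqr_ge0.
have [c0|c0] := eqVneq (a + t *: b) 0.
  have -> : E (a + t *: b) = 0 by rewrite c0 /energy (mink0 NM) expr0n/= mul0r.
  have := E0 a; have := E0 (a + b); nra.
have := energy_tangent (a + b) c0; have := energy_tangent a c0.
have -> : a - (a + t *: b) = (- t) *: b + 0.
  by rewrite opprD addrA subrr sub0r scaleNr addr0.
have -> : a + b - (a + t *: b) = (1 - t) *: b + 0.
  by rewrite opprD addrACA subrr add0r scalerBl scale1r addr0.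
by rewrite !deriveE_lin// derive0; nra.
Qed.

(** The covector is the differential of the energy at [w] divided by [N w]. It is dominated by [N]
    by the tangent inequality at the multiple of [u] whose norm is [N w]. *)
Lemma mink_support w : exists2 q : V, dotr q w = N w & forall u, dotr q u <= N u.
Proof.
have [->|w0] := eqVneq w 0.
  exists 0; rewrite ?(mink0 NM); first by rewrite /dotr big1// => j _; rewrite mxE mul0r.
  by move=> u; rewrite /dotr big1 ?mink_ge0// => j _; rewrite mxE mulr0.
have Nw := mink_gt0 NM w0.
exists (\row_j ('D_(delta_mx 0 j) E w / N w)).
all: have dq u : dotr (\row_j ('D_(delta_mx 0 j) E w / N w)) u = 'D_u E w / N w.
1,3: rewrite (derive_row_sum u) ?mulr_suml; [|exact: (mink_C2 NM).1].
1,2: by apply: eq_bigr => j _; rewrite mxE mulrA.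
  by rewrite dq derive_energy_self// /energy; field; rewrite gt_eqF.
move=> u; rewrite dq ler_pdivrMr//.
have [->|u0] := eqVneq u 0; first by rewrite derive0 (mink0 NM) mul0r.
have Nu := mink_gt0 NM u0.
have := energy_tangent ((N w / N u) *: u) w0.
have -> : (N w / N u) *: u - w = (N w / N u) *: u + ((-1) *: w + 0).
  by rewrite addr0 scaleN1r.
rewrite !deriveE_lin// derive0 addr0 derive_energy_self// energyZ /energy => h.
have : N w / N u * 'D_u E w <= N w ^+ 2.
  have -> : N w ^+ 2 = (N w / N u) ^+ 2 * (N u ^+ 2 / 2) + (N w ^+ 2 / 2).
    by field; rewrite gt_eqF.
  lra.
by rewrite mulrAC ler_pdivrMr// expr2 -mulrA ler_pM2l// [N w * N u]mulrC.
Qed.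

End minkowski_norm.

(** * Positive definite forms, ellipsoids and strict concavity of volume *)

Section positive_forms.
Variables (R : realType) (n : nat).
Local Notation V := 'rV[R]_n.
Implicit Types (H : 'M[R]_n) (u v w : V).

Definition posdef H := forall w, w != 0 -> 0 < qform H w w.

Lemma qform0l H w : qform H 0 w = 0.
Proof. by rewrite /qform !mul0mx mxE. Qed.

Lemma qform0r H w : qform H w 0 = 0.
Proof. by rewrite /qform trmx0 mulmx0 mxE. Qed.

Lemma qformC H u w : H^T = H -> qform H u w = qform H w u.
Proof. by move=> Hs; rewrite -[in LHS]Hs qform_tr. Qed.

Lemma qform_mulr H (S : 'M[R]_n) u w : qform H (u *m S) w = qform (S *m H) u w.
Proof. by rewrite /qform !mulmxA. Qed.

Lemma qformNl H u w : qform H (- u) w = - qform H u w.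
Proof. by rewrite -scaleN1r qformZl mulN1r. Qed.

Lemma qformNr H u w : qform H u (- w) = - qform H u w.
Proof. by rewrite -scaleN1r qformZr mulN1r. Qed.

Lemma qform_sqD H u w : H^T = H ->
  qform H (u + w) (u + w) = qform H u u + 2 * qform H u w + qform H w w.
Proof. by move=> Hs; rewrite qformDl !qformDr (qformC w u Hs); ring. Qed.

Lemma qform_sqB H u w : H^T = H ->
  qform H (u - w) (u - w) = qform H u u - 2 * qform H u w + qform H w w.
Proof. by move=> Hs; rewrite qform_sqD// qformNr qformNl qformNr; ring. Qed.

Lemma qform_sq_continuous H : continuous (fun w => qform H w w).
Proof.
move=> w; have -> : (fun w => qform H w w) = (fun w => \sum_j (w *m H) 0 j * w 0 j).
  by apply/funext => u; rewrite /qform mxE; apply: eq_bigr => j _; rewrite !mxE.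
apply: continuous_at_sum => j; apply: continuousM; last exact: coord_continuous.
exact: (continuous_comp (@mulmxr_continuous _ _ H w) (@coord_continuous _ _ _ _ _ _)).
Qed.

Lemma posdef_ge0 H w : posdef H -> 0 <= qform H w w.
Proof. by move=> Hp; have [->|/Hp/ltW//] := eqVneq w 0; rewrite qform0l. Qed.

Lemma posdef_unitmx H : posdef H -> H \in unitmx.
Proof.
move=> Hp; rewrite -row_free_unit; apply: inj_row_free => v v0.
by apply/eqP/negPn/negP => /Hp; rewrite /qform v0 mul0mx mxE ltxx.
Qed.

Lemma posdef_lower H : posdef H ->
  exists2 c : R, 0 < c & forall w, c * `|w| ^+ 2 <= qform H w w.
Proof.
move=> Hp; have [c c0 cS] := @sphere_min R n (fun w => qform H w w)
  (fun w _ => @qform_sq_continuous H w) Hp.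
exists c => // w; have [->|w0] := eqVneq w 0; first by rewrite normr0 expr0n/= mulr0 qform0l.
have nw : 0 < `|w| by rewrite normr_gt0.
have := cS _ (sphere_normalize w0); rewrite qformZl qformZr mulrA -invfM -expr2 => h.
by rewrite mulrC -ler_pdivlMl// exprn_gt0.
Qed.

Section ellipsoid.
Variable G : 'M[R]_n.
Hypothesis Gp : posdef G.

(** The endomorphism Q representing [H] relative to [G], acting on rows: [y *m Q *m G = y *m H].
    Weighted averages of the y_i Q_i are the linearized barycenters. *)
Definition ratio_form H : 'M[R]_n := H *m invmx G.

Lemma ratio_form_unitmx H : posdef H -> ratio_form H \in unitmx.
Proof. by move=> Hp; rewrite unitmx_mul unitmx_inv !posdef_unitmx. Qed.

Definition unit_ellipsoid : set V := [set u | qform G u u <= 1].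

Lemma unit_ellipsoid_closed : closed unit_ellipsoid.
Proof.
have -> : unit_ellipsoid = (fun u => qform G u u) @^-1` [set x : R | x <= 1] by [].
apply: closed_comp; last exact: closed_le.
by move=> u _; exact: qform_sq_continuous.
Qed.

Lemma unit_ellipsoid_bounded : exists2 r : R, 0 < r & forall u, unit_ellipsoid u -> `|u| < r.
Proof.
have [c c0 cq] := posdef_lower Gp.
have c10 : 0 < c^-1 + 1 by rewrite addr_gt0// invr_gt0.
exists (c^-1 + 1) => // u qu; rewrite ltNge; apply/negP => ru.
have := le_trans (cq u) qu; rewrite leNgt => /negP; apply.
have i0 : 0 < c^-1 by rewrite invr_gt0.
rewrite mulrC -ltr_pdivrMr// div1r expr2; nra.
Qed.

Variable L : {measure set (borel V) -> \bar R}.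
Hypothesis lebL : is_lebesgue L.

Lemma ellipsoid_volume : exists2 b : R, 0 < b & L unit_ellipsoid = b%:E.
Proof.
have mB : measurable (unit_ellipsoid : set (borel V)) by exact: borel_closed unit_ellipsoid_closed.
have [r r0 Br] := unit_ellipsoid_bounded.
have Lfin : (L unit_ellipsoid < +oo)%E.
  apply: le_lt_trans (lebesgue_box_finite lebL (const_mx (- r)) (const_mx r)).
  apply: le_measure; rewrite ?inE//; first exact: measurable_box.
  exact: bounded_box.
have Lgt0 : (0 < L unit_ellipsoid)%E.
  have oO : open [set u : V | qform G u u < 1].
    have -> : [set u : V | qform G u u < 1] = (fun u => qform G u u) @^-1` [set x : R | x < 1] by [].
    by apply: open_comp; [move=> u _; exact: qform_sq_continuous|exact: open_lt].
  apply: lt_le_trans (lebesgue_open_gt0 lebL oO _) _.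
    by exists 0; rewrite /= qform0l ltr01.
  apply: le_measure; rewrite ?inE//; first exact: borel_open.
  by move=> u /= /ltW.
have Lf : L unit_ellipsoid \is a fin_num by rewrite ge0_fin_numE// ltW.
exists (fine (L unit_ellipsoid)); last by rewrite fineK.
by rewrite -lte_fin fineK.
Qed.

End ellipsoid.

Section pair_of_forms.
Variables (H1 H2 : 'M[R]_n).
Hypotheses (s1 : H1^T = H1) (s2 : H2^T = H2) (p1 : posdef H1) (p2 : posdef H2).

Definition mean_form : 'M[R]_n := 2^-1 *: (H1 + H2).
Local Notation Hb := mean_form.
Local Notation q := (fun u => qform Hb u u).

Lemma mean_form_sym : Hb^T = Hb.
Proof. by rewrite /mean_form linearZ/= linearD/= s1 s2. Qed.

Lemma mean_formE u w : qform Hb u w = (qform H1 u w + qform H2 u w) / 2.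
Proof. by rewrite qformZm qformDm mulrC. Qed.

Lemma mean_form_posdef : posdef Hb.
Proof. by move=> w w0; rewrite mean_formE divr_gt0// addr_gt0 ?p1 ?p2. Qed.

Let uHb : Hb \in unitmx. Proof. exact: posdef_unitmx mean_form_posdef. Qed.

Local Notation ratio_form := (ratio_form Hb).
Local Notation unit_ellipsoid := (unit_ellipsoid Hb).
Local Notation S := (ratio_form H1 - 1%:M).

Let S2E : ratio_form H2 = 1%:M - S.
Proof.
have -> : H2 = Hb + Hb - H1.
  by apply/matrixP => i j; rewrite !mxE; lra.
rewrite /ratio_form mulmxBl mulmxDl mulmxV//.
by apply/matrixP => i j; rewrite !mxE; ring.
Qed.

Let SHb : S *m Hb = H1 - Hb.
Proof. by rewrite mulmxBl mulmxKV// mul1mx. Qed.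

Let DE u w : qform (H1 - Hb) u w = (qform H1 u w - qform H2 u w) / 2.
Proof. by rewrite qformBm mean_formE; lra. Qed.

Let Dsym : (H1 - Hb)^T = H1 - Hb.
Proof. by rewrite linearB/= s1 mean_form_sym. Qed.

Let D_le a b : 2 * qform (H1 - Hb) a b <= q a + q b.
Proof.
have := posdef_ge0 (a - b) p1; have := posdef_ge0 (a + b) p2.
rewrite (qform_sqB _ _ s1) (qform_sqD _ _ s2) DE !mean_formE; lra.
Qed.

Let S_contraction p : q (p *m S) <= q p.
Proof.
have : q (p *m S) = qform (H1 - Hb) p (p *m S) by rewrite qform_mulr SHb.
by have := D_le p (p *m S); lra.
Qed.

(** The two ratio forms are 1 + S and 1 - S, with product 1 - S^2. Here S is self-adjoint for the
    mean form and, both given forms being positive, does not increase the mean form; expanding the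
    square gives the bound. *)
Lemma ratio_form_contraction u :
  q (u *m ratio_form H2 *m ratio_form H1) <= q u - q (u *m S).
Proof.
set p := u *m S.
have -> : u *m ratio_form H2 *m ratio_form H1 = u - p *m S.
  have E (Z : 'M[R]_n) : u *m (1%:M - Z) *m (1%:M + Z) = u - u *m Z *m Z.
    by rewrite mulmxBr mulmx1 mulmxBl !mulmxDr !mulmx1 opprD addrA addrK.
  have R1 : ratio_form H1 = 1%:M + S by rewrite [RHS]addrC subrK.
  by rewrite S2E [X in _ *m X]R1 E.
rewrite (qform_sqB _ _ mean_form_sym).
have -> : qform Hb u (p *m S) = q p.
  by rewrite (qformC _ _ mean_form_sym) qform_mulr SHb (qformC _ _ Dsym) -SHb -qform_mulr.
have := S_contraction p; lra.
Qed.

Section volume.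
Variables (L : {measure set (borel V) -> \bar R}).
Hypothesis lebL : is_lebesgue L.

(** The preimage of the unit ellipsoid under [T] contains the ellipsoid itself and, when S is
    nonzero, also a nonempty open set outside it; the ratio of the volumes is [c1 * c2]. Since c_i =
    1 / |det Q_i|, this is the strict concavity of ln det. *)
Lemma volume_gap (c1 c2 : R) : H1 != H2 -> 0 <= c1 -> 0 <= c2 ->
  (forall A : set (borel V), measurable A ->
    L ((fun u : V => u *m ratio_form H1) @^-1` A) = (c1%:E * L A)%E) ->
  (forall A : set (borel V), measurable A ->
    L ((fun u : V => u *m ratio_form H2) @^-1` A) = (c2%:E * L A)%E) ->
  1 < c1 * c2.
Proof.
move=> H12 c1_ge0 c2_ge0 c1E c2E.
have mB : measurable (unit_ellipsoid : set (borel V)) by exact: borel_closed (@unit_ellipsoid_closed _).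
have [b b0 bE] := ellipsoid_volume mean_form_posdef lebL.
pose T u : V := u *m ratio_form H2 *m ratio_form H1.
have cT : continuous T.
  move=> u; exact: (continuous_comp (@mulmxr_continuous _ _ _ u) (@mulmxr_continuous _ _ _ _)).
have LX : L (T @^-1` unit_ellipsoid) = (c2 * c1 * b)%:E.
  rewrite -mulrA EFinM EFinM -bE -c1E// -c2E//.
  by rewrite -[X in measurable X]setTI; exact: mulmxr_measurable.
pose O : set V := [set u | q (T u) < 1] `&` [set u | 1 < q u].
have oO : open O.
  apply: openI.
    have -> : [set u : V | q (T u) < 1] = (fun u => q (T u)) @^-1` [set x : R | x < 1] by [].
    apply: open_comp; last exact: open_lt.
    by move=> u _; exact: (continuous_comp (cT u) (@qform_sq_continuous Hb _)).
  have -> : [set u : V | 1 < q u] = (fun u => q u) @^-1` [set x : R | 1 < x] by [].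
  apply: open_comp; last exact: open_gt.
  by move=> u _; exact: qform_sq_continuous.
have O0 : O !=set0.
  have [w wS] : exists w : V, w *m S != 0.
    apply: contrapT => no; move/eqP: H12; apply.
    have S0 : S = 0.
      apply/row_matrixP => i; rewrite row0 rowE; apply/eqP/negPn/negP => h.
      by apply: no; exists (delta_mx 0 i).
    have := SHb; rewrite S0 mul0mx => /esym/subr0_eq HHb.
    have : H1 + H1 = H1 + H2.
      by rewrite {1 2}HHb /mean_form -scalerDl -mulr2n -[2^-1 *+ 2]mulr_natl mulfV ?scale1r ?pnatr_eq0.
    by move/addrI.
  have h1 := ratio_form_contraction w.
  have h2 := mean_form_posdef wS.
  have h3 : 0 <= q (T w) by exact: posdef_ge0 mean_form_posdef.
  (* [w] is rescaled so that 1 falls midway between the values of [q] at its image under [T] and at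
     itself. *)
  pose s := 2 / (q (T w) + q w).
  have s0 : 0 < s by rewrite divr_gt0//; rewrite /T in h3 *; lra.
  exists (Num.sqrt s *: w); split => /=.
    have -> : T (Num.sqrt s *: w) = Num.sqrt s *: T w by rewrite /T -!scalemxAl.
    rewrite qformZl qformZr mulrA -expr2 sqr_sqrtr ?(ltW s0)//.
    rewrite /s mulrAC ltr_pdivrMr; rewrite /T in h3 *; lra.
  rewrite qformZl qformZr mulrA -expr2 sqr_sqrtr ?(ltW s0)//.
  rewrite /s mulrAC ltr_pdivlMr; rewrite /T in h3 *; lra.
have Opos := lebesgue_open_gt0 lebL oO O0.
have BX : unit_ellipsoid `|` O `<=` T @^-1` unit_ellipsoid.
  move=> u [uB|[/ltW Tu _]]; last exact: Tu.
  apply: le_trans (ratio_form_contraction u) _.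
  have := posdef_ge0 (u *m S) mean_form_posdef; move: uB; rewrite /unit_ellipsoid/=; lra.
have LU : (L (unit_ellipsoid `|` O) <= (c2 * c1 * b)%:E)%E.
  rewrite -LX; apply: le_measure; rewrite ?inE//.
    by apply: measurableU => //; exact: borel_open.
  have cl : closed (T @^-1` unit_ellipsoid).
    by apply: closed_comp; [move=> u _; exact: cT|exact: unit_ellipsoid_closed].
  exact: borel_closed cl.
move: LU; rewrite measureU//; last 2 first.
- exact: borel_open.
- apply/seteqP; split => // u [uB [_ qu]]; move: uB qu; rewrite /unit_ellipsoid/=; lra.
move=> LU; have {}LU : (b%:E + L O <= (c2 * c1 * b)%:E)%E by rewrite -bE.
have : (b%:E < (c2 * c1 * b)%:E)%E.
  by apply: lt_le_trans LU; rewrite lteDl.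
by rewrite lte_fin ltr_pMl// [c2 * c1]mulrC.
Qed.

End volume.
End pair_of_forms.
End positive_forms.

(** * Decrease of energy under radial retraction *)

Section energy_retract.
Variables (R : realType) (n : nat).
Local Notation V := 'rV[R]_n.
Variable N : V -> R.
Hypothesis NM : minkowski_norm N.
Local Notation E := (energy N).

(* [y = b *m T], where [T] carries the unit ball of [G] to that of the dual of [H] relative to [G]. *)
Lemma energy_retract (z : V) (G : 'M[R]_n) (c om : R) :
  z != 0 -> posdef G -> G^T = G -> 0 < c -> 0 < om ->
  exists2 d0 : R, 0 < d0 & forall (d th a : R) (e b y : V),
    0 < d < d0 -> 0 < th <= 1 -> th <= a -> `|e| <= c -> `|y| <= c ->
    qform G e e = 1 -> qform G b b <= 1 -> b *m G = y *m hessian E z ->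
    a / th * (th * d * 'D_e E z + ((1 + th) ^+ 2 - 1) / 2 * d ^+ 2 * qform (hessian E z) e e
              - th * d ^+ 2 - om * d ^+ 2)
    <= E (z + d *: e - d *: y + (a * d) *: e) - E (z + d *: e - d *: y).
Proof.
move=> z0 Gp Gs c0 om0; set H := hessian E z.
have Hs : H^T = H by exact: hessian_sym.
(* The expansion is used at two displacements of norms at most 2 c d and 3 c d; as 13 = 4 + 9, the
   two errors add up to at most [om * d ^+ 2]. *)
have om'0 : 0 < om / (13 * c ^+ 2) by rewrite divr_gt0// mulr_gt0// exprn_gt0.
have := class_C2_taylor (@neq0_open R n) z0 (mink_C2 NM) om'0.
move=> /nbhs_ballP[r /= r0 taylor].
exists (r / (3 * c)); first by rewrite divr_gt0// mulr_gt0.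
move=> d th a e b y /andP[d0 dr] /andP[th0 th1] tha ec yc Ge Gb byE.
have a0 : 0 < a by exact: lt_le_trans tha.
pose zeta s : V := (s * d) *: e - d *: y.
have zetaE s : 0 <= s <= 2 -> `|zeta s| <= (s + 1) * c * d.
  move=> /andP[s0 s2]; rewrite /zeta (le_trans (ler_normB _ _))// !normrZ.
  rewrite !ger0_norm ?mulr_ge0// ?(ltW d0)//.
  have := mulr_ge0 s0 (ltW d0); nra.
have T s : 0 <= s <= 2 -> `|E (z + zeta s) - E z - 'D_(zeta s) E z - qform H (zeta s) (zeta s) / 2|
    <= om / (13 * c ^+ 2) * ((s + 1) * c * d) ^+ 2.
  move=> s02; have zs := zetaE s s02.
  apply: le_trans (taylor _ _) _.
    rewrite -ball_normE /= sub0r normrN; apply: le_lt_trans zs _.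
    have /andP[s0 s2] := s02; rewrite ltr_pdivlMr ?mulr_gt0// in dr.
    have := mulr_gt0 c0 d0; nra.
  rewrite ler_pM2l// lerXn2r ?nnegrE//.
  by have /andP[s0 s2] := s02; rewrite !mulr_ge0 ?(ltW c0) ?(ltW d0)// addr_ge0.
have T0 := T 1 ltac:(lra); have T1 := T (1 + th) ltac:(lra).
have DE s : 'D_(zeta s) E z = s * d * 'D_e E z + 'D_(- (d *: y)) E z.
  by rewrite /zeta (deriveE_lin NM).
have He : qform H e y = qform G b e.
  by rewrite (qformC _ _ Hs) /qform -byE.
(* By [He] this bounds the mixed Hessian term by 1 through Cauchy-Schwarz for [G]; it is the way in
   which the source ellipsoid enters. *)
have Gbe : qform G b e <= 1.
  have := posdef_ge0 (b - e) Gp; rewrite (qform_sqB _ _ Gs); lra.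
have QE s : qform H (zeta s) (zeta s) =
    s ^+ 2 * d ^+ 2 * qform H e e - 2 * s * d ^+ 2 * qform H e y + d ^+ 2 * qform H y y.
  rewrite /zeta (qform_sqB _ _ Hs) !qformZl !qformZr; ring.
have SL : 0 < th / a <= 1 by rewrite divr_gt0//= ler_pdivrMr// mul1r.
(* The displacement by [a * d] is compared with its initial part of length [th * d]. *)
have := energy_slope NM (z + zeta 1) ((a * d) *: e) SL.
have -> : z + zeta 1 + (th / a) *: ((a * d) *: e) = z + zeta (1 + th).
  have -> : (th / a) *: ((a * d) *: e) = (th * d) *: e.
    by rewrite scalerA; congr (_ *: _); field; rewrite gt_eqF.
  rewrite /zeta mulrDl scalerDl; rewrite -!addrA; congr (_ + (_ + _)).
  by rewrite addrC.
have -> : z + zeta 1 = z + d *: e - d *: y by rewrite /zeta mul1r addrA.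
rewrite invf_div => SL'; apply: le_trans SL'.
rewrite mulrC ler_wpM2r//; first by rewrite divr_ge0 ?ltW.
have zE : z + zeta 1 = z + d *: e - d *: y by rewrite /zeta mul1r addrA.
rewrite zE in T0; move: T0 T1; rewrite !DE !QE He !ler_norml => /andP[_ T0] /andP[T1 _].
have k0 : th * d ^+ 2 * qform G b e <= th * d ^+ 2.
  by rewrite ler_piMr// mulr_ge0 ?ltW// exprn_gt0.
have k1 : om / (13 * c ^+ 2) * ((1 + 1) * c * d) ^+ 2 = om * d ^+ 2 * 4 / 13.
  by field; rewrite gt_eqF.
have k2 : om / (13 * c ^+ 2) * ((1 + th + 1) * c * d) ^+ 2 <= om * d ^+ 2 * 9 / 13.
  have -> : om / (13 * c ^+ 2) * ((1 + th + 1) * c * d) ^+ 2 = om * d ^+ 2 * (2 + th) ^+ 2 / 13.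
    by field; rewrite gt_eqF.
  have : 0 <= om * d ^+ 2 by rewrite mulr_ge0 ?ltW// exprn_gt0.
  rewrite ler_pM2r ?invr_gt0// => h; rewrite ler_wpM2l//; nra.
rewrite k1 in T0; nra.
Qed.

End energy_retract.

Section gain.
Variables (R : realType) (n : nat).
Local Notation V := 'rV[R]_n.
Variable N : V -> R.
Hypothesis NM : minkowski_norm N.
Local Notation E := (energy N).

(** The bound of [energy_retract] with e = u / s, a = s / d - 1 and om = th^2 / 4: a lower bound,
    uniform in the source point near -z, for the energy decrease when [u] is moved radially to the
    G-sphere of radius [d]. *)
Definition gain (G : 'M[R]_n) (z : V) (th d : R) (u : V) : R :=
  let s := Num.sqrt (qform G u u) in
  (s / d - 1) / th * (th * d * ('D_u E z / s)
    + ((1 + th) ^+ 2 - 1) / 2 * d ^+ 2 * (qform (hessian E z) u u / s ^+ 2)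
    - th * d ^+ 2 - th ^+ 2 / 4 * d ^+ 2).

Lemma gain_continuous G z th d u : posdef G -> z != 0 -> u != 0 ->
  {for u, continuous (gain G z th d)}.
Proof.
move=> Gp z0 u0.
have s0 : Num.sqrt (qform G u u) != 0 by rewrite gt_eqF// sqrtr_gt0 Gp.
have cs : {for u, continuous (fun u => Num.sqrt (qform G u u))}.
  exact: (continuous_comp (@qform_sq_continuous R n G u) (@sqrt_continuous R _)).
have cD : {for u, continuous (fun u => 'D_u E z)}.
  have -> : (fun u => 'D_u E z) = dotr (\row_j 'D_(delta_mx 0 j) E z).
    apply/funext => w; rewrite (derive_row_sum w); last exact: (mink_C2 NM).1.
    by apply: eq_bigr => j _; rewrite mxE.
  exact: dotr_continuous.
have csV : {for u, continuous (fun u => (Num.sqrt (qform G u u))^-1)} by exact: continuousV.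
have cs2V : {for u, continuous (fun u => (Num.sqrt (qform G u u) ^+ 2)^-1)}.
  apply: continuousV; first by rewrite expf_neq0.
  exact: (continuousM cs cs).
have cc (a : R) : {for u, continuous (fun _ : V => a)} by exact: cst_continuous.
rewrite /gain; apply: continuousM.
  apply: continuousM; last exact: cc.
  by apply: continuousB; [apply: continuousM; [exact: cs|exact: cc]|exact: cc].
apply: continuousB; last exact: cc.
apply: continuousB; last exact: cc.
apply: continuousD.
  by apply: continuousM; [exact: cc|apply: continuousM].
apply: continuousM; first exact: cc.
by apply: continuousM => //; exact: qform_sq_continuous.
Qed.

Lemma gain_le (G : 'M[R]_n) (x : V) (c th : R) : x != 0 -> posdef G -> G^T = G ->
  0 < c -> 0 < th <= 1 ->
  exists2 d0 : R, 0 < d0 & forall (d : R) (u y : V), 0 < d < d0 ->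
    (forall e, qform G e e <= 1 -> `|e| <= c) -> `|y| <= c ->
    qform G (y *m ratio_form G (hessian E (- x))) (y *m ratio_form G (hessian E (- x))) <= 1 ->
    ((1 + th) * d) ^+ 2 <= qform G u u ->
    gain G (- x) th d u <=
    E (u - (x + d *: y)) - E ((d / Num.sqrt (qform G u u)) *: u - (x + d *: y)).
Proof.
move=> x0 Gp Gs c0 /andP[th0 th1].
have om0 : 0 < th ^+ 2 / 4 by rewrite divr_gt0// exprn_gt0.
have nx0 : - x != 0 by rewrite oppr_eq0.
have [d0 d00 H] := energy_retract NM nx0 Gp Gs c0 om0.
exists d0 => // d u y d0d ec yc yG uG.
have /andP[d_gt0 _] := d0d.
have thd : 0 < (1 + th) * d by rewrite mulr_gt0// addr_gt0.
set s := Num.sqrt (qform G u u).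
have ths : (1 + th) * d <= s.
  by rewrite -(ger0_norm (ltW thd)) -sqrtr_sqr ler_wsqrtr.
have s0 : 0 < s by exact: lt_le_trans ths.
have s2 : qform G u u = s ^+ 2 by rewrite sqr_sqrtr// (le_trans _ uG)// sqr_ge0.
have sd : th <= s / d - 1 by rewrite lerBrDl ler_pdivlMr.
have e1 : qform G (s^-1 *: u) (s^-1 *: u) = 1.
  by rewrite qformZl qformZr s2; field; rewrite gt_eqF.
have byE : (y *m ratio_form G (hessian E (- x))) *m G = y *m hessian E (- x).
  by rewrite /ratio_form -!mulmxA mulVmx ?mulmx1// posdef_unitmx.
have th01 : 0 < th <= 1 by rewrite th0.
have := H d th (s / d - 1) (s^-1 *: u) _ y d0d th01 sd (ec _ _) yc e1 yG byE.
rewrite e1 lexx => /(_ isT).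
have -> : 'D_(s^-1 *: u) E (- x) = 'D_u E (- x) / s.
  have := deriveE_lin NM nx0 s^-1 u 0.
  by rewrite addr0 derive0 addr0 mulrC.
have -> : qform (hessian E (- x)) (s^-1 *: u) (s^-1 *: u) = qform (hessian E (- x)) u u / s ^+ 2.
  by rewrite qformZl qformZr; field; rewrite gt_eqF.
rewrite !scalerA.
have -> : - x + (d / s) *: u - d *: y + ((s / d - 1) * d / s) *: u = u - (x + d *: y).
  by apply/rowP => j; rewrite !mxE; field; rewrite !gt_eqF.
have -> : - x + (d / s) *: u - d *: y = (d / s) *: u - (x + d *: y).
  by rewrite opprD addrA [- x + _]addrC.
by [].
Qed.

(** In the average the first-order terms cancel and the Hessian terms add up to G(e, e) = 1. What
    remains is a d^2 th / 4 with a = s / d - 1, and a is at least [th]. *)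
Lemma gain_average (k : nat) (lambda : 'I_k -> R) (G : 'M[R]_n) (z : 'I_k -> V) th d u :
  \sum_i lambda i = 1 -> (forall w, \sum_i lambda i * 'D_w E (z i) = 0) ->
  (forall w, \sum_i lambda i * qform (hessian E (z i)) w w = qform G w w) ->
  posdef G -> 0 < th -> 0 < d -> ((1 + th) * d) ^+ 2 <= qform G u u ->
  th ^+ 2 * d ^+ 2 / 4 <= \sum_i lambda i * gain G (z i) th d u.
Proof.
move=> l1 D0 GE Gp th0 d0 uG; rewrite /gain; set s := Num.sqrt (qform G u u).
have thd : 0 < (1 + th) * d by rewrite mulr_gt0// addr_gt0.
have ths : (1 + th) * d <= s.
  by rewrite -(ger0_norm (ltW thd)) -sqrtr_sqr ler_wsqrtr.
have s0 : 0 < s by exact: lt_le_trans ths.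
have s2 : qform G u u = s ^+ 2 by rewrite sqr_sqrtr// (le_trans _ uG)// sqr_ge0.
have sd : th <= s / d - 1 by rewrite lerBrDl ler_pdivlMr.
set a := s / d - 1 in sd *.
pose c1 := a / th * (th * d / s); pose c2 := a / th * (((1 + th) ^+ 2 - 1) / 2 * d ^+ 2 / s ^+ 2).
pose c3 := a / th * (th * d ^+ 2 + th ^+ 2 / 4 * d ^+ 2).
rewrite (eq_bigr (fun i => c1 * (lambda i * 'D_u E (z i)) +
    (c2 * (lambda i * qform (hessian E (z i)) u u) - c3 * lambda i))); last first.
  by move=> i _; rewrite /c1 /c2 /c3; ring.
rewrite big_split/= sumrB -!mulr_sumr D0 GE l1 mulr0 add0r mulr1 s2.
have -> : c2 * s ^+ 2 - c3 = a * (d ^+ 2 * (th / 4)).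
  by rewrite /c2 /c3; field; rewrite !gt_eqF.
have -> : th ^+ 2 * d ^+ 2 / 4 = th * (d ^+ 2 * (th / 4)) by ring.
by rewrite ler_wpM2r// mulr_ge0 ?sqr_ge0// divr_ge0// ltW.
Qed.

End gain.

Lemma measurable_fun_cond d d' (T : measurableType d) (T' : measurableType d')
    (E W : set T) (f g : T -> T') :
  measurable E -> measurable W -> measurable_fun (E `&` W) f -> measurable_fun (E `\` W) g ->
  measurable_fun E (fun z => if z \in W then f z else g z).
Proof.
move=> mE mW mf mg.
have -> : E = (E `&` W) `|` (E `\` W) by rewrite setUIDK.
apply/measurable_funU; [exact: measurableI|exact: measurableD|split].
  by apply: eq_measurable_fun mf => z /set_mem[_ Wz]; rewrite mem_set.
by apply: eq_measurable_fun mg => z /set_mem[_ Wz]; rewrite memNset.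
Qed.

(** * Small-scale models of the metric measure space *)

Section blowup.
Variables (R : realType) (n : nat) (M : ptopologicalType).
Local Notation V := 'rV[R]_n.
Variables (D : M -> M -> \bar R) (m : {measure set (borel M) -> \bar R}).
Variables (L : {measure set (borel V) -> \bar R}) (N : V -> R) (cf : R).

(* On the ball of radius [r] of [V], the pull-backs of [D / eta] and [m / kappa]
   along [f] are [N] and the Lebesgue measure up to the factor [1 +- tau]. *)
Record blowup (tau r eta kappa : R) (f : V -> M) (g : M -> V) : Prop := Blowup {
  blowup_eta : 0 < eta;
  blowup_kappa : 0 < kappa;
  blowup_continuous : forall u, `|u| < r -> {for u, continuous f};
  blowup_open : open (f @` [set u | `|u| < r]);
  blowupK : forall u, `|u| < r -> g (f u) = u;
  blowup_inv_continuous : forall u, `|u| < r -> {for f u, continuous g};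
  blowup_dist_le : forall u w, `|u| < r -> `|w| < r ->
    (D (f u) (f w) <= ((1 + tau) * eta * N (w - u))%:E)%E;
  blowup_dist_ge : forall u w, `|u| < r -> `|w| < r ->
    (((1 - tau) * eta * N (w - u))%:E <= D (f u) (f w))%E;
  blowup_dist_far : forall s u z, `|u| < s -> s < r -> ~ (f @` [set u | `|u| < r]) z ->
    (((1 - tau) * cf * eta * (r - s))%:E <= D (f u) z)%E;
  blowup_measure : forall Y : set (borel V), measurable Y -> (forall u, Y u -> `|u| < r) ->
    (((1 - tau) * kappa)%:E * L Y <= m (f @` Y) <= ((1 + tau) * kappa)%:E * L Y)%E }.

Hypothesis NM : minkowski_norm N.
Local Notation E := (energy N).

Section at_scale.
Variables (tau r eta kappa : R) (f : V -> M) (g : M -> V).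
Hypothesis bu : blowup tau r eta kappa f g.
Local Notation U := (f @` [set u | `|u| < r]).

Lemma blowup_image (Y : set V) : (forall u, Y u -> `|u| < r) -> f @` Y = U `&` g @^-1` Y.
Proof.
move=> Yr; apply/seteqP; split => [_ [u Yu <-]|_ [[u ur <-]]].
  by split; [exists u => //; exact: Yr|rewrite /= (blowupK bu)//; exact: Yr].
by rewrite /= (blowupK bu)// => Yu; exists u.
Qed.

Lemma blowup_inv_measurable : measurable_fun (U : set (borel M)) (g : borel M -> borel V).
Proof.
apply: borel_measurable_fun; first exact: blowup_open bu.
by move=> _ [u ur <-]; exact: (blowup_inv_continuous bu).
Qed.

Lemma blowup_image_measurable (Y : set (borel V)) : measurable Y ->
  (forall u, Y u -> `|u| < r) -> measurable (f @` Y : set (borel M)).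
Proof.
move=> mY Yr; rewrite blowup_image//; apply: blowup_inv_measurable => //.
by apply: borel_open; exact: blowup_open bu.
Qed.

(** An energy difference is transferred to squared distances. All norms involved are at most C = 2 r
    cN, and replacing (1 + tau)^2 and (1 - tau)^2 by 1 costs at most 3 tau C^2 each. *)
Lemma blowup_retract (cN : R) (u w y : V) : 0 < tau <= 1 -> (forall u, N u <= cN * `|u|) -> 0 < cN ->
  `|u| < r -> `|w| < r -> `|y| < r ->
  (D (f w) (f y) ^+ 2 + (eta ^+ 2 * (2 * (E (u - y) - E (w - y)) - 6 * tau * (2 * r * cN) ^+ 2))%:E
   <= D (f u) (f y) ^+ 2)%E.
Proof.
move=> /andP[tau0 tau1] NcN cN0 ur wr yr.
have eta0 := blowup_eta bu.
have Nsym a b : N (a - b) = N (b - a) by rewrite -[in RHS]opprB (minkN NM).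
have Nb a : `|a| < r -> 0 <= N (a - y) <= 2 * r * cN.
  move=> ar; rewrite (mink_ge0 NM)/= (le_trans (NcN _))// mulrC ler_pM2r//.
  by rewrite (le_trans (ler_normB _ _))// mulr2n mulrDl mul1r lerD// ltW.
have := Nb _ ur; have := Nb _ wr; rewrite /energy.
have h1 := blowup_dist_le bu wr yr; have h2 := blowup_dist_ge bu ur yr.
rewrite Nsym in h1; rewrite Nsym in h2; move: h1 h2.
set a := N (w - y); set b := N (u - y); set C := _ * cN => h1 h2 /andP[a0 aC] /andP[b0 bC].
have le1 : (D (f w) (f y) ^+ 2 <= (((1 + tau) * eta * a) ^+ 2)%:E)%E.
  have [D0|D0] := leP 0%E (D (f w) (f y)).
    by rewrite EFin_expe lee_sqr// lee_fin; apply: mulr_ge0 => //; apply: mulr_ge0; lra.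
  have := blowup_dist_ge bu wr yr; rewrite leNgt => /negP[].
  by apply: lt_le_trans D0 _; rewrite lee_fin Nsym; apply: mulr_ge0 => //; apply: mulr_ge0; lra.
have Y0 : 0 <= (1 - tau) * eta * b by apply: mulr_ge0 => //; apply: mulr_ge0; lra.
have le2 : ((((1 - tau) * eta * b) ^+ 2)%:E <= D (f u) (f y) ^+ 2)%E.
  rewrite EFin_expe lee_sqr// ?lee_fin//; exact: le_trans h2.
apply: le_trans le2; apply: le_trans (leeD2r _ le1) _; rewrite -EFinD lee_fin.
have -> : ((1 + tau) * eta * a) ^+ 2 + eta ^+ 2 * (2 * (b ^+ 2 / 2 - a ^+ 2 / 2) - 6 * tau * C ^+ 2)
  = eta ^+ 2 * ((1 + tau) ^+ 2 * a ^+ 2 + b ^+ 2 - a ^+ 2 - 6 * tau * C ^+ 2) by field.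
have -> : ((1 - tau) * eta * b) ^+ 2 = eta ^+ 2 * ((1 - tau) ^+ 2 * b ^+ 2) by ring.
rewrite ler_wpM2l ?sqr_ge0//.
have aa : a ^+ 2 <= C ^+ 2 by rewrite lerXn2r ?nnegrE// (le_trans a0).
have bb : b ^+ 2 <= C ^+ 2 by rewrite lerXn2r ?nnegrE// (le_trans a0).
have a2 : tau * (2 + tau) * a ^+ 2 <= tau * 3 * C ^+ 2.
  by apply: ler_pM; rewrite ?sqr_ge0//; nra.
have b2 : tau * (2 - tau) * b ^+ 2 <= tau * 3 * C ^+ 2.
  by apply: ler_pM; rewrite ?sqr_ge0//; nra.
lra.
Qed.

End at_scale.
End blowup.

Lemma mulmxr_bounded (R : realType) (n : nat) (T : 'M[R]_n) :
  exists2 C : R, 0 < C & forall u : 'rV[R]_n, `|u *m T| <= C * `|u|.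
Proof.
exists (\sum_i \sum_j `|T i j| + 1).
  by rewrite ltr_wpDl//; apply: sumr_ge0 => i _; apply: sumr_ge0.
move=> u; apply: norm_le_coord.
  by rewrite mulr_ge0// addr_ge0//; apply: sumr_ge0 => i _; apply: sumr_ge0.
move=> j; rewrite mxE (le_trans (ler_norm_sum _ _ _))//.
apply: (@le_trans _ _ (\sum_i `|T i j| * `|u|)).
  by apply: ler_sum => i _; rewrite normrM mulrC ler_wpM2l// coord_le_norm.
rewrite -mulr_suml ler_wpM2r//.
apply: ler_wpDr => //; apply: ler_sum => i _; rewrite (bigD1 j)//= lerDl.
exact: sumr_ge0.
Qed.

Section minkowski_bounds.
Variables (R : realType) (n : nat) (N : 'rV[R]_n -> R).
Hypothesis NM : minkowski_norm N.

Let Ec (u : 'rV[R]_n) : u != 0 -> {for u, continuous (energy N)}.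
Proof.
by move=> u0; exact: (class_C_continuous (mink_C2 NM)).
Qed.

Lemma mink_upper : exists2 C : R, 0 < C & forall u, N u <= C * `|u|.
Proof.
have [C C0 CE] := sphere_max Ec; exists (C * 2 + 1); first by lra.
move=> u; have [->|u0] := eqVneq u 0; first by rewrite (mink0 NM) normr0 mulr0.
have nu : 0 < `|u| by rewrite normr_gt0.
have -> : N u = `|u| * N (`|u|^-1 *: u).
  by rewrite (minkZ NM) ?invr_gt0// mulrA mulfV ?mul1r// gt_eqF.
rewrite mulrC ler_pM2r//.
have := CE _ (sphere_normalize u0); rewrite /energy.
have := mink_ge0 NM (`|u|^-1 *: u); nra.
Qed.

Lemma mink_lower : exists2 c : R, 0 < c & forall u, c * `|u| <= N u.
Proof.
have [c c0 cE] := sphere_min Ec (fun u u0 => divr_gt0 (exprn_gt0 2 (mink_gt0 NM u0)) (ltr0Sn R 1)).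
exists (Num.min 1 c); first by rewrite lt_min ltr01.
move=> u; have [->|u0] := eqVneq u 0; first by rewrite (mink0 NM) normr0 mulr0.
have nu : 0 < `|u| by rewrite normr_gt0.
have -> : N u = `|u| * N (`|u|^-1 *: u).
  by rewrite (minkZ NM) ?invr_gt0// mulrA mulfV ?mul1r// gt_eqF.
rewrite mulrC ler_pM2l// ge_min.
have := cE _ (sphere_normalize u0); rewrite /energy.
have := mink_ge0 NM (`|u|^-1 *: u); case: (leP 1) => //= h; nra.
Qed.

End minkowski_bounds.

(** * The Brunn-Minkowski inequality inside a blowup *)

Section blowup_inequality.
Variables (R : realType) (n : nat) (M : ptopologicalType).
Local Notation V := 'rV[R]_n.
Variables (D : M -> M -> \bar R) (m : {measure set (borel M) -> \bar R}) (K : R).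
Hypotheses (bcd : BCD D m K) (scM : @second_countable M).
Variables (L : {measure set (borel V) -> \bar R}) (N : V -> R) (cf : R).
Hypotheses (NM : minkowski_norm N) (lebL : is_lebesgue L).
Local Notation E := (energy N).

Variables (k : nat) (lambda : 'I_k -> R) (x : 'I_k -> V) (G : 'M[R]_n).
Hypotheses (lam0 : forall i, 0 < lambda i) (lam1 : \sum_i lambda i = 1).
Hypotheses (x0 : forall i, x i != 0) (Gp : posdef G) (Gs : G^T = G).
Local Notation H i := (hessian E (- x i)).
Local Notation Q i := (ratio_form G (H i)).
Local Notation q := (fun u => qform G u u).

Variables (tau r eta kappa : R) (f : V -> M) (g : M -> V).
Hypothesis bu : blowup D m L N cf tau r eta kappa f g.
Local Notation U := (f @` [set u | `|u| < r]).

Variables (th d ce s0 cN : R).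
Hypotheses (tau0 : 0 < tau) (tau1 : tau <= 2^-1) (th0 : 0 < th) (th1 : th <= 1).
Hypotheses (d0 : 0 < d) (d1 : d <= 1).
Hypotheses (ce0 : 0 < ce) (cN0 : 0 < cN) (s0r : s0 < r).
Hypothesis NcN : forall u, N u <= cN * `|u|.
Hypothesis Gce : forall e, q e <= 1 -> `|e| <= ce.
Hypothesis Qce : forall i y, q (y *m Q i) <= 1 -> `|y| <= ce.
Hypotheses (xs0 : forall i, `|x i| + ce < s0) (ces0 : 2 * ce < s0).
Hypothesis gainE : forall i u y, `|y| <= ce -> q (y *m Q i) <= 1 ->
  ((1 + th) * d) ^+ 2 <= q u ->
  gain N G (- x i) th d u <= E (u - (x i + d *: y)) - E ((d / Num.sqrt (q u)) *: u - (x i + d *: y)).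
Variable gam : R.
Hypothesis gam0 : 0 < gam.
Hypothesis gain_avg : forall u, ((1 + th) * d) ^+ 2 <= q u ->
  gam <= \sum_i lambda i * gain N G (- x i) th d u.
Hypothesis tau_small : 6 * tau * (2 * r * cN) ^+ 2 <= gam.
Hypothesis r_large : 4 * cN * s0 + 1 <= cf * (r - s0) / 2.

(** The radius is [(1 + th) * d], whereas the retraction lands at G-radius [d]: this margin keeps
    the gain away from 0 off the target. *)
Definition target_ball : set V := [set u | q u <= ((1 + th) * d) ^+ 2].
(** The points x_i + d y with y Q_i in the unit ellipsoid of [G], so that by convexity the
    linearized barycenters lie in the G-ball of radius [d]. *)
Definition source_ball i : set V :=
  [set u | unit_ellipsoid G ((d^-1 *: (u - x i)) *m Q i)].

Fact eta0 : 0 < eta. Proof. exact: blowup_eta bu. Qed.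
Fact s0_gt0 : 0 < s0. Proof. by apply: lt_trans ces0; rewrite mulr_gt0. Qed.
Fact r0 : 0 < r. Proof. exact: lt_trans s0_gt0 s0r. Qed.
Let dmet : is_metric D. Proof. by case: bcd. Qed.

Let sqrt_q u : u != 0 -> 0 < Num.sqrt (q u).
Proof. by move=> u0; rewrite sqrtr_gt0; exact: Gp. Qed.

Let q_norm (t : R) u : 0 < t -> q u <= t ^+ 2 -> `|u| <= t * ce.
Proof.
move=> t0 qu; have -> : u = t *: (t^-1 *: u) by rewrite scalerA mulfV ?scale1r// gt_eqF.
rewrite normrZ gtr0_norm// ler_pM2l//; apply: Gce.
by rewrite qformZl qformZr mulrA -invfM -expr2 mulrC ler_pdivrMr ?exprn_gt0// mul1r.
Qed.

Lemma target_ball_bound u : target_ball u -> `|u| < s0.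
Proof.
move=> qu; apply: le_lt_trans ces0.
have h : 0 < (1 + th) * d by rewrite mulr_gt0// addr_gt0.
apply: le_trans (q_norm h qu) _; rewrite ler_pM2r//.
by have := ler_pM (ltW th0) (ltW d0) th1 d1; move: d1; lra.
Qed.

Lemma source_ballP i u : source_ball i u ->
  exists y, [/\ u = x i + d *: y, `|y| <= ce & q (y *m Q i) <= 1].
Proof.
move=> uA; exists (d^-1 *: (u - x i)); split => //; last exact: Qce uA.
by rewrite scalerA mulfV ?gt_eqF// scale1r addrC subrK.
Qed.

Lemma source_ball_bound i u : source_ball i u -> `|u| < s0.
Proof.
move=> /source_ballP[y [-> yce _]]; apply: le_lt_trans (xs0 i).
rewrite (le_trans (ler_normD _ _))// lerD2l normrZ gtr0_norm//.
by apply: le_trans yce; rewrite ler_piMl.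
Qed.

Let lt_r (u : V) : `|u| < s0 -> `|u| < r. Proof. by move/lt_trans; apply. Qed.

Lemma target_ball_closed : closed target_ball.
Proof.
have -> : target_ball = q @^-1` [set t : R | t <= ((1 + th) * d) ^+ 2] by [].
by apply: closed_comp; [move=> u _; exact: qform_sq_continuous|exact: closed_le].
Qed.

Lemma source_ball_closed i : closed (source_ball i).
Proof.
have -> : source_ball i = (fun u : V => q ((d^-1 *: (u - x i)) *m Q i)) @^-1` [set t : R | t <= 1] by [].
apply: closed_comp; last exact: closed_le.
move=> u _; have c1 : {for u, continuous (fun u : V => d^-1 *: (u - x i))}.
  have c0 : {for u, continuous (fun u : V => u - x i)}.
    by apply: continuousB; [exact: cvg_id|exact: cst_continuous].
  exact: (continuous_comp c0 (@scaler_continuous _ _ d^-1 _)).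
have c2 : {for u, continuous (fun u : V => (d^-1 *: (u - x i)) *m Q i)}.
  exact: (continuous_comp c1 (@mulmxr_continuous R n (Q i) _)).
exact: (continuous_comp c2 (@qform_sq_continuous R n G _)).
Qed.

Local Notation W := (f @` target_ball).
Local Notation radial u := ((d / Num.sqrt (q u)) *: u).
Local Notation D0 := (4 * cN * s0).
Local Notation err := (6 * tau * (2 * r * cN) ^+ 2).

Let mW : measurable (W : set (borel M)).
Proof.
apply: (blowup_image_measurable bu); first exact: borel_closed target_ball_closed.
by move=> u /target_ball_bound/lt_r.
Qed.

Let mU : measurable (U : set (borel M)).
Proof. by apply: borel_open; exact: blowup_open bu. Qed.

(** Off the target a point of the chart ball moves radially to G-radius [d]; points outside the
    blowup ball are all sent to its center. *)
Definition retraction (z : M) : M :=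
  if z \in W then z else if z \in U then f (radial (g z)) else f 0.

(** A lower bound for the decrease of the squared distance to the i-th source. Truncation at
    [- D0 ^+ 2] supplies the uniform lower bound asked by [barycenter_retract], and it is legitimate
    because after retraction the squared distance is at most (eta D0)^2. *)
Definition defect i (z : M) : R :=
  if z \in W then 0 else if z \in U then
    eta ^+ 2 * Num.max (- D0 ^+ 2) (2 * gain N G (- x i) th d (g z) - err)
  else eta ^+ 2.

Let radial_bound u : u != 0 -> `|radial u| < s0.
Proof.
move=> u0; apply: le_lt_trans ces0.
apply: le_trans (q_norm d0 _) _.
  rewrite qformZl qformZr mulrA -expr2 expr_div_n sqr_sqrtr ?posdef_ge0//.
  by rewrite divfK// gt_eqF// Gp.
by rewrite ler_pM2r//; move: d1; lra.
Qed.

Let off_target u : `|u| < r -> ~ W (f u) -> u != 0 /\ ((1 + th) * d) ^+ 2 < q u.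
Proof.
move=> ur nW; have h : ((1 + th) * d) ^+ 2 < q u.
  by rewrite ltNge; apply/negP => qu; apply: nW; exists u.
split => //; apply: contraTneq h => ->.
by rewrite qform0l -leNgt sqr_ge0.
Qed.

Local Notation O := (U `&` g @^-1` [set u | u != 0]).

Let oO : open O.
Proof.
apply: open_preimageI; first exact: blowup_open bu.
  by move=> _ [u ur <-]; exact: (blowup_inv_continuous bu).
exact: neq0_open.
Qed.

Let UWO : (setT `\` W) `&` U `<=` O.
Proof.
move=> z [[_ nW] [u ur fuE]]; move: nW; rewrite -{}fuE => nW; split; first by exists u.
by rewrite /= (blowupK bu)//; have [] := off_target ur nW.
Qed.

Let retraction_measurable : measurable_fun setT (retraction : borel M -> borel M).
Proof.
apply: measurable_fun_cond => //.
apply: measurable_fun_cond => //; first exact: measurableD.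
apply: (@measurable_funS _ _ (borel M) _ O) => //; first exact: borel_open oO.
apply: borel_measurable_fun oO _ => z [[u ur <-]]; rewrite /= (blowupK bu)// => u0.
have cg : {for f u, continuous g} by exact: (blowup_inv_continuous bu).
have cr : {for u, continuous (fun u : V => radial u)}.
  apply: continuousZ; last exact: cvg_id.
  apply: continuousM; first exact: cst_continuous.
  apply: continuousV; first by rewrite gt_eqF// sqrt_q.
  exact: (continuous_comp (@qform_sq_continuous R n G u) (@sqrt_continuous R _)).
have cf' : {for radial u, continuous f}.
  by apply: (blowup_continuous bu); apply: lt_r; exact: radial_bound.
rewrite -(blowupK bu ur) in cr cf'.
exact: (continuous_comp (continuous_comp cg cr) cf').
Qed.

Let defect_measurable i : measurable_fun setT (defect i : borel M -> R).
Proof.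
apply: measurable_fun_cond => //.
apply: measurable_fun_cond => //; first exact: measurableD.
apply: (@measurable_funS _ _ (borel M) _ O) => //; first exact: borel_open oO.
apply: measurable_funM => //; apply: measurable_maxr => //.
apply: measurable_funB => //; apply: measurable_funM => //.
apply: borel_measurable_real oO _ => z [[u ur <-]]; rewrite /= (blowupK bu)// => u0.
have cg : {for f u, continuous g} by exact: (blowup_inv_continuous bu).
apply: continuous_comp cg _; rewrite (blowupK bu)//.
by apply: gain_continuous; rewrite ?oppr_eq0.
Qed.

Let N0 u : 0 <= N u. Proof. exact: mink_ge0. Qed.

Let D_le u w : `|u| < s0 -> `|w| < s0 -> (D (f u) (f w) <= (eta * D0)%:E)%E.
Proof.
move=> us ws; apply: le_trans (blowup_dist_le bu (lt_r us) (lt_r ws)) _; rewrite lee_fin.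
have h : N (w - u) <= cN * (2 * s0).
  apply: le_trans (NcN _) _; rewrite ler_pM2l//.
  by rewrite (le_trans (ler_normB _ _))//; lra.
have -> : eta * D0 = 2 * eta * (cN * (2 * s0)) by ring.
move: tau0 tau1 eta0 => t0 t1 e0; apply: ler_pM => //; first by apply: mulr_ge0; lra.
by rewrite ler_pM2r//; lra.
Qed.

Let retractionP z : exists2 w, retraction z = f w & `|w| < s0.
Proof.
rewrite /retraction; case: ifPn => [/set_mem[u /target_ball_bound us <-]|/negP zW].
  by exists u.
case: ifPn => [/set_mem[u ur uz]|_]; last by exists 0; rewrite ?normr0 ?s0_gt0.
suff gz0 : g z != 0 by exists (radial (g z)); [by []|exact: radial_bound gz0].
have nW : ~ W (f u) by rewrite uz => /mem_set.
by rewrite -uz (blowupK bu)//; have [] := off_target ur nW.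
Qed.

Let sqD_le z i y : source_ball i y -> (D (retraction z) (f y) ^+ 2 <= ((eta * D0) ^+ 2)%:E)%E.
Proof.
move=> /source_ball_bound ys; have [w -> ws] := retractionP z.
rewrite EFin_expe lee_sqr ?(metric_ge0 dmet)//; first exact: D_le.
by rewrite lee_fin !mulr_ge0 ?(ltW eta0) ?(ltW cN0) ?(ltW s0_gt0).
Qed.

Let defect_le i z y : source_ball i y ->
  (D (retraction z) (f y) ^+ 2 + (defect i z)%:E <= D z (f y) ^+ 2)%E.
Proof.
move=> yA; have sq := sqD_le z yA; have ys := source_ball_bound yA.
have Dge0 : (0 <= D z (f y) ^+ 2)%E by rewrite expe2 mule_ge0// (metric_ge0 dmet).
move: sq; rewrite /retraction /defect; case: ifPn => [_ _|/negP zW]; first by rewrite adde0.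
case: ifPn => [/set_mem[u ur uz]|/negP zU] sq.
  have [u0 qu] : u != 0 /\ ((1 + th) * d) ^+ 2 < q u.
    by apply: off_target => //; rewrite uz => /mem_set.
  move: sq Dge0; rewrite -uz (blowupK bu)// => sq Dge0.
  case: (leP (- D0 ^+ 2) (2 * gain N G (- x i) th d u - err)) => _; last first.
    apply: le_trans Dge0; apply: le_trans (leeD2r _ sq) _.
    by rewrite -EFinD lee_fin; lra.
  have t1 : 0 < tau <= 1 by move: tau0 tau1; lra.
  apply: le_trans (blowup_retract NM bu t1 NcN cN0 ur (lt_r (radial_bound u0)) (lt_r ys)).
  have gE : gain N G (- x i) th d u <= E (u - y) - E (radial u - y).
    by have [y' [-> yce yQ]] := source_ballP yA; apply: gainE => //; exact: ltW.
  apply: leeD2l; rewrite lee_fin; apply: ler_wpM2l; first exact: sqr_ge0.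
  by rewrite lerB// ler_pM2l.
apply: le_trans (leeD2r _ sq) _; rewrite -EFinD.
(* By [r_large] a point outside the blowup ball is at distance at least eta (D0 + 1) from the source
   point, against at most eta D0 for its image; the squares differ by more than eta^2. *)
have far := blowup_dist_far bu ys s0r (fun h => zU (mem_set h)).
rewrite (Defs.metric_sym dmet).
apply: (@le_trans _ _ ((eta * (D0 + 1)) ^+ 2)%:E).
  have : 0 < D0 by rewrite !mulr_gt0 ?s0_gt0.
  rewrite lee_fin; by have := exprn_gt0 2 eta0; nra.
rewrite EFin_expe lee_sqr ?(metric_ge0 dmet)//; last first.
  by rewrite lee_fin mulr_ge0 ?(ltW eta0)// addr_ge0// !mulr_ge0 ?(ltW cN0) ?(ltW s0_gt0).
apply: le_trans far; rewrite lee_fin.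
have -> : (1 - tau) * cf * eta * (r - s0) = eta * ((1 - tau) * (cf * (r - s0))) by ring.
rewrite ler_pM2l ?eta0//; apply: le_trans r_large _.
have : 0 <= cf * (r - s0).
  have : 0 < D0 by rewrite !mulr_gt0 ?s0_gt0.
  by move: r_large; lra.
by move: tau1; nra.
Qed.

Lemma blowup_brunn_minkowski : (forall i, (0 < L (source_ball i) < +oo)%E) ->
  (0 < L target_ball < +oo)%E ->
  \sum_i lambda i * ln (fine (m (f @` source_ball i))) - `|K| / 2 * (eta * D0) ^+ 2
  <= ln (fine (m (f @` target_ball))).
Proof.
move=> LA LW.
have k0 := blowup_kappa bu.
have mpos (Y : set (borel V)) : measurable Y -> (forall u, Y u -> `|u| < s0) -> (0 < L Y < +oo)%E ->
    (0 < m (f @` Y))%E /\ (m (f @` Y) < +oo)%E.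
  move=> mY Ys /andP[LY0 LYoo].
  have /andP[h1 h2] := blowup_measure bu mY (fun u Yu => lt_r (Ys u Yu)).
  have Lf : L Y \is a fin_num by rewrite ge0_fin_numE.
  split; first by apply: lt_le_trans h1; rewrite mule_gt0// lte_fin mulr_gt0//; move: tau1; lra.
  by apply: le_lt_trans h2 _; rewrite -(fineK Lf) -EFinM ltry.
have mA i : measurable (source_ball i : set (borel V)) by exact: borel_closed (@source_ball_closed i).
have mT : measurable (target_ball : set (borel V)) by exact: borel_closed target_ball_closed.
have Ai i := mpos _ (mA i) (@source_ball_bound i) (LA i).
have Wi := mpos _ mT target_ball_bound LW.
have e2 : 0 < eta ^+ 2 by rewrite exprn_gt0 ?eta0.
apply: (@barycenter_brunn_minkowski R M D m K bcd scM k lambda retraction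
  (fun i => f @` source_ball i) defect W (eta ^+ 2 * Num.min gam 1) ((eta * D0) ^+ 2)
  (eta * D0) (f 0)) => //.
- by rewrite !mulr_ge0 ?(ltW eta0) ?(ltW cN0) ?(ltW s0_gt0).
- by move=> z; have [w -> ws] := retractionP z; apply: D_le => //; rewrite normr0 s0_gt0.
- by move=> i; apply: (blowup_image_measurable bu) => // u /source_ball_bound/lt_r.
- by move=> i; have [] := Ai i.
- by move=> i; have [] := Ai i.
- by move=> i _ [y yA <-]; apply: D_le; rewrite ?normr0 ?s0_gt0//; exact: source_ball_bound yA.
- exact: sqr_ge0.
- move=> i z; rewrite /defect; case: ifPn => _; first by rewrite add0r sqr_ge0.
  case: ifPn => _; last by rewrite addr_ge0// sqr_ge0.
  rewrite [(eta * _) ^+ 2]exprMn -mulrDr mulr_ge0 ?(ltW e2)// -lerBlDr sub0r.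
  by rewrite le_max lexx.
- by move=> i z _ [y yA <-]; exact: defect_le.
- by have [] := Wi.
- by have [] := Wi.
- by rewrite mulr_gt0// lt_min gam0 ltr01.
- by move=> z /mem_set zW; rewrite /defect zW big1// => i _; rewrite mulr0.
move=> z zW; rewrite /defect memNset//.
case: (boolP (z \in U)) => [/set_mem[u ur uz]|_]; last first.
  by rewrite -mulr_suml lam1 mul1r ler_piMr ?(ltW e2)// ge_min lexx orbT.
have [u0 qu] : u != 0 /\ ((1 + th) * d) ^+ 2 < q u by apply: off_target => //; rewrite uz.
rewrite -uz (blowupK bu)//.
(* The averaged gain counts twice, so it leaves at least [gam] after paying the error, itself at
   most [gam]. *)
apply: (@le_trans _ _ (eta ^+ 2 * (2 * (\sum_i lambda i * gain N G (- x i) th d u) - err))).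
  rewrite ler_pM2l// ge_min; apply/orP; left.
  have := gain_avg (ltW qu); move: tau_small; lra.
have -> : eta ^+ 2 * (2 * (\sum_i lambda i * gain N G (- x i) th d u) - err) =
    \sum_i lambda i * (eta ^+ 2 * (2 * gain N G (- x i) th d u - err)).
  rewrite [RHS](eq_bigr (fun i => 2 * eta ^+ 2 * (lambda i * gain N G (- x i) th d u)
    - eta ^+ 2 * err * lambda i)); last by move=> i _; ring.
  by rewrite sumrB -!mulr_sumr lam1; ring.
apply: ler_sum => i _.
by rewrite ler_pM2l// ler_pM2l// le_max lexx orbT.
Qed.

End blowup_inequality.

(** * Letting the scale tend to zero in the volume inequality *)

Section volume_factors.
Variables (R : realType) (n : nat) (M : ptopologicalType).
Local Notation V := 'rV[R]_n.
Variables (D : M -> M -> \bar R) (m : {measure set (borel M) -> \bar R}) (K : R).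
Hypotheses (bcd : BCD D m K) (scM : @second_countable M).
Variables (L : {measure set (borel V) -> \bar R}) (N : V -> R) (cf : R).
Hypotheses (NM : minkowski_norm N) (lebL : is_lebesgue L).
Local Notation E := (energy N).

Variables (k : nat) (lambda : 'I_k -> R) (x : 'I_k -> V) (G : 'M[R]_n).
Hypotheses (lam0 : forall i, 0 < lambda i) (lam1 : \sum_i lambda i = 1).
Hypotheses (x0 : forall i, x i != 0) (Gp : posdef G) (Gs : G^T = G).
Local Notation H i := (hessian E (- x i)).
Local Notation Q i := (ratio_form G (H i)).
Variable c : 'I_k -> R.
Hypothesis c0 : forall i, 0 < c i.
Hypothesis cE : forall i (A : set (borel V)), measurable A ->
  L ((fun u : V => u *m Q i) @^-1` A) = ((c i)%:E * L A)%E.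

Let B := unit_ellipsoid G.
Let mB : measurable (B : set (borel V)).
Proof. exact: borel_closed (@unit_ellipsoid_closed _ _ G). Qed.

Lemma source_ball_volume d i : 0 < d ->
  L (source_ball N x G d i) = ((d ^+ n * c i)%:E * L B)%E.
Proof.
move=> d0.
have mQ : measurable ((fun u : V => u *m Q i) @^-1` B : set (borel V)).
  by rewrite -[X in measurable X]setTI; exact: mulmxr_measurable.
have ms : measurable_fun setT ((fun u : V => d^-1 *: u) : borel V -> borel V).
  by apply: borel_measurable_fun; [exact: openT|move=> u _; exact: scaler_continuous].
have mS := ms measurableT _ mQ; rewrite setTI in mS.
rewrite EFinM -muleA -cE// -lebesgue_scale//.
by rewrite -(lebesgue_translation_invariant lebL (- x i) mS).
Qed.

Lemma target_ball_volume th d : 0 < th -> 0 < d ->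
  L (target_ball G th d) = ((((1 + th) * d) ^+ n)%:E * L B)%E.
Proof.
move=> th0 d0; have s0 : 0 < (1 + th) * d by rewrite mulr_gt0// addr_gt0.
rewrite -lebesgue_scale//; congr (L _); apply/seteqP.
have E' u : qform G (((1 + th) * d)^-1 *: u) (((1 + th) * d)^-1 *: u) = qform G u u / ((1 + th) * d) ^+ 2.
  by rewrite qformZl qformZr; field; rewrite !gt_eqF// addr_gt0.
by split => u; rewrite /target_ball/= /B /unit_ellipsoid/= E' ler_pdivrMr ?exprn_gt0// mul1r.
Qed.

(** All sets have volume [kappa * d ^+ n * b] times a factor; as the weights sum to 1, this common
    volume drops out after taking logarithms. The errors come from ln (1 + t) <= t: tau + 2 tau from
    the measure comparison and n th from the enlarged target. *)
Lemma blowup_volume_le (tau r eta kappa : R) (f : V -> M) (g : M -> V) (th d D0 : R) :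
  blowup D m L N cf tau r eta kappa f g ->
  0 < tau <= 2^-1 -> 0 < th -> 0 < d ->
  (forall i u, source_ball N x G d i u -> `|u| < r) ->
  (forall u, target_ball G th d u -> `|u| < r) ->
  \sum_i lambda i * ln (fine (m (f @` source_ball N x G d i))) - `|K| / 2 * (eta * D0) ^+ 2
    <= ln (fine (m (f @` target_ball G th d))) ->
  \sum_i lambda i * ln (c i) <= 3 * tau + n%:R * th + `|K| / 2 * (eta * D0) ^+ 2.
Proof.
move=> bu /andP[tau0 tau1] th0 d0 sr tr.
have [b b0 bE] := ellipsoid_volume Gp lebL.
have k0 := blowup_kappa bu.
have t1 : 0 < 1 - tau by lra.
have t2 : 0 < 1 + tau by lra.
have h1 : 0 < 1 + th by lra.
have mA i : measurable (source_ball N x G d i : set (borel V)) by exact: borel_closed (@source_ball_closed _ _ _ _ _ _ _ i).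
have mT : measurable (target_ball G th d : set (borel V)) by exact: borel_closed (@target_ball_closed _ _ _ _ _).
have dn : 0 < d ^+ n by rewrite exprn_gt0.
have hn : 0 < (1 + th) ^+ n by rewrite exprn_gt0.
pose V0 := kappa * d ^+ n * b.
have V00 : 0 < V0 by rewrite !mulr_gt0.
have Ae i : ln (1 - tau) + ln V0 + ln (c i) <= ln (fine (m (f @` source_ball N x G d i))).
  have /andP[l1 l2] := blowup_measure bu (mA i) (sr i).
  rewrite source_ball_volume// bE -!EFinM in l1 l2.
  rewrite -lnM ?posrE// -lnM ?posrE ?mulr_gt0//.
  have mf : m (f @` source_ball N x G d i) \is a fin_num.
    by rewrite ge0_fin_numE// (le_lt_trans l2)// ltry.
  have E1 : (1 - tau) * V0 * c i = (1 - tau) * kappa * (d ^+ n * c i * b) by rewrite /V0; ring.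
  rewrite -(fineK mf) lee_fin -E1 in l1.
  by rewrite ler_ln ?posrE// ?mulr_gt0// (lt_le_trans _ l1)// !mulr_gt0.
have Te : ln (fine (m (f @` target_ball G th d))) <= ln (1 + tau) + ln V0 + n%:R * ln (1 + th).
  have /andP[l1 l2] := blowup_measure bu mT tr.
  rewrite target_ball_volume// bE -!EFinM in l1 l2.
  have mf : m (f @` target_ball G th d) \is a fin_num.
    by rewrite ge0_fin_numE// (le_lt_trans l2)// ltry.
  rewrite mulr_natl -lnXn// -lnM ?posrE// -lnM ?posrE ?mulr_gt0//.
  have E1 : (1 + tau) * V0 * (1 + th) ^+ n = (1 + tau) * kappa * (((1 + th) * d) ^+ n * b).
    by rewrite /V0 exprMn; ring.
  rewrite -(fineK mf) !lee_fin -E1 in l1 l2.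
  rewrite ler_ln ?posrE// ?mulr_gt0// (lt_le_trans _ l1)// !mulr_gt0// exprn_gt0// mulr_gt0//.
move=> main.
have S1 : ln (1 - tau) + ln V0 + \sum_i lambda i * ln (c i)
    <= \sum_i lambda i * ln (fine (m (f @` source_ball N x G d i))).
  have -> : ln (1 - tau) + ln V0 + \sum_i lambda i * ln (c i) =
      \sum_i lambda i * (ln (1 - tau) + ln V0 + ln (c i)).
    rewrite [RHS](eq_bigr (fun i => (ln (1 - tau) + ln V0) * lambda i + lambda i * ln (c i))).
      by rewrite big_split/= -mulr_sumr lam1 mulr1.
    by move=> i _; ring.
  by apply: ler_sum => i _; rewrite ler_wpM2l ?(ltW (lam0 i)).
have n1 : ln (1 + tau) <= tau by apply: le_ln1Dx; lra.
have n2 : n%:R * ln (1 + th) <= n%:R * th by rewrite ler_wpM2l// le_ln1Dx//; lra.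
have n3 : - ln (1 - tau) <= 2 * tau.
  rewrite -lnV ?posrE//.
  have -> : (1 - tau)^-1 = 1 + tau / (1 - tau) by field; rewrite gt_eqF.
  apply: le_trans (le_ln1Dx _) _; first by apply: lt_trans (divr_gt0 tau0 t1); lra.
  by rewrite ler_pdivrMr//; nra.
lra.
Qed.

Hypothesis cf0 : 0 < cf.
Hypothesis blowups : forall tau r eta0 : R, 0 < tau < 1 -> 0 < r -> 0 < eta0 ->
  exists eta kappa f g, eta < eta0 /\ blowup D m L N cf tau r eta kappa f g.
Hypothesis dE0 : forall w, \sum_i lambda i * 'D_w E (- x i) = 0.
Hypothesis GE : forall w, \sum_i lambda i * qform (H i) w w = qform G w w.

(** If the sum [b] were positive, the parameters could be chosen with 3 tau <= 3 b / 16, n th <= b /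
    4 and curvature term at most b / 4, contradicting [blowup_volume_le]. They are fixed in the
    order th, d, r, tau, eta, each depending on the previous ones. *)
Lemma volume_factors_le : \sum_i lambda i * ln (c i) <= 0.
Proof.
rewrite leNgt; apply/negP; set b := \sum_i _ => b0.
have n1 : 0 < 1 + n%:R :> R by rewrite ltr_wpDr.
pose th := Num.min 1 (b / (4 * (1 + n%:R))).
have th0 : 0 < th by rewrite lt_min ltr01 divr_gt0// mulr_gt0.
have th1 : th <= 1 by rewrite ge_min lexx.
have nth : n%:R * th <= b / 4.
  apply: (@le_trans _ _ ((1 + n%:R) * (b / (4 * (1 + n%:R))))); last first.
    by rewrite le_eqVlt; apply/orP; left; apply/eqP; field; rewrite gt_eqF.
  by rewrite ler_pM ?(ltW th0)// ?lerDr// ge_min lexx orbT.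
have [rb rb0 rbB] := unit_ellipsoid_bounded Gp.
have /choice[Cf CfP] : forall i, exists C, 0 < C /\ forall u : V, `|u *m invmx (Q i)| <= C * `|u|.
  by move=> i; have [C C0 CE] := mulmxr_bounded (invmx (Q i)); exists C.
(* One constant bounding the unit ellipsoid and all its preimages under the Q_i. *)
pose ce := rb * (1 + \sum_i Cf i).
have SC0 : 0 <= \sum_i Cf i by apply: sumr_ge0 => i _; apply: ltW; case: (CfP i).
have ce0 : 0 < ce by rewrite mulr_gt0// ltr_wpDr.
have Hp i : posdef (H i).
  by move=> w w0; apply: (mink_convex NM) => //; rewrite oppr_eq0.
have Gce e : qform G e e <= 1 -> `|e| <= ce.
  move=> /rbB/ltW er; apply: le_trans er _.
  by rewrite ler_peMr ?(ltW rb0)// lerDl.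
have Qce i y : qform G (y *m Q i) (y *m Q i) <= 1 -> `|y| <= ce.
  move=> /rbB/ltW yr; have [C0 /(_ (y *m Q i))] := CfP i.
  rewrite mulmxK ?ratio_form_unitmx// => h; apply: le_trans h _.
  rewrite mulrC ler_pM ?(ltW C0)//.
  rewrite (bigD1 i)//= addrCA lerDl addr_ge0// sumr_ge0// => j _.
  by apply: ltW; case: (CfP j).
have th01 : 0 < th <= 1 by rewrite th0.
have /choice[df dfP] : forall i, exists d0, 0 < d0 /\ forall (d : R) (u y : V), 0 < d < d0 ->
    (forall e, qform G e e <= 1 -> `|e| <= ce) -> `|y| <= ce ->
    qform G (y *m Q i) (y *m Q i) <= 1 -> ((1 + th) * d) ^+ 2 <= qform G u u ->
    gain N G (- x i) th d u <=
    E (u - (x i + d *: y)) - E ((d / Num.sqrt (qform G u u)) *: u - (x i + d *: y)).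
  by move=> i; have [d0 d00 dE] := gain_le NM (x0 i) Gp Gs ce0 th01; exists d0.
(* Halving makes [d] strictly smaller than every threshold [df i]. *)
pose d := Num.min 1 (\big[Num.min/1]_i df i) / 2.
have dm0 : 0 < \big[Num.min/1]_i df i.
  by apply/bigmin_gtP; split => // i _; case: (dfP i).
have d0 : 0 < d by rewrite /d divr_gt0// lt_min ltr01 dm0.
have d1 : d <= 1.
  by rewrite ler_pdivrMr// mul1r (@le_trans _ _ 1)// ?ler1n// ge_min lexx.
have dd i : 0 < d < df i.
  rewrite d0/= ltr_pdivrMr// (@le_lt_trans _ _ (df i))//.
    by rewrite ge_min bigmin_le_cond// orbT.
  by rewrite ltr_pMr ?ltr1n//; case: (dfP i).
pose s0 := \sum_i `|x i| + 2 * ce + 1.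
have Sx0 : 0 <= \sum_i `|x i| by exact: sumr_ge0.
have xs0 i : `|x i| + ce < s0.
  have : `|x i| <= \sum_i `|x i| by rewrite (bigD1 i)//= lerDl sumr_ge0.
  by rewrite /s0; lra.
have ces0 : 2 * ce < s0 by rewrite /s0; lra.
have s00 : 0 < s0 by lra.
have [cN cN0 NcN] := mink_upper NM.
pose D0 := 4 * cN * s0.
have D00 : 0 < D0 by rewrite !mulr_gt0.
(* Chosen so that [r_large] holds with equality. *)
pose r := s0 + 2 * (D0 + 1) / cf.
have s0r : s0 < r by rewrite /r ltrDl divr_gt0// mulr_gt0// addr_gt0.
have r_large : 4 * cN * s0 + 1 <= cf * (r - s0) / 2.
  by rewrite le_eqVlt; apply/orP; left; apply/eqP; rewrite /r /D0; field; rewrite gt_eqF.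
have r0 : 0 < r by lra.
pose gam := th ^+ 2 * d ^+ 2 / 4.
have gam0 : 0 < gam by rewrite divr_gt0// mulr_gt0 ?exprn_gt0.
have C0 : 0 < 6 * (2 * r * cN) ^+ 2 by rewrite mulr_gt0// exprn_gt0// !mulr_gt0.
(* The last bound makes the metric error of the blowup smaller than the gain [gam], which depends on
   [th] and [d]. *)
pose tau := Num.min 2^-1 (Num.min (b / 16) (gam / (6 * (2 * r * cN) ^+ 2))).
have tau0 : 0 < tau by rewrite /tau !lt_min; apply/and3P; split; [rewrite invr_gt0|exact: divr_gt0|exact: divr_gt0].
have tau1 : tau <= 2^-1 by rewrite /tau ge_min lexx.
have taub : tau <= b / 16 by rewrite /tau !ge_min lexx !orbT.
have tau_small : 6 * tau * (2 * r * cN) ^+ 2 <= gam.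
  have : tau <= gam / (6 * (2 * r * cN) ^+ 2) by rewrite /tau !ge_min lexx !orbT.
  by rewrite ler_pdivlMr// mulrCA mulrA.
pose eta0 := Num.min 1 (b / (4 * (`|K| + 1) * D0 ^+ 2)).
have KD : 0 < 4 * (`|K| + 1) * D0 ^+ 2 by rewrite !mulr_gt0 ?exprn_gt0// ltr_wpDl.
have eta00 : 0 < eta0 by rewrite /eta0 lt_min ltr01 divr_gt0.
have tau01 : 0 < tau < 1 by rewrite tau0/=; lra.
have [eta [kappa [f [g [etaS bu]]]]] := blowups tau01 r0 eta00.
have eta_gt0 := blowup_eta bu.
have eta1 : eta <= 1 by apply: ltW; apply: lt_le_trans etaS _; rewrite /eta0 ge_min lexx.
have KD' : `|K| / 2 * (eta * D0) ^+ 2 <= b / 4.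
  have h : eta * (4 * (`|K| + 1) * D0 ^+ 2) <= b.
    rewrite -ler_pdivlMr//; apply: ltW; apply: lt_le_trans etaS _.
    by rewrite /eta0 ge_min lexx orbT.
  have h2 : eta ^+ 2 * (`|K| * D0 ^+ 2) <= eta * ((`|K| + 1) * D0 ^+ 2).
    apply: ler_pM; first exact: sqr_ge0.
    - by rewrite mulr_ge0// sqr_ge0.
    - by rewrite expr2 ler_piMr// ltW.
    by rewrite ler_wpM2r ?sqr_ge0// lerDl.
  have h3 : 0 <= eta ^+ 2 * (`|K| * D0 ^+ 2).
    by apply: mulr_ge0; [exact: sqr_ge0|apply: mulr_ge0; [exact: normr_ge0|exact: sqr_ge0]].
  have -> : `|K| / 2 * (eta * D0) ^+ 2 = eta ^+ 2 * (`|K| * D0 ^+ 2) / 2 by ring.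
  have : eta * ((`|K| + 1) * D0 ^+ 2) <= b / 4 by rewrite ler_pdivlMr//; lra.
  by lra.
have gainE i u y : `|y| <= ce -> qform G (y *m Q i) (y *m Q i) <= 1 ->
    ((1 + th) * d) ^+ 2 <= qform G u u ->
    gain N G (- x i) th d u <=
    E (u - (x i + d *: y)) - E ((d / Num.sqrt (qform G u u)) *: u - (x i + d *: y)).
  by move=> yc yQ qu; case: (dfP i) => _; apply.
have gain_avg u : ((1 + th) * d) ^+ 2 <= qform G u u ->
    gam <= \sum_i lambda i * gain N G (- x i) th d u.
  exact: gain_average.
have sb i u : source_ball N x G d i u -> `|u| < s0.
  exact: (source_ball_bound d0 d1 Qce xs0).
have tb u : target_ball G th d u -> `|u| < s0.
  exact: (target_ball_bound th0 th1 d0 d1 ce0 Gce ces0).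
have [bB bB0 bBE] := ellipsoid_volume Gp lebL.
have LA i : (0 < L (source_ball N x G d i) < +oo)%E.
  by rewrite source_ball_volume// bBE -EFinM lte_fin ltry andbT !mulr_gt0// exprn_gt0.
have LW : (0 < L (target_ball G th d) < +oo)%E.
  rewrite target_ball_volume// bBE -EFinM lte_fin ltry andbT mulr_gt0// exprn_gt0//.
  by rewrite mulr_gt0// addr_gt0.
have BM := blowup_brunn_minkowski bcd scM NM lam0 lam1 x0 Gp bu tau0 tau1 th0 th1 d0 d1
  ce0 cN0 s0r NcN Gce Qce xs0 ces0 gainE gam0 gain_avg tau_small r_large LA LW.
have tau01' : 0 < tau <= 2^-1 by rewrite tau0.
have := blowup_volume_le bu tau01' th0 d0 (fun i u h => lt_trans (sb i u h) s0r)
  (fun u h => lt_trans (tb u h) s0r) BM.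
rewrite -/b -/D0; lra.
Qed.

End volume_factors.

Lemma qform_inj (R : realType) (n : nat) (G H : 'M[R]_n) : G^T = G -> H^T = H ->
  (forall w, qform G w w = qform H w w) -> G = H.
Proof.
move=> Gs Hs GH; have D (M : 'M[R]_n) i j : qform M (delta_mx 0 i) (delta_mx 0 j) = M i j.
  by rewrite /qform -rowE trmx_delta -colE !mxE.
apply/matrixP => i j; rewrite -!D.
have := GH (delta_mx 0 i + delta_mx 0 j).
rewrite (qform_sqD _ _ Gs) (qform_sqD _ _ Hs) !GH; lra.
Qed.

(** * The Hessian of the energy is constant *)

Section hessian_constant.
Variables (R : realType) (n : nat) (M : ptopologicalType).
Local Notation V := 'rV[R]_n.
Variables (D : M -> M -> \bar R) (m : {measure set (borel M) -> \bar R}) (K : R).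
Hypotheses (bcd : BCD D m K) (scM : @second_countable M).
Variables (L : {measure set (borel V) -> \bar R}) (N : V -> R) (cf : R).
Hypotheses (NM : minkowski_norm N) (lebL : is_lebesgue L).
Local Notation E := (energy N).
Hypothesis cf0 : 0 < cf.
Hypothesis blowups : forall tau r eta0 : R, 0 < tau < 1 -> 0 < r -> 0 < eta0 ->
  exists eta kappa f g, eta < eta0 /\ blowup D m L N cf tau r eta kappa f g.

Lemma energy_hessianN v : v != 0 -> hessian E (- v) = hessian E v.
Proof.
move=> v0; apply: qform_inj; try exact: hessian_sym.
by move=> w; exact: (hessianN NM).
Qed.

(* At [v], [- v], [w], [- w] with equal weights the differentials of the even function [E] cancel. *)
Lemma energy_hessian_constant v w : v != 0 -> w != 0 -> hessian E v = hessian E w.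
Proof.
move=> v0 w0; apply/eqP/negPn/negP => H12.
set H1 := hessian E v in H12; set H2 := hessian E w in H12.
have s1 : H1^T = H1 by exact: hessian_sym.
have s2 : H2^T = H2 by exact: hessian_sym.
have p1 : posdef H1 by move=> u; exact: (mink_convex NM).
have p2 : posdef H2 by move=> u; exact: (mink_convex NM).
have Gp := mean_form_posdef p1 p2; have Gs := mean_form_sym s1 s2.
set G := mean_form H1 H2 in Gp Gs.
have [c1 c10 c1E] := lebesgue_linear lebL (ratio_form_unitmx Gp p1).
have [c2 c20 c2E] := lebesgue_linear lebL (ratio_form_unitmx Gp p2).
have gap := volume_gap s1 s2 p1 p2 lebL H12 c10 c20 c1E c2E.
have c1_gt0 : 0 < c1.
  by rewrite lt_neqAle c10 andbT; apply: contraTneq gap => <-; rewrite mul0r ltr10.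
have c2_gt0 : 0 < c2.
  by rewrite lt_neqAle c20 andbT; apply: contraTneq gap => <-; rewrite mulr0 ltr10.
pose x (i : 'I_4) : V := nth 0 [:: v; - v; w; - w] i.
pose c (i : 'I_4) : R := nth 0 [:: c1; c1; c2; c2] i.
have x0 i : x i != 0.
  by rewrite /x; case: i => -[|[|[|[|//]]]] ? /=; rewrite ?oppr_eq0.
have HE i : hessian E (- x i) = nth (0 : 'M[R]_n) [:: H1; H1; H2; H2] i.
  rewrite /x; case: i => -[|[|[|[|j]]]] lti; last by exfalso.
  - exact: energy_hessianN.
  - exact: (congr1 (hessian E) (opprK v)).
  - exact: energy_hessianN.
  - exact: (congr1 (hessian E) (opprK w)).
have : \sum_i 4^-1 * ln (c i) <= 0.
  apply: (@volume_factors_le R n M D m K bcd scM L N cf NM lebL 4 (fun=> 4^-1) x G _ _ x0 Gp Gs c).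
  - by move=> _; rewrite invr_gt0.
  - by rewrite sumr_const card_ord -[_ *+ 4]mulr_natl mulfV.
  - by rewrite /c; case=> -[|[|[|[|//]]]].
  - move=> i; rewrite HE /c; case: i => -[|[|[|[|j]]]] lti; last by exfalso.
    + exact: c1E.
    + exact: c1E.
    + exact: c2E.
    + exact: c2E.
  - exact: cf0.
  - exact: blowups.
  - move=> u; rewrite !big_ord_recl big_ord0 /x/= !opprK !(derive_energyN NM)//; ring.
  - move=> u; rewrite (eq_bigr (fun i : 'I_4 => 4^-1 *
      qform (nth (0 : 'M[R]_n) [:: H1; H1; H2; H2] i) u u)); last by move=> i _; rewrite HE.
    rewrite mean_formE; move: H1 H2 {p1 p2 s1 s2 H12 G Gp Gs c1E c2E gap HE} => H1 H2.
    by rewrite !big_ord_recl big_ord0 /=; lra.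
(* The inequality just obtained reads ln (c1 c2) / 2 <= 0, against the volume gap. *)
have := ln_gt0 gap; rewrite lnM ?posrE// !big_ord_recl big_ord0 /c/=; lra.
Qed.

End hessian_constant.

Lemma open_setX (X Y : topologicalType) (U : set X) (W : set Y) :
  open U -> open W -> open (U `*` W).
Proof.
rewrite !openE => oU oW -[x y] [/= Ux Wy]; exists (U, W) => //=.
by split; [exact: oU|exact: oW].
Qed.

(** * The norm in a chart is a Minkowski norm *)

Section tangent_norm.
Variables (R : realType) (n : nat) (M : ptopologicalType).
Variable A : smooth_manifold R n M.
Local Notation V := 'rV[R]_n.
Local Notation dom i := (@chart_dom R n M A i).
Local Notation phi i := (@chart_map R n M A i).
Local Notation psi i := (@chart_inv R n M A i).
Local Notation chart_image := (@chart_image R n M A).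
Variable F : finsler_structure A.
Hypothesis Frev : reversible F.
Variables (i : chart A) (f : V * V -> R).
Hypothesis fE : forall x (v : tangent A x), dom i x -> v != 0 -> F x v = f (phi i x, v i).
Hypothesis fs : smooth_on (chart_image i `*` [set v | v != 0]) f.

Let oU : open (chart_image i `*` [set v : V | v != 0]).
Proof. by apply: open_setX; [exact: chart_image_open|exact: neq0_open]. Qed.

Lemma cnormE y (yi : chart_image i y) w :
  cnorm f y w = F (psi i y) (tangent_of (chart_invP yi).1 w).
Proof.
by rewrite (finsler_cnorm fE) ?tangent_ofK ?(chart_invP yi).2//; exact: (chart_invP yi).1.
Qed.

Lemma cnorm0 y : cnorm f y 0 = 0.
Proof. by rewrite /cnorm eqxx. Qed.

Lemma cnormZ y a w : chart_image i y -> 0 < a -> cnorm f y (a *: w) = a * cnorm f y w.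
Proof.
move=> yi a0; rewrite !(cnormE yi) -finsler_homogeneous//; congr (F _ _).
apply: (tangent_inj (chart_invP yi).1).
by apply: (etrans (tangent_ofK _ _)); rewrite tcoordZ; congr (_ *: _); rewrite tangent_ofK.
Qed.

Lemma cnormN y w : chart_image i y -> cnorm f y (- w) = cnorm f y w.
Proof.
move=> yi; rewrite !(cnormE yi) -[RHS]Frev; congr (F _ _).
apply: (tangent_inj (chart_invP yi).1).
by apply: (etrans (tangent_ofK _ _)); rewrite tcoordN; congr (- _); rewrite tangent_ofK.
Qed.

Lemma cnorm_slice_smooth y k : chart_image i y ->
  class_C k [set w : V | w != 0] (fun w => cnorm f y w ^+ 2 / 2).
Proof.
move=> yi; pose l (w : V) : V * V := (0, w).
have ll : linear l.
  by move=> a u w; apply/pair_equal_spec; split; rewrite //= scaler0 addr0.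
pose lin : {linear V -> (V * V)%type} := HB.pack l (GRing.isLinear.Build R V (V * V)%type *:%R l ll).
have cl : continuous lin.
  move=> w W [[W1 W2] [/= h1 h2] WW]; apply: filterS h2 => u W2u; apply: WW.
  by split => //; exact: nbhs_singleton h1.
have fC := class_C_comp_affine (y, 0) oU cl (fs k).
have lE w : (y, 0) + lin w = (y, w).
  by apply/pair_equal_spec; split; rewrite /= ?addr0 ?add0r.
have sE : [set w | (chart_image i `*` [set v : V | v != 0]) ((y, 0) + lin w)] = [set w : V | w != 0].
  under eq_set do rewrite lE.
  by apply/seteqP; split => w /= => [[]|w0].
rewrite sE in fC.
have fC2 := class_CZl (2^-1 : R) (@neq0_open R n) (class_CM (@neq0_open R n) fC fC).
apply: eq_class_C fC2; first exact: neq0_open.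
move=> w w0; rewrite /cnorm (negbTE w0) expr2.
by rewrite [LHS](_ : _ = f ((y, 0) + lin w) * f ((y, 0) + lin w) / 2)// lE.
Qed.

Lemma cnorm_minkowski p : chart_image i p -> minkowski_norm (cnorm f p).
Proof.
move=> pi; set N := cnorm f p; pose E w := N w ^+ 2 / 2.
have E2 : class_C 2 [set w : V | w != 0] E by exact: cnorm_slice_smooth.
set xp := psi i p; have xpi : dom i xp := (chart_invP pi).1.
have strong v w : v != 0 -> w != 0 -> 0 < derive1n 2 (fun s : R => E (v + s *: w)) 0.
  move=> v0 w0.
  have h u : (tangent_of xpi u == 0) = (u == 0) by rewrite -(tcoord_eq0 _ xpi) tangent_ofK.
  have := @finsler_strongly_convex _ _ _ _ F xp (tangent_of xpi v) (tangent_of xpi w).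
  rewrite !h => /(_ v0 w0).
  suff -> : (fun s : R => E (v + s *: w)) =
    (fun s => F xp (tangent_of xpi v + s *: tangent_of xpi w) ^+ 2 / 2) by [].
  apply/funext => s.
  rewrite /E /N (finsler_cnorm fE)// tcoordD tcoordZ !tangent_ofK.
  by rewrite (chart_invP pi).2.
have d2 v w : v != 0 -> derive1n 2 (fun s : R => E (v + s *: w)) 0 = qform (hessian E v) w w.
  move=> v0.
  have near0 : \forall s \near (0 : R), v + s *: w != 0.
    have cl : {for 0, continuous (fun s : R => v + s *: w)}.
      apply: continuousD; first exact: cst_continuous.
      by apply: continuousZr_tmp; exact: cvg_id.
    have nv : nbhs (v + 0 *: w) [set u : V | u != 0].
      by rewrite scale0r addr0; apply: open_nbhs_nbhs; split => //; exact: neq0_open.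
    exact: (cl _ nv).
  have dE : \forall s \near (0 : R), derive1 (fun s : R => E (v + s *: w)) s = 'D_w E (v + s *: w).
    apply: filterS near0 => s s0; rewrite derive1E.
    have dd : derivable E (v + s *: w) w by exact: (diff_derivable (E2.1 _ s0)).
    by have [] := is_derive_line (derivableP dd).
  rewrite -(derive2_hessian w (@neq0_open R n) v0 E2).
  rewrite /derive1n /= derive1E.
  have dd : derivable ('D_w E) v w by exact: (diff_derivable ((E2.2 w).1 _ v0)).
  have [_ <-] := is_derive_line0 dd.
  by apply: near_eq_derive.
have N0 : N 0 = 0 by exact: cnorm0.
split => //.
(* If [N w] were 0, then by homogeneity and reversibility the energy would vanish on the whole line
   through [w], contradicting strong convexity at [w] in the direction [w]. *)
- move=> w w0; have Nw : 0 <= N w by rewrite /N (cnormE pi); exact: finsler_ge0.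
  rewrite lt_neqAle Nw andbT; apply/eqP => Nw0.
  have := strong w w w0 w0.
  have -> : (fun s : R => E (w + s *: w)) = cst 0; last first.
    have c0 : derive1 (cst 0 : R -> R) = cst 0 by apply/funext => s; exact: derive1_cst.
    by rewrite /derive1n/= !c0 ltxx.
  apply/funext => s; rewrite /E -{1}[w]scale1r -scalerDl.
  suff -> : N ((1 + s) *: w) = 0 by rewrite expr0n/= mul0r.
  have [s0|s0|->] := ltgtP (1 + s) 0; last by rewrite scale0r.
    by rewrite /N -[_ *: w]opprK cnormN// -scaleNr cnormZ ?oppr_gt0// -/N -Nw0 mulr0.
  by rewrite /N cnormZ// -/N -Nw0 mulr0.
- by move=> a w; exact: cnormZ.
- by move=> w; exact: cnormN.
- by move=> v w v0 w0; rewrite -d2//; exact: strong.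
Qed.

End tangent_norm.

(** * Norm and measure near a point of a chart *)

Section small_scale.
Variables (R : realType) (n : nat) (M : ptopologicalType).
Variable A : smooth_manifold R n M.
Local Notation V := 'rV[R]_n.
Local Notation dom i := (@chart_dom R n M A i).
Local Notation phi i := (@chart_map R n M A i).
Local Notation psi i := (@chart_inv R n M A i).
Local Notation chart_image := (@chart_image R n M A).
Variable F : finsler_structure A.
Hypothesis Frev : reversible F.
Variables (i : chart A) (f : V * V -> R).
Hypothesis fE : forall x (v : tangent A x), dom i x -> v != 0 -> F x v = f (phi i x, v i).
Hypothesis fs : smooth_on (chart_image i `*` [set v | v != 0]) f.
Variable p : V.
Hypothesis pi : chart_image i p.
Local Notation N := (cnorm f p).

Let NM : minkowski_norm N. Proof. exact: (cnorm_minkowski Frev fE fs). Qed.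

(** Compactness of the unit sphere makes the continuity of [f] in the base point uniform in the
    direction; homogeneity and the lower bound of [N] on the sphere turn this into a multiplicative
    estimate. *)
Lemma cnorm_near (tau : R) : 0 < tau ->
  exists2 rho : R, 0 < rho & forall y, `|y - p| < rho -> chart_image i y /\
    forall w, (1 - tau) * N w <= cnorm f y w <= (1 + tau) * N w.
Proof.
move=> tau0; have [c c0 cN] := mink_lower NM.
have tc : 0 < tau * c by rewrite mulr_gt0.
have cov := (compact_near_coveringP (@sphere R n)).1 (@sphere_compact R n).
have : \forall y \near p, chart_image i y /\ (@sphere R n `<=` (fun w => `|f (y, w) - f (p, w)| < tau * c)).
  apply: filterI; first by apply: open_nbhs_nbhs; split => //; exact: chart_image_open.
  apply: (cov V (nbhs p)) => w sw.
  have w0 := sphere_neq0 sw.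
  have cf : {for (p, w), continuous f} by exact: (fs 0%N).
  have h2 : 0 < tau * c / 2 by rewrite divr_gt0.
  have /cvgrPdist_lt/(_ _ h2)[[B1 B2] [/= pB wB] BB] := cf.
  exists (B2, B1) => // -[w' y] [/= w'B yB].
  have b1 := BB (y, w') (conj yB w'B); have b2 := BB (p, w') (conj (nbhs_singleton pB) w'B).
  move: b1 b2; rewrite /= => b1 b2.
  have -> : f (y, w') - f (p, w') = (f (p, w) - f (p, w')) - (f (p, w) - f (y, w')) by ring.
  by rewrite (le_lt_trans (ler_normB _ _))//; lra.
move=> /nbhs_ballP[rho /= rho0 H]; exists rho => // y yp.
have [yi sy] : _ /\ _ := H y ltac:(by rewrite -ball_normE/= distrC).
split => // w; have [->|w0] := eqVneq w 0; first by rewrite !cnorm0 !mulr0 lexx.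
have nw : 0 < `|w| by rewrite normr_gt0.
have sw := sphere_normalize w0; have u0 := sphere_neq0 sw.
set u := `|w|^-1 *: w in sw u0.
have -> : w = `|w| *: u by rewrite scalerA mulfV ?scale1r// gt_eqF.
clearbody u.
rewrite !(cnormZ fE)// [(1 - tau) * _]mulrCA [(1 + tau) * _]mulrCA !ler_pM2l//.
have := sy u sw; have := cN u; rewrite (_ : `|u| = 1)// mulr1.
rewrite /cnorm (negbTE u0) => cu; rewrite ltr_norml => /andP[h1 h2].
by apply/andP; split; nra.
Qed.

Section measure.
Variables (m : {measure set (borel M) -> \bar R}) (L : {measure set (borel V) -> \bar R}).
Variable rho : V -> R.
Hypothesis rhos : smooth_on (chart_image i) rho.
Hypothesis rho0 : forall y, chart_image i y -> 0 < rho y.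
Hypothesis rhoE : forall B : set (borel M), measurable B -> B `<=` dom i ->
  m B = (\int[L]_(y in phi i @` B) (rho y)%:E)%E.

Lemma chart_inv_image (Y : set V) : Y `<=` chart_image i ->
  psi i @` Y = dom i `&` phi i @^-1` Y.
Proof.
move=> Yi; apply/seteqP; split => [_ [y Yy <-]|x [xi Yx]].
  by have [h1 h2] := chart_invP (Yi _ Yy); split; rewrite //= h2.
by exists (phi i x) => //; exact: chart_mapK.
Qed.

Lemma chart_inv_measurable (Y : set V) : measurable (Y : set (borel V)) ->
  Y `<=` chart_image i -> measurable (psi i @` Y : set (borel M)).
Proof.
move=> mY Yi; rewrite chart_inv_image//.
have := @borel_measurable_fun M V (dom i) (phi i) (chart_dom_open i)
  (fun x xi => chart_map_continuous xi).
by apply => //; apply: borel_open; exact: chart_dom_open.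
Qed.

Lemma measure_near (tau : R) : 0 < tau ->
  exists2 r : R, 0 < r & forall Y : set (borel V), measurable Y ->
    (forall y, Y y -> `|y - p| < r) ->
    (((1 - tau) * rho p)%:E * L Y <= m (psi i @` Y) <= ((1 + tau) * rho p)%:E * L Y)%E.
Proof.
move=> tau0; have rp := rho0 pi.
have e0 : 0 < tau * rho p by rewrite mulr_gt0.
have crho : {for p, continuous rho} by exact: (rhos 0%N).
have : \forall y \near p, chart_image i y /\ `|rho p - rho y| < tau * rho p.
  apply: filterI; first by apply: open_nbhs_nbhs; split => //; exact: chart_image_open.
  by have /cvgrPdist_lt/(_ _ e0) := crho.
move=> /nbhs_ballP[r /= r0 H]; exists r => // Y mY Yr.
have HY y : Y y -> chart_image i y /\ `|rho p - rho y| < tau * rho p.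
  by move=> /Yr yr; apply: H; rewrite -ball_normE/= distrC.
have Yi : Y `<=` chart_image i by move=> y /HY[].
have YE : phi i @` (psi i @` Y) = Y.
  apply/seteqP; split => [_ [_ [y Yy <-] <-]|y Yy]; first by rewrite (chart_invP (Yi _ Yy)).2.
  by exists (psi i y); [exists y|exact: (chart_invP (Yi _ Yy)).2].
have mrho : measurable_fun (Y : set (borel V)) (EFin \o rho : borel V -> \bar R).
  apply/measurable_EFinP; apply: (@measurable_funS _ _ (borel V) _ (chart_image i)) => //.
    by apply: borel_open; exact: chart_image_open.
  apply: borel_measurable_real; first exact: chart_image_open.
  by move=> y yi; exact: (rhos 0%N).
rewrite rhoE; last 2 first.
- exact: chart_inv_measurable.
- by move=> _ [y Yy <-]; exact: (chart_invP (Yi _ Yy)).1.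
rewrite YE -!integral_cst//.
have [t1|t1] := leP tau 1.
  apply/andP; split; apply: ge0_le_integral => //.
  - by move=> y _; rewrite lee_fin mulr_ge0 ?subr_ge0// ltW.
  - by move=> y Yy; have [_] := HY y Yy; rewrite lee_fin ltr_norml => /andP[_ ?]; lra.
  - by move=> y Yy; rewrite lee_fin; apply: ltW; apply: rho0; exact: Yi.
  - by move=> y Yy; have [_] := HY y Yy; rewrite lee_fin ltr_norml => /andP[? _]; lra.
(* Here 1 - tau is negative and the lower bound is trivial. *)
apply/andP; split.
  apply: (@le_trans _ _ 0%E).
    rewrite integral_cst//= mule_le0_ge0// lee_fin nmulr_rle0 ?ltW//; lra.
  by apply: integral_ge0 => y Yy; rewrite lee_fin; apply: ltW; apply: rho0; exact: Yi.
apply: ge0_le_integral => //.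
- by move=> y Yy; rewrite lee_fin; apply: ltW; apply: rho0; exact: Yi.
- by move=> y Yy; have [_] := HY y Yy; rewrite lee_fin ltr_norml => /andP[? _]; lra.
Qed.

End measure.
End small_scale.

(** * Existence of blowups of a Finsler manifold *)

Section blowups.
Variables (R : realType) (n : nat) (M : ptopologicalType).
Variable A : smooth_manifold R n M.
Local Notation V := 'rV[R]_n.
Local Notation dom i := (@chart_dom R n M A i).
Local Notation phi i := (@chart_map R n M A i).
Local Notation psi i := (@chart_inv R n M A i).
Local Notation chart_image := (@chart_image R n M A).
Variable F : finsler_structure A.
Hypothesis Frev : reversible F.
Variables (i : chart A) (f : V * V -> R).
Hypothesis fE : forall x (v : tangent A x), dom i x -> v != 0 -> F x v = f (phi i x, v i).
Hypothesis fs : smooth_on (chart_image i `*` [set v | v != 0]) f.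
Variable p : V.
Hypothesis pi : chart_image i p.
Local Notation N := (cnorm f p).
Variables (m : {measure set (borel M) -> \bar R}) (L : {measure set (borel V) -> \bar R}).
Hypothesis lebL : is_lebesgue L.
Variable dens : V -> R.
Hypothesis denss : smooth_on (chart_image i) dens.
Hypothesis dens0 : forall y, chart_image i y -> 0 < dens y.
Hypothesis densE : forall B : set (borel M), measurable B -> B `<=` dom i ->
  m B = (\int[L]_(y in phi i @` B) (dens y)%:E)%E.

Let NM : minkowski_norm N. Proof. exact: (cnorm_minkowski Frev fE fs). Qed.

(** The blowup is u |-> psi (p + eta u), with volume scale [dens p * eta ^+ n]. For small [eta] the
    image ball lies where the norm and the density are within [tau] of their values at [p]. *)
Lemma finsler_blowups : exists2 cf : R, 0 < cf &
  forall tau r eta0 : R, 0 < tau < 1 -> 0 < r -> 0 < eta0 ->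
  exists eta kappa g h, eta < eta0 /\ blowup (finsler_dist F) m L N cf tau r eta kappa g h.
Proof.
have [c0 c00 Nc0] := mink_lower NM; have [cN cN0 NcN] := mink_upper NM.
exists c0 => // tau r eta0 /andP[tau0 tau1] r0 eta00.
have [rho rho0 near_p] := cnorm_near Frev fE fs pi tau0.
have [rm rm0 measure_p] := measure_near pi denss dens0 densE tau0.
(* Room around the ball: c0 (r' - r) = 2 r cN bounds [N] on differences of vectors of norm less than
   [r], so a curve leaving the larger ball satisfies the lower bound wanted between two points of
   the smaller one. *)
pose r' := r + 2 * r * cN / c0.
have r'r : r < r' by rewrite ltrDl divr_gt0// !mulr_gt0.
have r'0 : 0 < r' by exact: lt_trans r'r.
pose rr := Num.min rho rm.
have rr0 : 0 < rr by rewrite /rr lt_min rho0.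
pose eta := Num.min (eta0 / 2) (rr / (2 * r')).
have eta_gt0 : 0 < eta.
  by rewrite /eta lt_min; apply/andP; split; apply: divr_gt0 => //; rewrite mulr_gt0.
have etaS : eta < eta0.
  by rewrite /eta; apply: (@le_lt_trans _ _ (eta0 / 2)); [rewrite ge_min lexx|lra].
have eta_r' : eta * r' < rr.
  apply: (@le_lt_trans _ _ (rr / 2)); last lra.
  have : eta <= rr / (2 * r') by rewrite /eta ge_min lexx orbT.
  by rewrite ler_pdivlMr ?mulr_gt0//; lra.
have eta_rho : eta * r' < rho by apply: lt_le_trans eta_r' _; rewrite /rr ge_min lexx.
have eta_rm : eta * r' < rm by apply: lt_le_trans eta_r' _; rewrite /rr ge_min lexx orbT.
have rho_codom y : `|y - p| < rho -> chart_image i y by move=> /near_p[].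
have tau01 : 0 <= tau < 1 by rewrite tau1 ltW.
have Nle y w : `|y - p| < rho -> (1 - tau) * N w <= cnorm f y w.
  by move=> /near_p[_ /(_ w)/andP[]].
have Nge y w : `|y - p| < rho -> cnorm f y w <= (1 + tau) * N w.
  by move=> /near_p[_ /(_ w)/andP[]].
have Nsupp := mink_support NM.
pose a u : V := p + eta *: u.
have aE u : `|a u - p| = eta * `|u|.
  by rewrite /a [p + _]addrC addrK normrZ gtr0_norm.
have aB u w : N (a w - a u) = eta * N (w - u).
  have -> : a w - a u = eta *: (w - u).
    by rewrite /a opprD addrACA subrr add0r scalerBr.
  by rewrite (minkZ NM).
have a_lt s u : `|u| < s -> `|a u - p| < eta * s by rewrite aE ltr_pM2l.
have er : eta * r < eta * r' by rewrite ltr_pM2l.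
have ar u : `|u| < r -> `|a u - p| < rho by move=> /a_lt ?; lra.
pose g u := psi i (a u); pose h z : V := eta^-1 *: (phi i z - p).
have aK y : a (eta^-1 *: (y - p)) = y.
  by rewrite /a scalerA mulfV ?gt_eqF// scale1r addrC subrK.
have Ka u : eta^-1 *: (a u - p) = u.
  by rewrite /a [p + _]addrC addrK scalerA mulVf ?gt_eqF// scale1r.
have img (Y : set V) : g @` Y = psi i @` [set y | Y (eta^-1 *: (y - p))].
  apply/seteqP; split => [_ [u Yu <-]|_ [y /= Yy <-]]; first by exists (a u); rewrite //= Ka.
  by exists (eta^-1 *: (y - p)) => //; rewrite /g aK.
have ballE s : [set y | `|eta^-1 *: (y - p)| < s] = [set y | `|y - p| < eta * s].
  apply/funext => y; rewrite /mkset normrZ normfV (gtr0_norm eta_gt0) [_^-1 * _]mulrC.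
  by rewrite ltr_pdivrMr// [s * eta]mulrC.
have ball_image : [set y | `|y - p| < eta * r] `<=` chart_image i.
  by move=> y /= yr; apply: rho_codom; lra.
exists eta, (dens p * eta ^+ n), g, h; split; first exact: etaS.
apply: Blowup.
- exact: eta_gt0.
- by rewrite mulr_gt0 ?dens0// exprn_gt0.
- move=> u ur; have ca : {for u, continuous a}.
    apply: continuousD; first exact: cst_continuous.
    exact: scaler_continuous.
  by apply: (continuous_comp ca); apply: chart_inv_cont; apply: rho_codom; exact: ar.
- rewrite img ballE chart_inv_image//; apply: open_preimageI; first exact: chart_dom_open.
    by move=> x xi; exact: chart_map_continuous.
  have -> : [set y | `|y - p| < eta * r] = ball p (eta * r).
    by apply/seteqP; split => y; rewrite -ball_normE/= distrC.
  exact: ball_open.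
- by move=> u /ar/rho_codom/chart_invP[_ ui]; rewrite /h /g ui Ka.
- move=> u /ar/rho_codom/chart_invP[ud _].
  have cp : {for g u, continuous (fun z => phi i z - p)}.
    by apply: continuousB; [exact: chart_map_continuous|exact: cst_continuous].
  exact: (continuous_comp cp (@scaler_continuous _ _ eta^-1 _)).
- move=> u w /ar ur /ar wr; rewrite -mulrA -aB.
  exact: (finsler_dist_le fE rho_codom Nge).
- move=> u w ur wr'; have wr := ar _ wr'; rewrite -mulrA -aB.
  have r1 : 0 < eta * r < eta * r' by rewrite mulr_gt0.
  apply: (finsler_dist_ge fE rho_codom tau01 Nle Nsupp Nc0 (ltW c00) (a_lt _ _ ur) wr r1 eta_rho).
  rewrite aB -mulrBr mulrCA ler_pM2l// /r' [r + _]addrC addrK [c0 * _]mulrC divfK ?gt_eqF//.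
  apply: le_trans (NcN _) _; rewrite mulrC ler_pM2r//.
  by rewrite (le_trans (ler_normB _ _))//; lra.
- move=> s u z us sr zU.
  have s0 : 0 < s by exact: le_lt_trans (normr_ge0 u) us.
  have r1 : 0 < eta * s < eta * r by rewrite mulr_gt0//= ltr_pM2l.
  have -> : (1 - tau) * c0 * eta * (r - s) = (1 - tau) * (c0 * (eta * r - eta * s)) by ring.
  apply: (finsler_dist_far fE rho_codom tau01 Nle Nsupp Nc0 (ltW c00) (a_lt _ _ us) r1).
    by lra.
  by move: zU; rewrite img ballE.
- move=> Y mY Yr; rewrite img.
  have ms : measurable_fun setT ((fun u : V => eta^-1 *: u) : borel V -> borel V).
    by apply: borel_measurable_fun; [exact: openT|move=> u _; exact: scaler_continuous].
  have mY1 := ms measurableT _ mY; rewrite setTI in mY1.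
  have mY2 := shift_measurable (- p) measurableT mY1; rewrite setTI in mY2.
  have LE : L [set y | Y (eta^-1 *: (y - p))] = ((eta ^+ n)%:E * L Y)%E.
    by rewrite -lebesgue_scale// -(lebesgue_translation_invariant lebL (- p) mY1).
  have := measure_p _ mY2; rewrite [L _]LE muleA -EFinM -!mulrA muleA -EFinM -!mulrA; apply.
  move=> y /Yr; have := ballE r => /seteqP[/(_ y)/= h1 _] /h1; lra.
Qed.

End blowups.

Lemma dot_product_of (R : realType) (U : lmodType R) (b : U -> U -> R) :
  (forall u v w a, b (a *: u + v) w = a * b u w + b v w) ->
  (forall u v, b u v = b v u) -> (forall u, u != 0 -> 0 < b u u) ->
  exists g : {dot U for idfun}, forall u v, g u v = b u v.
Proof.
move=> bl bC b0.
have bil : bilinear_for *%R (idfun \; *%R) b.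
  split => [w a u v|w a u v]; first exact: bl.
  by rewrite bC bl !(bC _ w).
have her u v : b u v = (-1) ^+ false * idfun (b v u) by rewrite expr0 mul1r bC.
pose g : {dot U for idfun} := HB.pack b
  (bilinear_isBilinear.Build R U U R *%R (idfun \; *%R) b bil)
  (isHermitianSesquilinear.Build R U false idfun b her)
  (isDotProduct.Build R U b b0).
by exists g.
Qed.

(** * The inner products and the smooth Riemannian metric *)

Section riemannian.
Variables (R : realType) (n : nat) (M : ptopologicalType).
Variable A : smooth_manifold R n M.
Local Notation V := 'rV[R]_n.
Local Notation dom i := (@chart_dom R n M A i).
Local Notation phi i := (@chart_map R n M A i).
Local Notation psi i := (@chart_inv R n M A i).
Local Notation chart_image := (@chart_image R n M A).
Variable F : finsler_structure A.
Hypothesis Frev : reversible F.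
Variables (m : {measure set (borel M) -> \bar R}) (K : R).
Hypothesis msmooth : smooth_positive_measure A m.
Hypothesis bcd : BCD (finsler_dist F) m K.

(** The constant Hessian of the energy is the required form, by Euler's relation. In dimension 0,
    where there is no nonzero vector to evaluate it at, the zero matrix serves. *)
Lemma finsler_norm_quadratic i x : dom i x -> exists H : 'M[R]_n,
  [/\ H^T = H, posdef H & forall v : tangent A x, F x v ^+ 2 = qform H (v i) (v i)].
Proof.
move=> xi; have [f [fs fE']] := finsler_smooth F i.
have fE (y : M) (v : tangent A y) : dom i y -> v != 0 -> F y v = f (phi i y, v i) by exact: fE'.
have [L lebL /(_ i)[dens [denss dens0 densE]]] := msmooth.
have pi : chart_image i (phi i x) by exists x.
pose N := cnorm f (phi i x).
have NM : minkowski_norm N by exact: (cnorm_minkowski Frev fE fs).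
have [cf cf0 blowups] := finsler_blowups Frev fE fs pi lebL denss dens0 densE.
have hess := energy_hessian_constant bcd (mfd_second_countable A) NM lebL cf0 blowups.
have [[w0 w00]|noV] := pselect (exists w : V, w != 0).
  exists (hessian (energy N) w0); split.
  - exact: hessian_sym.
  - by move=> w; exact: (mink_convex NM).
  move=> v; rewrite (finsler_cnorm fE)// -/N.
  have [->|v0] := eqVneq (v i) 0; first by rewrite (mink0 NM) expr0n qform0l.
  by rewrite -(hess _ _ v0 w00) (hessian_self NM).
exists 0; split; first by rewrite trmx0.
  by move=> w w0; case: noV; exists w.
move=> v; have v0 : v i = 0 by apply/eqP/negPn/negP => w0; apply: noV; exists (v i).
by rewrite (finsler_cnorm fE)// v0 cnorm0 expr0n qform0l.
Qed.

Definition polarization x (v w : tangent A x) : R :=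
  (F x (v + w) ^+ 2 - F x v ^+ 2 - F x w ^+ 2) / 2.

Lemma polarizationE i x (xi : dom i x) (H : 'M[R]_n) : H^T = H ->
  (forall v : tangent A x, F x v ^+ 2 = qform H (v i) (v i)) ->
  forall v w : tangent A x, polarization v w = qform H (v i) (w i).
Proof.
move=> Hs FH v w; rewrite /polarization !FH tcoordD (qform_sqD _ _ Hs); lra.
Qed.

Lemma finsler_dot_product x : exists g : {dot tangent A x for idfun},
  forall v w : tangent A x, g v w = polarization v w.
Proof.
have [i xi] := chart_dom_cover A x.
have [H [Hs Hp FH]] := finsler_norm_quadratic xi.
have pE := polarizationE xi Hs FH.
apply: dot_product_of.
- by move=> u v w a; rewrite !pE tcoordD tcoordZ qformDl qformZl.
- by move=> u v; rewrite !pE qformC.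
- by move=> u u0; rewrite pE; apply: Hp; rewrite tcoord_eq0.
Qed.

Definition finsler_metric x : {dot tangent A x for idfun} := projT1 (cid (finsler_dot_product x)).

Lemma finsler_metricE x v w : finsler_metric x v w = polarization v w.
Proof. exact: (projT2 (cid (finsler_dot_product x))). Qed.

Lemma finsler_norm_metric x v : F x v = Num.sqrt (finsler_metric x v v).
Proof.
have [i xi] := chart_dom_cover A x.
have [H [Hs Hp FH]] := finsler_norm_quadratic xi.
by rewrite finsler_metricE (polarizationE xi Hs FH) -FH sqrtr_sqr ger0_norm// finsler_ge0.
Qed.

Lemma cnorm_sq_smooth i f : smooth_on (chart_image i `*` [set v | v != 0]) f ->
  forall u, smooth_on (chart_image i) (fun y => cnorm f y u ^+ 2).
Proof.
move=> fs u k; have oi := @chart_image_open R n M A i.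
have [->|u0] := eqVneq u 0.
  have -> : (fun y => cnorm f y 0 ^+ 2) = cst 0.
    by apply/funext => y; rewrite cnorm0 expr0n.
  exact: class_C_cst.
pose l (y : V) : V * V := (y, 0).
have ll : linear l.
  by move=> a y w; apply/pair_equal_spec; split; rewrite //= scaler0 addr0.
pose lin : {linear V -> (V * V)%type} := HB.pack l (GRing.isLinear.Build R V (V * V)%type *:%R l ll).
have cl : continuous lin.
  move=> w W [[W1 W2] [/= h1 h2] WW]; apply: filterS h1 => y W1y; apply: WW.
  by split => //; exact: nbhs_singleton h2.
have oU : open (chart_image i `*` [set v : V | v != 0]).
  by apply: open_setX => //; exact: neq0_open.
have fC := class_C_comp_affine (0, u) oU cl (fs k).
have lE y : (0, u) + lin y = (y, u).
  by apply/pair_equal_spec; split; rewrite /= ?addr0 ?add0r.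
have sE : [set y | (chart_image i `*` [set v : V | v != 0]) ((0, u) + lin y)] = chart_image i.
  under eq_set do rewrite lE.
  by apply/seteqP; split => w /= => [[]|w0].
rewrite sE in fC.
apply: eq_class_C (class_CM oi fC fC) => // y yi; rewrite /cnorm (negbTE u0) expr2.
by rewrite [LHS](_ : _ = f ((0, u) + lin y) * f ((0, u) + lin y))// lE.
Qed.

Lemma finsler_metric_riemannian : riemannian_metric finsler_metric.
Proof.
move=> i; have [f [fs fE']] := finsler_smooth F i.
have fE (y : M) (v : tangent A y) : dom i y -> v != 0 -> F y v = f (phi i y, v i) by exact: fE'.
have oi := @chart_image_open R n M A i.
pose e (j : 'I_n) : V := delta_mx 0 j.
(* The coefficients are polarizations of the squared norm on the coordinate basis. For a fixed
   vector the squared norm is smooth in the base point, hence so are they. *)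
pose G y : 'M[R]_n := \sum_j \sum_k
  (2^-1 * (cnorm f y (e j + e k) ^+ 2 - cnorm f y (e j) ^+ 2 - cnorm f y (e k) ^+ 2)) *: delta_mx j k.
have GE y j k : G y j k =
    2^-1 * (cnorm f y (e j + e k) ^+ 2 - cnorm f y (e j) ^+ 2 - cnorm f y (e k) ^+ 2).
  rewrite /G summxE (bigD1 j)//= [X in _ + X]big1 ?addr0; last first.
    move=> j' jj; rewrite summxE big1// => k' _.
    by rewrite !mxE eq_sym (negbTE jj) mulr0.
  rewrite summxE (bigD1 k)//= [X in _ + X]big1 ?addr0; last first.
    move=> k' kk; rewrite !mxE [k == k']eq_sym (negbTE kk) andbF mulr0//.
  by rewrite !mxE !eqxx mulr1.
exists G; split.
  move=> r; rewrite -/(chart_image i); apply: class_C_sum => // j; apply: class_C_sum => // k.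
  apply: class_CZl => //; have sq u := cnorm_sq_smooth fs u r.
  have half := @class_C_cst R V R r (chart_image i) 2^-1.
  have neg := @class_C_cst R V R r (chart_image i) (-1).
  have C1 := class_CM oi half (class_CD oi (class_CD oi (sq (e j + e k))
    (class_CM oi neg (sq (e j)))) (class_CM oi neg (sq (e k)))).
  apply: eq_class_C C1 => // y _.
  rewrite [LHS](_ : _ = 2^-1 * (cnorm f y (e j + e k) ^+ 2 + (-1) * cnorm f y (e j) ^+ 2
    + (-1) * cnorm f y (e k) ^+ 2))//; ring.
move=> x v w xi; have [H [Hs Hp FH]] := finsler_norm_quadratic xi.
rewrite finsler_metricE (polarizationE xi Hs FH).
suff -> : G (phi i x) = H by [].
apply/matrixP => j k; rewrite GE.
have cE u : cnorm f (phi i x) u ^+ 2 = qform H u u.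
  by rewrite -[u in LHS](tangent_ofK xi) -(finsler_cnorm fE)// FH tangent_ofK.
rewrite !cE (qform_sqD _ _ Hs).
have -> : H j k = qform H (e j) (e k) by rewrite /qform -rowE trmx_delta -colE !mxE.
lra.
Qed.

End riemannian.

Theorem corollary1p3 (R : realType) (n : nat) (M : ptopologicalType)
    (A : smooth_manifold R n M) (F : finsler_structure A)
    (m : {measure set (borel M) -> \bar R}) (K : R) :
  reversible F ->
  smooth_positive_measure A m ->
  BCD (finsler_dist F) m K ->
  (forall x : M, induced_by_inner_product F x) /\ riemannian F.
Proof.
move=> Frev ms bcd; split.
  move=> x; exists (finsler_metric Frev ms bcd x).
  exact: finsler_norm_metric.
exists (finsler_metric Frev ms bcd); first exact: finsler_metric_riemannian.
exact: finsler_norm_metric.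
Qed.
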